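(* Let $1<p<\infty$. Let $(b_n)_{n\ge1}$ be a sequence of elements of the closed unit ball of $H^\infty$. Put $B_0=1$ and $B_n:=b_1b_2\cdots b_n$ for $n\ge1$. Assume that $\lim_{n\to\infty}B_n(z)=0$ for every $z\in\mathbb{D}$. Then for every $f\in H^p$, \[ f=\sum_{n=1}^{\infty}B_{n-1}\cdot Q_{b_n}T_{\bar B_{n-1}}f, \] where the series converges in $H^p$-norm.
   Context: $\mathbb{D}$ is the open unit disc and $\mathbb{T}$ the unit circle; $H^p$ ($1<p<\infty$) is the Hardy space on $\mathbb{D}$, identified with a closed subspace of $L^p(\mathbb{T})$ via boundary values, and $H^\infty$ is the space of bounded analytic functions on $\mathbb{D}$ with the sup norm. $P_+:L^p(\mathbb{T})\to H^p$ is the M. Riesz (Szegő) projection. For $\varphi\in L^\infty(\mathbb{T})$ the Toeplitz operator $T_\varphi:H^p\to H^p$ is $T_\varphi f=P_+(\varphi f)$; for $B\in H^\infty$, $\bar B$ denotes the complex conjugate of its boundary function, so $T_{\bar B}$ is a co-analytic Toeplitz operator. For $b$ in the closed unit ball of $H^\infty$, $P_b:=T_bT_{\bar b}$ and $Q_b:=I-P_b$ (so $P_bf=bT_{\bar b}f$). *)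

(* Defs.v *)
From HB Require Import structures.
From mathcomp Require Import all_boot all_algebra.
From mathcomp Require Import complex.
From mathcomp Require Import all_classical all_reals all_analysis.
From Stdlib Require Import ClassicalEpsilon.
Set Implicit Arguments. Unset Strict Implicit.
Import GRing.Theory Num.Theory.
Local Open Scope ring_scope.
Local Open Scope classical_set_scope.

(* The unit circle T is parametrized by t in [0, 2 pi[ via t |-> e^{it};
   a function on T is a function R -> R[i] of the parameter t (only its values
   on [0, 2 pi[ matter).  Lebesgue measure on [0, 2 pi[ is (up to the factor 2 pi)
   normalized arc length on T. *)
Definition tdom (R : realType) : set R := `[0, 2 * pi[.

Definition cabs (R : realType) (z : R[i]) : R :=
  Num.sqrt (complex.Re z ^+ 2 + complex.Im z ^+ 2).

Definition expi (R : realType) (t : R) : R[i] := (cos t +i* sin t)%C.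

Definition cmeas (R : realType) (f : R -> R[i]) : Prop :=
  measurable_fun (@tdom R) (fun x => complex.Re (f x)) /\
  measurable_fun (@tdom R) (fun x => complex.Im (f x)).

Definition cint (R : realType) (f : R -> R[i]) : R[i] :=
  (Rintegral (@lebesgue_measure R) (@tdom R) (fun x => complex.Re (f x))
   +i* Rintegral (@lebesgue_measure R) (@tdom R) (fun x => complex.Im (f x)))%C.

Definition Lp (R : realType) (p : R) (f : R -> R[i]) : Prop :=
  cmeas f /\
  (\int[@lebesgue_measure R]_(x in @tdom R) ((cabs (f x)) `^ p)%:E < +oo)%E.

Definition Lpnorm (R : realType) (p : R) (f : R -> R[i]) : R :=
  (fine (\int[@lebesgue_measure R]_(x in @tdom R) ((cabs (f x)) `^ p)%:E)) `^ p^-1.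

Definition fcoef (R : realType) (f : R -> R[i]) (n : int) : R[i] :=
  (((2 * pi)^-1)%:C)%C * cint (fun t => f t * expi (- (n%:~R * t))).

(* Hardy space H^p, as the closed subspace of L^p(T) of boundary functions *)
Definition Hp (R : realType) (p : R) (f : R -> R[i]) : Prop :=
  Lp p f /\ forall n : int, n < 0 -> fcoef f n = 0.

(* closed unit ball of H^infty, identified with boundary functions:
   essentially bounded by 1, with vanishing negative Fourier coefficients *)
Definition Hinf_ball (R : realType) (b : R -> R[i]) : Prop :=
  cmeas b /\
  {ae @lebesgue_measure R, forall t, @tdom R t -> cabs (b t) <= 1} /\
  (forall n : int, n < 0 -> fcoef b n = 0).

(* value at z in D of the analytic function with boundary function F
   (Cauchy integral  (1/2pi) \int F(e^{it}) e^{it}/(e^{it} - z) dt) *)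
Definition hval (R : realType) (F : R -> R[i]) (z : R[i]) : R[i] :=
  (((2 * pi)^-1)%:C)%C * cint (fun t => F t / (1 - z * expi (- t))).

(* M. Riesz (Szego) projection L^p -> H^p: the element of H^p with the same
   nonnegative Fourier coefficients (exists for f in L^p, 1<p<oo, by M. Riesz) *)
Definition Pplus (R : realType) (p : R) (f : R -> R[i]) : R -> R[i] :=
  epsilon (inhabits (fun _ : R => 0 : R[i]))
    (fun g => Hp p g /\ forall n : int, 0 <= n -> fcoef g n = fcoef f n).

Definition Toep (R : realType) (p : R) (phi f : R -> R[i]) : R -> R[i] :=
  Pplus p (fun t => phi t * f t).

Definition cconj (R : realType) (f : R -> R[i]) : R -> R[i] :=
  fun t => (f t)^*.

(* P_b = T_b T_{\bar b}, i.e. P_b f = b T_{\bar b} f;  Q_b = I - P_b *)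
Definition Pb (R : realType) (p : R) (b f : R -> R[i]) : R -> R[i] :=
  fun t => b t * Toep p (cconj b) f t.

Definition Qb (R : realType) (p : R) (b f : R -> R[i]) : R -> R[i] :=
  fun t => f t - Pb p b f t.

Definition Bprod (R : realType) (b : nat -> R -> R[i]) (n : nat) : R -> R[i] :=
  fun t => \prod_(1 <= i < n.+1) b i t.

(* Main.v *)
(* Since [B_(n-1) Q_(b_n) T_(\bar B_(n-1)) f] equals
   [B_(n-1) T_(\bar B_(n-1)) f - B_n T_(\bar B_n) f], because
   [T_(\bar b_n) T_(\bar B_(n-1)) = T_(\bar B_n)], the partial sums telescope and
   the remainder after N terms is [B_N T_(\bar B_N) f], whose norm is at most that
   of [T_(\bar B_N) f].  By M. Riesz's theorem the operators [T_(\bar B_N)] are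
   uniformly bounded, so it suffices to let N tend to infinity for a trigonometric
   polynomial f; there [T_(\bar B_N) f] is a polynomial of bounded degree whose
   coefficients are combinations of finitely many Taylor coefficients of [B_N], and
   these tend to 0 because [B_N] is bounded by 1 and tends to 0 on the disc.

   M. Riesz's theorem is proved on polynomials.  For 1 < p <= 2 and F with positive
   real part, [|z|^p <= A (Re z)^p - B Re (z^p)] on the right half-plane and the
   mean value property of [F^p] bound the norm of F by that of its real part; Fejer
   means reduce general F to this case.  Cotlar's identity passes from p to 2p, and
   every p > 1 is reached from the interval ]1, 2]. *)

Require Import Defs.
From HB Require Import structures.
From mathcomp Require Import all_boot all_order all_algebra.
From mathcomp Require Import complex.
From mathcomp Require Import all_classical all_reals all_analysis.
From mathcomp Require Import measurable_realfun.
From mathcomp Require Import ring lra zify.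
Import Order.TTheory GRing.Theory Num.Theory numFieldNormedType.Exports.
Local Open Scope ring_scope.
Local Open Scope classical_set_scope.
Set Implicit Arguments. Unset Strict Implicit. Unset Printing Implicit Defensive.

(** Estimates concern the integral of |f|^p rather than its p-th root, with (x + y)^p <= 2^p (x^p +
    y^p) in place of Minkowski's inequality: constants only have to be uniform, and the root is
    taken once, at the very end. A trigonometric polynomial is written e^{-int} q(e^{it}), so its
    analytic part is [drop_poly n q], and M. Riesz's theorem becomes an inequality on polynomials,
    uniform in n and q. It serves twice: to bound the operators T_{\bar B_N}, and before that to
    show that [Pplus], defined by choice, has something to choose; passing from polynomials to L^p
    takes density, completeness and uniqueness of Fourier coefficients. Membership in [Hp] and
    [Hinf_ball] is a condition on Fourier coefficients: closure of [Hinf_ball] under products needs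
    a proof, and for B_n the disc enters only through [hval], from which Taylor coefficients must be
    recovered. Behind both this closure and the composition rule for the T_{\bar b_n} is one fact:
    \bar b times a function with only negative frequencies has only negative frequencies. *)

Section complex_modulus.
Variable R : realType.
Implicit Types (z w : R[i]) (t : R).

Lemma cabsE z : cabs z = Normc.normc z.
Proof. by case: z. Qed.

Lemma cabs_ge0 z : 0 <= cabs z.
Proof. exact: sqrtr_ge0. Qed.

Lemma cabsM z w : cabs (z * w) = cabs z * cabs w.
Proof. by rewrite !cabsE Normc.normcM. Qed.

Lemma cabsD z w : cabs (z + w) <= cabs z + cabs w.
Proof. by rewrite !cabsE le_normcD. Qed.

Lemma cabsN z : cabs (- z) = cabs z.
Proof. by rewrite !cabsE normcN. Qed.

Lemma cabsB z w : cabs (z - w) <= cabs z + cabs w.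
Proof. by rewrite -(cabsN w) cabsD. Qed.

Lemma cabs0 : cabs (0 : R[i]) = 0.
Proof. by rewrite cabsE Normc.normc0. Qed.

Lemma cabs1 : cabs (1 : R[i]) = 1.
Proof. by rewrite cabsE Normc.normc1. Qed.

Lemma cabs_eq0 z : cabs z = 0 -> z = 0.
Proof. by rewrite cabsE => /Normc.eq0_normc. Qed.

Lemma cabsX z n : cabs (z ^+ n) = cabs z ^+ n.
Proof. by elim: n => [|n IH]; rewrite ?expr0 ?cabs1// !exprS cabsM IH. Qed.

Lemma cabsV z : cabs z^-1 = (cabs z)^-1.
Proof. by rewrite !cabsE Normc.normcV. Qed.

Lemma cabs_conj z : cabs (z^*)%R = cabs z.
Proof. by case: z => a b; rewrite /cabs /= sqrrN. Qed.

Lemma cabs_real (x : R) : cabs (x%:C)%C = `|x|.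
Proof. by rewrite /cabs /= expr0n addr0 sqrtr_sqr. Qed.

Lemma cabs_sum (I : Type) (r : seq I) (P : pred I) (F : I -> R[i]) :
  cabs (\sum_(i <- r | P i) F i) <= \sum_(i <- r | P i) cabs (F i).
Proof.
elim/big_ind2: _ => //; first by rewrite cabs0.
by move=> x1 x2 y1 y2 h1 h2; apply: le_trans (cabsD _ _) _; exact: lerD.
Qed.

Lemma sqr_cabs z : cabs z ^+ 2 = complex.Re z ^+ 2 + complex.Im z ^+ 2.
Proof. by rewrite sqr_sqrtr// addr_ge0// sqr_ge0. Qed.

Lemma normr_Re_le z : `|complex.Re z| <= cabs z.
Proof.
rewrite -ler_sqr ?nnegrE ?cabs_ge0// sqr_cabs real_normK ?num_real//.
by rewrite lerDl sqr_ge0.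
Qed.

Lemma normr_Im_le z : `|complex.Im z| <= cabs z.
Proof.
rewrite -ler_sqr ?nnegrE ?cabs_ge0// sqr_cabs real_normK ?num_real//.
by rewrite lerDr sqr_ge0.
Qed.

Lemma cabs_le z : cabs z <= `|complex.Re z| + `|complex.Im z|.
Proof.
rewrite -ler_sqr ?nnegrE ?cabs_ge0 ?addr_ge0// sqr_cabs.
rewrite -[complex.Re z ^+ 2]real_normK ?num_real// -[complex.Im z ^+ 2]real_normK ?num_real//.
have := normr_ge0 (complex.Re z); have := normr_ge0 (complex.Im z); nra.
Qed.

Lemma cReD z w : complex.Re (z + w) = complex.Re z + complex.Re w.
Proof. by case: z => a b; case: w. Qed.
Lemma cImD z w : complex.Im (z + w) = complex.Im z + complex.Im w.
Proof. by case: z => a b; case: w. Qed.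
Lemma cReN z : complex.Re (- z) = - complex.Re z.
Proof. by case: z. Qed.
Lemma cImN z : complex.Im (- z) = - complex.Im z.
Proof. by case: z. Qed.
Lemma cReM z w : complex.Re (z * w) =
  complex.Re z * complex.Re w - complex.Im z * complex.Im w.
Proof. by case: z => a b; case: w. Qed.
Lemma cImM z w : complex.Im (z * w) =
  complex.Re z * complex.Im w + complex.Im z * complex.Re w.
Proof. by case: z => a b; case: w. Qed.
Lemma cReMr (a : R) z : complex.Re ((a%:C)%C * z) = a * complex.Re z.
Proof. by rewrite cReM /= mul0r subr0. Qed.
Lemma cImMr (a : R) z : complex.Im ((a%:C)%C * z) = a * complex.Im z.
Proof. by rewrite cImM /= mul0r addr0. Qed.
Lemma cReJ z : complex.Re (z^*)%R = complex.Re z.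
Proof. by case: z. Qed.
Lemma cImJ z : complex.Im (z^*)%R = - complex.Im z.
Proof. by case: z. Qed.

Lemma expi0 : expi (0 : R) = 1.
Proof. by rewrite /expi cos0 sin0. Qed.

Lemma expiD t s : expi (t + s) = expi t * expi s.
Proof. by rewrite /expi cosD sinD; apply/eqP; rewrite eq_complex /= !eqxx/= addrC. Qed.

Lemma expiN t : expi (- t) = ((expi t)^*)%R.
Proof. by rewrite /expi cosN sinN. Qed.

Lemma cabs_expi t : cabs (expi t) = 1.
Proof. by rewrite /cabs /= cos2Dsin2 sqrtr1. Qed.

Lemma expiMN t : expi t * expi (- t) = 1.
Proof. by rewrite -expiD subrr expi0. Qed.

Lemma expiMn t n : expi (n%:R * t) = expi t ^+ n.
Proof.
elim: n => [|n IH]; first by rewrite mul0r expi0.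
by rewrite exprS -IH -expiD mulrSr mulrDl mul1r addrC.
Qed.
End complex_modulus.

(** * Elementary inequalities for real powers *)

Section powers.
Variable R : realType.
Implicit Types (a b p : R).

(** The sum is at most twice the larger term. The factor 2^p is the price of avoiding Minkowski's
    inequality. *)
Lemma powRDle a b p : 0 <= a -> 0 <= b -> 0 <= p ->
  (a + b) `^ p <= 2 `^ p * (a `^ p + b `^ p).
Proof.
move=> a0 b0 p0.
have h x y : 0 <= x -> x <= y -> (x + y) `^ p <= 2 `^ p * (x `^ p + y `^ p).
  move=> x0 xy; have y0 := le_trans x0 xy.
  apply: (@le_trans _ _ ((2 * y) `^ p)).
    by rewrite ge0_ler_powR ?nnegrE ?addr_ge0// ?mulr_ge0//; lra.
  by rewrite powRM// ler_pM2l ?powR_gt0// lerDr powR_ge0.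
have [ab|/ltW ba] := leP a b; first exact: h.
by rewrite addrC [a `^ p + _]addrC; exact: h.
Qed.

(* Young's inequality in the elementary form replacing Hoelder's:
   if [a > e] then [a <= a * (a / e) `^ (p - 1)]. *)
Lemma ler_linear_powR a p e : 0 <= a -> 1 <= p -> 0 < e ->
  a <= e + e `^ (1 - p) * a `^ p.
Proof.
move=> a0 p1 e0; have [ae|ea] := leP a e.
  by apply: (le_trans ae); rewrite lerDl mulr_ge0 ?powR_ge0.
apply: ler_wpDl; first exact: ltW.
have a_gt0 : 0 < a := lt_trans e0 ea.
have -> : a `^ p = a * a `^ (p - 1).
  by rewrite mulr_powRB1//; lra.
rewrite mulrCA -[X in X <= _]mulr1 ler_pM2l//.
have -> : 1 - p = - (p - 1) by ring.
rewrite powRN mulrC -ler_pdivrMr ?invr_gt0 ?powR_gt0// div1r invrK.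
by apply: ge0_ler_powR; rewrite ?nnegrE ?(ltW ea) ?(ltW e0) ?(ltW a_gt0)//; lra.
Qed.
End powers.

(** * Integration and Fourier coefficients on the circle *)

Section circle_integral.
Variable R : realType.
Implicit Types (f g : R -> R).
Local Notation mu := (@lebesgue_measure R).
Local Notation T := (@tdom R).
Local Notation mT f := (measurable_fun T f).

Definition intg (f : R -> R) : Prop := mu.-integrable T (EFin \o f).
Definition It (f : R -> R) : R := Rintegral mu T f.
Definition aeT (P : R -> Prop) : Prop := {ae mu, forall t, T t -> P t}.

Lemma measurable_tdom : measurable T.
Proof. exact: measurable_itv. Qed.
Hint Resolve measurable_tdom : core.

Lemma mu_tdom : mu T = (2 * pi)%:E.
Proof.
rewrite /tdom lebesgue_measure_itv/= lte_fin mulr_gt0 ?pi_gt0//.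
by rewrite -EFinD subr0.
Qed.

Lemma mu_tdom_fin : (mu T < +oo)%E.
Proof. by rewrite mu_tdom ltry. Qed.

Lemma aeT_all (P : R -> Prop) : (forall t, T t -> P t) -> aeT P.
Proof. by move=> h; apply: aeW. Qed.

Lemma aeT_sub (P Q : R -> Prop) : aeT P -> (forall t, T t -> P t -> Q t) -> aeT Q.
Proof.
have FF := ae_filter_ringOfSetsType mu; move=> h PQ; apply: (@filterS _ _ FF _ _ _ h) => t {}h Dt; apply: PQ => //; exact: h.
Qed.

Lemma aeT_and (P Q : R -> Prop) : aeT P -> aeT Q -> aeT (fun t => P t /\ Q t).
Proof.
have FF := ae_filter_ringOfSetsType mu; move=> hP hQ; apply: (@filterS2 _ _ FF _ _ _ _ hP hQ) => t {}hP {}hQ Dt.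
by split; [exact: hP|exact: hQ].
Qed.

Lemma intg_mf f : intg f -> mT f.
Proof. by move=> /measurable_int/measurable_EFinP. Qed.

Lemma intg_bounded f (M : R) : mT f -> (forall t, T t -> `|f t| <= M) -> intg f.
Proof.
move=> mf fM; apply: measurable_bounded_integrable => //; first exact: mu_tdom_fin.
exists M; split; first exact: num_real.
by move=> x Mx t Dt; apply: le_trans (fM t Dt) (ltW Mx).
Qed.

Lemma intg_cst (c : R) : intg (fun=> c).
Proof. by apply: (@intg_bounded _ `|c|) => //; exact: measurable_cst. Qed.

Lemma intgD f g : intg f -> intg g -> intg (fun t => f t + g t).
Proof.
by move=> hf hg; rewrite /intg (_ : _ \o _ = ((EFin \o f) \+ (EFin \o g))%E)//; exact: integrableD.
Qed.

Lemma intgN f : intg f -> intg (fun t => - f t).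
Proof.
by move=> hf; rewrite /intg (_ : _ \o _ = (\- (EFin \o f))%E)//; exact: integrableN.
Qed.

Lemma intgB f g : intg f -> intg g -> intg (fun t => f t - g t).
Proof. by move=> hf hg; apply: intgD => //; exact: intgN. Qed.

Lemma intgZ (k : R) f : intg f -> intg (fun t => k * f t).
Proof. exact: integrableZl. Qed.

Lemma intg_abs f : intg f -> intg (fun t => `|f t|).
Proof. exact: integrable_abse. Qed.

Lemma eq_intg f g : (forall t, T t -> f t = g t) -> intg f -> intg g.
Proof.
move=> fg hf; apply: eq_integrable hf => //.
by move=> t /set_mem Dt /=; rewrite fg.
Qed.

Lemma eq_It f g : (forall t, T t -> f t = g t) -> It f = It g.
Proof. by move=> fg; apply: eq_Rintegral => t /set_mem; exact: fg. Qed.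

Lemma intg_le f g : mT f -> intg g -> aeT (fun t => `|f t| <= g t) -> intg f.
Proof.
move=> mf hg fg; apply/integrableP; split; first exact/measurable_EFinP.
case/integrableP : (hg) => /measurable_EFinP mg goo.
apply: le_lt_trans goo; apply: ae_ge0_le_integral => //.
- by apply: measurableT_comp => //; exact/measurable_EFinP.
- by apply: measurableT_comp => //; exact/measurable_EFinP.
apply: (aeT_sub fg) => t Dt; rewrite /= lee_fin => /le_trans; apply.
exact: ler_norm.
Qed.

Lemma intg_le0 f g : mT f -> intg g -> (forall t, T t -> `|f t| <= g t) -> intg f.
Proof. by move=> mf hg fg; apply: (intg_le mf hg); exact: aeT_all. Qed.

Lemma ItD f g : intg f -> intg g -> It (fun t => f t + g t) = It f + It g.
Proof. exact: RintegralD. Qed.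

Lemma ItB f g : intg f -> intg g -> It (fun t => f t - g t) = It f - It g.
Proof. exact: RintegralB. Qed.

Lemma ItZ (k : R) f : intg f -> It (fun t => k * f t) = k * It f.
Proof. exact: RintegralZl. Qed.

Lemma ItN f : intg f -> It (fun t => - f t) = - It f.
Proof.
move=> hf; rewrite -mulN1r -ItZ//; apply: eq_It => t _; exact: esym (mulN1r _).
Qed.

Lemma It_cst (c : R) : It (fun=> c) = c * (2 * pi).
Proof. by rewrite /It Rintegral_cst// [X in fine X]mu_tdom. Qed.

Lemma It_ge0 f : (forall t, T t -> 0 <= f t) -> 0 <= It f.
Proof. by move=> h; rewrite /It; apply: Rintegral_ge0. Qed.

Lemma le_It f g : intg f -> intg g -> (forall t, T t -> f t <= g t) -> It f <= It g.
Proof. exact: le_Rintegral. Qed.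

Lemma eq_ae_It f g : mT f -> mT g -> aeT (fun t => f t = g t) -> It f = It g.
Proof.
move=> mf mg fg; rewrite /It /Rintegral; congr fine; apply: ae_eq_integral => //.
- exact/measurable_EFinP.
- exact/measurable_EFinP.
- by apply: (aeT_sub fg) => t _ ->.
Qed.

Lemma le_ae_It f g : intg f -> intg g -> aeT (fun t => f t <= g t) -> It f <= It g.
Proof.
move=> hf hg fg.
(* Replacing [g] by max(f, g), which equals [g] almost everywhere, makes the comparison hold at
   every point. *)
have mm : mT (fun t => Order.max (f t) (g t)).
  by apply: measurable_maxr; exact: intg_mf.
rewrite (_ : It g = It (fun t => Order.max (f t) (g t))); last first.
  apply: eq_ae_It => //; first exact: intg_mf.
  by apply: (aeT_sub fg) => t _ /max_idPr.
apply: le_It => //; last by move=> t _; rewrite le_max lexx.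
apply: (intg_le0 mm (intgD (intg_abs hf) (intg_abs hg))) => t _.
by case: (leP (f t) (g t)) => _; rewrite ?lerDl ?lerDr.
Qed.

Lemma norm_It f : intg f -> `|It f| <= It (fun t => `|f t|).
Proof. exact: le_normr_Rintegral. Qed.

Lemma It_EFin f : intg f -> ((It f)%:E = \int[mu]_(t in T) (f t)%:E)%E.
Proof.
by move=> hf; rewrite /It /Rintegral fineK// integrable_fin_num.
Qed.

Lemma intg_lty f : mT f -> (forall t, T t -> 0 <= f t) ->
  (\int[mu]_(t in T) (f t)%:E < +oo)%E -> intg f.
Proof.
move=> mf f0 foo; apply/integrableP; split; first exact/measurable_EFinP.
apply: le_lt_trans foo; rewrite le_eqVlt; apply/orP; left; apply/eqP.
by apply: eq_integral => t /set_mem Dt; rewrite /= ger0_norm// f0.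
Qed.

Lemma It_eq0 f : intg f -> (forall t, T t -> 0 <= f t) -> It f = 0 ->
  aeT (fun t => f t = 0).
Proof.
move=> hf f0 If0.
have m : measurable_fun T (EFin \o f) by apply/measurable_EFinP; exact: intg_mf.
have [+ _] := ae_eq_integral_abs mu measurable_tdom m.
have -> : (\int[mu]_(x in T) `|(EFin \o f) x| = 0)%E.
  rewrite -[RHS]/(0%:E) -If0 It_EFin//; apply: eq_integral.
  by move=> t /set_mem Dt; rewrite /= ger0_norm// f0.
move=> /(_ erefl) h; apply: (@filterS _ _ (ae_filter_ringOfSetsType mu) _ _ _ h).
by move=> t + Dt => /(_ Dt) [].
Qed.

Lemma intg_sum (I : Type) (r : seq I) (F : I -> R -> R) :
  (forall i, intg (F i)) -> intg (fun t => \sum_(i <- r) F i t).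
Proof.
move=> hF; elim: r => [|i r IH].
  by apply: eq_intg (intg_cst 0) => t _; rewrite big_nil.
by apply: eq_intg (intgD (hF i) IH) => t _; rewrite big_cons.
Qed.

Lemma It_sum (I : Type) (r : seq I) (F : I -> R -> R) :
  (forall i, intg (F i)) ->
  It (fun t => \sum_(i <- r) F i t) = \sum_(i <- r) It (F i).
Proof.
move=> hF; elim: r => [|i r IH].
  rewrite big_nil (@eq_It _ (fun=> 0)) ?It_cst ?mul0r//.
  by move=> t _; rewrite big_nil.
rewrite big_cons -IH -ItD//; last exact: intg_sum.
by apply: eq_It => t _; rewrite big_cons.
Qed.
End circle_integral.
Arguments measurable_tdom {R}.
#[export] Hint Resolve measurable_tdom : core.

(** * Measurability and integration of complex-valued functions *)

Section complex_integral.
Variable R : realType.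
Implicit Types (f g : R -> R[i]).
Local Notation T := (@tdom R).
Local Notation mT f := (measurable_fun T f).
Local Notation Re := complex.Re.
Local Notation Im := complex.Im.

Lemma cmeas_cst (z : R[i]) : cmeas (fun=> z).
Proof. by split; exact: measurable_cst. Qed.

Lemma cmeasD f g : cmeas f -> cmeas g -> cmeas (fun t => f t + g t).
Proof.
move=> [f1 f2] [g1 g2]; split.
  under eq_fun do rewrite cReD; exact: measurable_funD.
under eq_fun do rewrite cImD; exact: measurable_funD.
Qed.

Lemma cmeasN f : cmeas f -> cmeas (fun t => - f t).
Proof.
move=> [f1 f2]; split.
  under eq_fun do rewrite cReN; exact: measurableT_comp.
under eq_fun do rewrite cImN; exact: measurableT_comp.
Qed.

Lemma cmeasB f g : cmeas f -> cmeas g -> cmeas (fun t => f t - g t).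
Proof. by move=> hf hg; apply: cmeasD => //; exact: cmeasN. Qed.

Lemma cmeasM f g : cmeas f -> cmeas g -> cmeas (fun t => f t * g t).
Proof.
move=> [f1 f2] [g1 g2]; split.
  by under eq_fun do rewrite cReM; apply: measurable_funB; exact: measurable_funM.
by under eq_fun do rewrite cImM; apply: measurable_funD; exact: measurable_funM.
Qed.

Lemma cmeasJ f : cmeas f -> cmeas (fun t => ((f t)^*)%R).
Proof.
move=> [f1 f2]; split.
  by under eq_fun do rewrite cReJ.
under eq_fun do rewrite cImJ; exact: measurableT_comp.
Qed.

Lemma cmeas_real (f : R -> R) : mT f -> cmeas (fun t => ((f t)%:C)%C).
Proof. by move=> h; split => //; exact: measurable_cst. Qed.

Lemma eq_cmeas f g : f =1 g -> cmeas f -> cmeas g.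
Proof. by move=> /funext ->. Qed.

Lemma cmeas_sum (I : Type) (r : seq I) (F : I -> R -> R[i]) :
  (forall i, cmeas (F i)) -> cmeas (fun t => \sum_(i <- r) F i t).
Proof.
move=> hF; elim: r => [|i r IH].
  by apply: eq_cmeas (cmeas_cst 0) => t; rewrite big_nil.
by apply: eq_cmeas (cmeasD (hF i) IH) => t; rewrite big_cons.
Qed.

Lemma cmeasX f n : cmeas f -> cmeas (fun t => f t ^+ n).
Proof.
move=> hf; elim: n => [|n IH]; first exact: (cmeas_cst 1).
by apply: eq_cmeas (cmeasM hf IH) => t; rewrite exprS.
Qed.

Lemma cmeas_horner f (q : {poly R[i]}) : cmeas f -> cmeas (fun t => q.[f t]).
Proof.
move=> hf.
apply: (@eq_cmeas (fun t => \sum_(i < size q) q`_i * f t ^+ i)).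
  by move=> t; rewrite horner_coef.
by apply: cmeas_sum => i; apply: cmeasM; [exact: cmeas_cst|exact: cmeasX].
Qed.

Lemma cmeas_expi (k : R) : cmeas (fun t => expi (k * t)).
Proof.
have ck : continuous (fun t : R => k * t) by move=> t; apply: mulrl_continuous.
split; apply: measurable_funTS; apply: continuous_measurable_fun => t.
  by apply: continuous_comp; [exact: ck|exact: continuous_cos].
by apply: continuous_comp; [exact: ck|exact: continuous_sin].
Qed.

Lemma measurable_cabs f : cmeas f -> mT (fun t => cabs (f t)).
Proof.
move=> [f1 f2]; rewrite /cabs.
apply: (@measurableT_comp _ _ _ _ _ _ (@Num.sqrt R)).
  by apply: continuous_measurable_fun; exact: sqrt_continuous.
by apply: measurable_funD; exact: measurable_funX.
Qed.

Lemma measurable_cabs_powR f (p : R) : cmeas f -> mT (fun t => cabs (f t) `^ p).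
Proof.
move=> hf; apply: (@measurableT_comp _ _ _ _ _ _ (fun x => x `^ p)).
  exact: measurable_powR.
exact: measurable_cabs.
Qed.

Definition cintg f : Prop := cmeas f /\ intg (fun t => cabs (f t)).

Lemma cintg_ReIm f : cintg f -> intg (fun t => Re (f t)) /\ intg (fun t => Im (f t)).
Proof.
move=> [[f1 f2] hf]; split; apply: (intg_le0 _ hf) => // t _.
  exact: normr_Re_le.
exact: normr_Im_le.
Qed.

Lemma cintg_le f (g : R -> R) : cmeas f -> intg g -> aeT (fun t => cabs (f t) <= g t) ->
  cintg f.
Proof.
move=> mf hg fg; split => //; apply: (intg_le _ hg); first exact: measurable_cabs.
by apply: (aeT_sub fg) => t _; rewrite ger0_norm ?cabs_ge0.
Qed.

Lemma cintg_bounded f (M : R) : cmeas f -> aeT (fun t => cabs (f t) <= M) -> cintg f.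
Proof. by move=> mf fM; apply: cintg_le fM => //; exact: intg_cst. Qed.

Lemma cintgD f g : cintg f -> cintg g -> cintg (fun t => f t + g t).
Proof.
move=> [mf hf] [mg hg]; apply: (@cintg_le _ (fun t => cabs (f t) + cabs (g t))).
- exact: cmeasD.
- exact: intgD.
- by apply: aeT_all => t _; exact: cabsD.
Qed.

Lemma cintgMb f g (M : R) : cintg f -> cmeas g -> aeT (fun t => cabs (g t) <= M) ->
  cintg (fun t => g t * f t).
Proof.
move=> [mf hf] mg hg; apply: (@cintg_le _ (fun t => M * cabs (f t))).
- exact: cmeasM.
- exact: intgZ.
- by apply: (aeT_sub hg) => t _ h; rewrite cabsM ler_wpM2r ?cabs_ge0.
Qed.

Lemma cintgZ (z : R[i]) f : cintg f -> cintg (fun t => z * f t).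
Proof.
move=> hf; apply: (@cintgMb f (fun=> z) (cabs z)) => //.
exact: aeT_all.
Qed.

Lemma cintgN f : cintg f -> cintg (fun t => - f t).
Proof.
move=> hf; have := cintgZ (-1) hf; rewrite (_ : (fun _ => _) = (fun t => - f t))//.
by apply/funext => t; rewrite mulN1r.
Qed.

Lemma cintgB f g : cintg f -> cintg g -> cintg (fun t => f t - g t).
Proof. by move=> hf hg; apply: cintgD => //; exact: cintgN. Qed.

Lemma cintE f : cint f = (It (fun t => Re (f t)) +i* It (fun t => Im (f t)))%C.
Proof. by []. Qed.

Lemma cintD f g : cintg f -> cintg g ->
  cint (fun t => f t + g t) = cint f + cint g.
Proof.
move=> /cintg_ReIm[f1 f2] /cintg_ReIm[g1 g2]; rewrite !cintE.
under [in LHS]eq_fun do rewrite cReD.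
by rewrite ItD// (_ : (fun t => Im (f t + g t)) = (fun t => Im (f t) + Im (g t)))
  ?ItD//; apply/funext => t; rewrite cImD.
Qed.

Lemma cintZ (z : R[i]) f : cintg f -> cint (fun t => z * f t) = z * cint f.
Proof.
move=> /cintg_ReIm[f1 f2]; rewrite !cintE; apply/eqP; rewrite eq_complex; apply/andP; split.
  rewrite /= cReM/= -!ItZ// -ItB//; try exact: intgZ.
  by apply/eqP/eq_It => t _; rewrite cReM.
rewrite /= cImM/= -!ItZ// -ItD//; try exact: intgZ.
by apply/eqP/eq_It => t _; rewrite cImM.
Qed.

Lemma cintN f : cintg f -> cint (fun t => - f t) = - cint f.
Proof.
move=> hf; rewrite -mulN1r -cintZ//; congr cint.
by apply/funext => t; rewrite mulN1r.
Qed.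

Lemma cintB f g : cintg f -> cintg g ->
  cint (fun t => f t - g t) = cint f - cint g.
Proof. by move=> hf hg; rewrite cintD ?cintN//; exact: cintgN. Qed.

Lemma cint0 : cint (fun=> 0) = 0 :> R[i].
Proof. by rewrite cintE /= It_cst mul0r. Qed.

Lemma cintg_sum (I : Type) (r : seq I) (F : I -> R -> R[i]) :
  (forall i, cintg (F i)) -> cintg (fun t => \sum_(i <- r) F i t).
Proof.
move=> hF; elim: r => [|i r IH].
  under eq_fun do rewrite big_nil.
  apply: (@cintg_bounded _ 0); first exact: cmeas_cst.
  by apply: aeT_all => t _; rewrite cabs0.
under eq_fun do rewrite big_cons.
exact: cintgD.
Qed.

Lemma cint_sum (I : Type) (r : seq I) (F : I -> R -> R[i]) :
  (forall i, cintg (F i)) ->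
  cint (fun t => \sum_(i <- r) F i t) = \sum_(i <- r) cint (F i).
Proof.
move=> hF; elim: r => [|i r IH].
  by under eq_fun do rewrite big_nil; rewrite big_nil cint0.
under eq_fun do rewrite big_cons.
by rewrite big_cons cintD ?IH//; exact: cintg_sum.
Qed.

Lemma cintJ f : cintg f -> cint (fun t => ((f t)^*)%R) = ((cint f)^*)%R.
Proof.
move=> /cintg_ReIm[f1 f2]; rewrite !cintE /=.
under eq_fun do rewrite cReJ.
by rewrite (_ : (fun t => Im ((f t)^*)%R) = (fun t => - Im (f t))) ?ItN//;
  apply/funext => t; rewrite cImJ.
Qed.

(** Real and imaginary parts are bounded separately, whence the factor 2. It survives in the
    coefficient bounds and is removed in the maximum modulus principle by taking powers. *)
Lemma cabs_cint f : cintg f -> cabs (cint f) <= 2 * It (fun t => cabs (f t)).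
Proof.
move=> hf; have [mf hf'] := hf; have [f1 f2] := cintg_ReIm hf.
apply: le_trans (cabs_le _) _; rewrite cintE /= mulr_natl mulr2n; apply: lerD.
  apply: le_trans (norm_It f1) _; apply: le_It => //; first exact: intg_abs.
  by move=> t _; exact: normr_Re_le.
apply: le_trans (norm_It f2) _; apply: le_It => //; first exact: intg_abs.
by move=> t _; exact: normr_Im_le.
Qed.

End complex_integral.

(** * Fourier coefficients, and their values on polynomials in e^{it} *)

Section fourier.
Variable R : realType.
Implicit Types (f g : R -> R[i]).
Local Notation mu := (@lebesgue_measure R).
Local Notation T := (@tdom R).

Lemma It_FTC (F f : R -> R) : continuous f -> (forall t : R, is_derive t 1 F (f t)) ->
  It f = F (2 * pi) - F 0.
Proof.
move=> cf dF; have pi0 : (0 : R) < 2 * pi by rewrite mulr_gt0 ?pi_gt0.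
have cF : continuous F.
  move=> t; apply: differentiable_continuous; apply/derivable1_diffP.
  by have := dF t => -[].
have := @continuous_FTC2 R f F 0 (2 * pi) pi0.
have -> // : (\int[mu]_(x in `[0%R, (2 * pi)%R]) (f x)%:E = \int[mu]_(x in T) (f x)%:E)%E.
  rewrite /tdom integral_itv_bndo_bndc//.
  by apply/measurable_EFinP/measurable_funTS; exact: continuous_measurable_fun.
move=> h; rewrite /It /Rintegral h//.
- exact: continuous_subspaceT.
- split.
  + by move=> t _; have := dF t => -[].
  + by apply: cvg_at_right_filter; exact: cF.
  + by apply: cvg_at_left_filter; exact: cF.
- by move=> t _; rewrite derive1E; have := dF t => -[].
Qed.

Lemma sin_mulz_2pi (m : int) : sin (m%:~R * (2 * pi)) = 0 :> R.
Proof.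
have h (n : nat) : sin (n%:R * (2 * pi)) = 0 :> R.
  by rewrite !mulr_natl -[_ *+ n]add0r (periodicn (@sinD2pi R)) sin0.
by case: m => n; rewrite ?NegzE ?mulrNz ?mulNr ?sinN ?h ?oppr0//; exact: h.
Qed.

Lemma cos_mulz_2pi (m : int) : cos (m%:~R * (2 * pi)) = 1 :> R.
Proof.
have h (n : nat) : cos (n%:R * (2 * pi)) = 1 :> R.
  by rewrite !mulr_natl -[_ *+ n]add0r (periodicn (@cosD2pi R)) cos0.
by case: m => n; rewrite ?NegzE ?mulrNz ?mulNr ?cosN ?h//; exact: h.
Qed.

Lemma cint_expi (m : int) :
  cint (fun t : R => expi (m%:~R * t)) = if m == 0 then ((2 * pi)%:C)%C else 0.
Proof.
case: eqP => [->|/eqP m0].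
  rewrite cintE (@eq_It _ _ (fun=> 1)) ?It_cst ?mul1r; last first.
    by move=> t _; rewrite mul0r /= cos0.
  rewrite (@eq_It _ _ (fun=> 0)) ?It_cst ?mul0r//.
  by move=> t _; rewrite mul0r /= sin0.
have k0 : (m%:~R : R) != 0 by rewrite intr_eq0.
set k : R := m%:~R in k0 *.
have ck : continuous (fun t : R => k * t) by move=> t; apply: mulrl_continuous.
rewrite cintE; apply/eqP; rewrite eq_complex; apply/andP; split; apply/eqP => /=.
  have d t : is_derive (t : R) 1 (fun t => k^-1 * sin (k * t)) (cos (k * t)).
    apply: is_derive_eq.
    by rewrite /GRing.scale/= mulr1; field.
  refine (etrans (It_FTC _ d) _).
    by move=> t; apply: continuous_comp; [exact: ck|exact: continuous_cos].
  by rewrite mulr0 sin0 sin_mulz_2pi mulr0 subrr.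
have d t : is_derive (t : R) 1 (fun t => - k^-1 * cos (k * t)) (sin (k * t)).
  apply: is_derive_eq.
  by rewrite /GRing.scale/= mulr1; field.
refine (etrans (It_FTC _ d) _).
  by move=> t; apply: continuous_comp; [exact: ck|exact: continuous_sin].
by rewrite mulr0 cos0 cos_mulz_2pi subrr.
Qed.

Lemma cintg_expi (k : R) : cintg (fun t => expi (k * t)).
Proof.
apply: (@cintg_bounded _ _ 1); first exact: cmeas_expi.
by apply: aeT_all => t _; rewrite cabs_expi.
Qed.

Lemma cmeas_expi1 : cmeas (@expi R).
Proof. by apply: eq_cmeas (cmeas_expi 1) => t; rewrite mul1r. Qed.

Lemma cmeas_expin (n : int) : cmeas (fun t : R => expi (- (n%:~R * t))).
Proof. by apply: eq_cmeas (cmeas_expi (- n%:~R)) => t; rewrite mulNr. Qed.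

Lemma cintg_mul_expi f (n : int) : cintg f -> cintg (fun t => f t * expi (- (n%:~R * t))).
Proof.
move=> hf; have h : (fun t => f t * expi (- (n%:~R * t))) = (fun t => expi (- (n%:~R * t)) * f t).
  by apply/funext => t; rewrite mulrC.
rewrite h; apply: (@cintgMb _ f (fun t => expi (- (n%:~R * t))) 1) => //.
  exact: cmeas_expin.
by apply: aeT_all => t _; rewrite cabs_expi.
Qed.

Lemma twopiC_neq0 : (((2 * pi : R)%:C)%C : R[i]) != 0.
Proof. by rewrite fmorph_eq0 mulf_neq0 ?pnatr_eq0// gt_eqF// pi_gt0. Qed.

Lemma twopiCV : ((((2 * pi)^-1 : R)%:C)%C : R[i]) = (((2 * pi : R)%:C)%C)^-1.
Proof. by rewrite fmorphV. Qed.

Lemma eq_fcoef f g n : f =1 g -> fcoef f n = fcoef g n.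
Proof. by move=> /funext ->. Qed.

Lemma fcoefD f g n : cintg f -> cintg g ->
  fcoef (fun t => f t + g t) n = fcoef f n + fcoef g n.
Proof.
move=> hf hg; rewrite /fcoef -mulrDr -cintD; try exact: cintg_mul_expi.
by congr (_ * cint _); apply/funext => t; rewrite mulrDl.
Qed.

Lemma fcoefZ (z : R[i]) f n : cintg f -> fcoef (fun t => z * f t) n = z * fcoef f n.
Proof.
move=> hf; rewrite /fcoef mulrCA -(cintZ z); last exact: cintg_mul_expi.
by congr (_ * cint _); apply/funext => t; rewrite mulrA.
Qed.

Lemma fcoefN f n : cintg f -> fcoef (fun t => - f t) n = - fcoef f n.
Proof.
move=> hf; rewrite -mulN1r -fcoefZ//.
by apply: eq_fcoef => t; rewrite mulN1r.
Qed.

Lemma fcoefB f g n : cintg f -> cintg g ->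
  fcoef (fun t => f t - g t) n = fcoef f n - fcoef g n.
Proof. by move=> hf hg; rewrite fcoefD ?fcoefN//; exact: cintgN. Qed.

Lemma fcoef_sum (I : Type) (r : seq I) (F : I -> R -> R[i]) n :
  (forall i, cintg (F i)) ->
  fcoef (fun t => \sum_(i <- r) F i t) n = \sum_(i <- r) fcoef (F i) n.
Proof.
move=> hF; rewrite /fcoef -mulr_sumr -cint_sum.
  by congr (_ * cint _); apply/funext => t; rewrite mulr_suml.
by move=> i; exact: cintg_mul_expi.
Qed.

Lemma fcoefJ f (n : int) : cintg f -> fcoef (cconj f) n = ((fcoef f (- n))^*)%R.
Proof.
move=> hf; rewrite /fcoef rmorphM/= -cintJ; last exact: cintg_mul_expi.
congr (_ * cint _).
  by apply/eqP; rewrite eq_complex /= oppr0 !eqxx.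
apply/funext => t; rewrite rmorphM/= /cconj; congr (_ * _).
by rewrite -[RHS]expiN; congr expi; rewrite mulrNz; ring.
Qed.

Lemma fcoef_shift f (m n : int) :
  fcoef (fun t => expi (m%:~R * t) * f t) n = fcoef f (n - m).
Proof.
rewrite /fcoef; congr (_ * cint _); apply/funext => t.
by rewrite mulrAC -expiD mulrC; congr (_ * expi _); rewrite intrB; ring.
Qed.

Lemma fcoef_expi (m n : int) :
  fcoef (fun t : R => expi (m%:~R * t)) n = (m == n)%:R.
Proof.
rewrite /fcoef (_ : (fun t => _) = (fun t : R => expi ((m - n)%:~R * t))); last first.
  by apply/funext => t; rewrite -expiD intrB; congr expi; ring.
rewrite cint_expi subr_eq0; case: eqP => _; last by rewrite mulr0.
by rewrite twopiCV mulVf// twopiC_neq0.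
Qed.

(* Analytic trigonometric polynomials are encoded as [q.[expi t]] with [q] an
   ordinary polynomial. *)
Lemma cmeas_poly (q : {poly R[i]}) : cmeas (fun t : R => q.[expi t]).
Proof. by apply: cmeas_horner; exact: cmeas_expi1. Qed.

(** A crude majorant of the modulus of [q] on the closed disc of radius [r]. *)
Definition pnorm (r : R) (q : {poly R[i]}) : R := \sum_(i < size q) cabs q`_i * r ^+ i.

Lemma pnorm_ge0 (r : R) (q : {poly R[i]}) : 0 <= r -> 0 <= pnorm r q.
Proof.
by move=> r0; apply: sumr_ge0 => i _; rewrite mulr_ge0 ?cabs_ge0// exprn_ge0.
Qed.

Lemma cabs_horner_pnorm (r : R) (q : {poly R[i]}) z : cabs z <= r -> cabs q.[z] <= pnorm r q.
Proof.
move=> zr; rewrite horner_coef; apply: le_trans (cabs_sum _ _ _) _.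
apply: ler_sum => i _; rewrite cabsM cabsX ler_wpM2l ?cabs_ge0//.
by rewrite lerXn2r ?nnegrE ?cabs_ge0// (le_trans _ zr) ?cabs_ge0.
Qed.

Lemma cintg_poly (q : {poly R[i]}) : cintg (fun t : R => q.[expi t]).
Proof.
apply: (@cintg_bounded _ _ (pnorm 1 q)); first exact: cmeas_poly.
by apply: aeT_all => t _; rewrite cabs_horner_pnorm ?cabs_expi.
Qed.

Lemma fcoef_poly (q : {poly R[i]}) (n : int) :
  fcoef (fun t : R => q.[expi t]) n = if n is Posz k then q`_k else 0.
Proof.
rewrite (_ : (fun t => _) = (fun t : R => \sum_(i < size q) q`_i * expi ((Posz i)%:~R * t))); last first.
  by apply/funext => t; rewrite horner_coef; apply: eq_bigr => i _; rewrite -expiMn.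
rewrite fcoef_sum; last by move=> i; exact/cintgZ/cintg_expi.
under eq_bigr => i _ do rewrite (fcoefZ _ _ (cintg_expi _)) fcoef_expi.
case: n => k; last by apply: big1 => i _; rewrite mulr0.
have [kq|qk] := ltnP k (size q); last first.
  rewrite nth_default//; apply: big1 => i _.
  rewrite (_ : (_ == _) = false) ?mulr0//.
  by apply/negP => /eqP -[ik]; have := ltn_ord i; rewrite ik ltnNge qk.
rewrite (bigD1 (Ordinal kq))//= eqxx mulr1 big1 ?addr0// => i ik.
rewrite (_ : (_ == _) = false) ?mulr0//.
apply/negP => /eqP -[e]; move/negP : ik; apply; apply/eqP.
exact: val_inj.
Qed.
End fourier.

(** * Integrals of p-th powers, and continuity of Fourier coefficients *)

Section modular.
Variables (R : realType) (p : R).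
Implicit Types (f g : R -> R[i]).
Hypothesis p1 : 1 < p.
Local Notation T := (@tdom R).

(** The norm without its root: homogeneous of degree [q], with a triangle inequality up to the
    factor 2^q. *)
Definition Ip (q : R) f : R := It (fun t => cabs (f t) `^ q).

Let p0 : 0 < p. Proof. exact: lt_trans ltr01 p1. Qed.
Let p_ge0 : 0 <= p. Proof. exact: ltW. Qed.

Lemma LpP f : Lp p f <-> cmeas f /\ intg (fun t => cabs (f t) `^ p).
Proof.
split=> -[mf h]; split=> //.
  by apply: intg_lty => //; [exact: measurable_cabs_powR|move=> t _; exact: powR_ge0].
by rewrite -It_EFin ?ltry.
Qed.

Lemma Lp_cmeas f : Lp p f -> cmeas f. Proof. by case. Qed.
Lemma Lp_intg f : Lp p f -> intg (fun t => cabs (f t) `^ p).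
Proof. by move=> /LpP[]. Qed.

Lemma Ip_ge0 q f : 0 <= Ip q f.
Proof. by apply: It_ge0 => t _; exact: powR_ge0. Qed.

Lemma cabs_powRD (z w : R[i]) :
  cabs (z + w) `^ p <= 2 `^ p * (cabs z `^ p + cabs w `^ p).
Proof.
apply: le_trans (powRDle _ _ _); rewrite ?cabs_ge0//.
by apply: ge0_ler_powR; rewrite ?nnegrE ?addr_ge0 ?cabs_ge0// cabsD.
Qed.

Lemma Lp_le f (g : R -> R) : cmeas f -> intg g ->
  aeT (fun t => cabs (f t) `^ p <= g t) -> Lp p f.
Proof.
move=> mf hg fg; apply/LpP; split=> //; apply: (intg_le _ hg).
  exact: measurable_cabs_powR.
by apply: (aeT_sub fg) => t _ h; rewrite ger0_norm// powR_ge0.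
Qed.

Lemma LpD f g : Lp p f -> Lp p g -> Lp p (fun t => f t + g t).
Proof.
move=> hf hg; apply: (@Lp_le _ (fun t => 2 `^ p * (cabs (f t) `^ p + cabs (g t) `^ p))).
- exact: cmeasD (Lp_cmeas hf) (Lp_cmeas hg).
- by apply: intgZ; apply: intgD; exact: Lp_intg.
- by apply: aeT_all => t _; exact: cabs_powRD.
Qed.

Lemma IpD f g : Lp p f -> Lp p g ->
  Ip p (fun t => f t + g t) <= 2 `^ p * (Ip p f + Ip p g).
Proof.
move=> hf hg; have [jf jg] := (Lp_intg hf, Lp_intg hg).
rewrite /Ip -ItD// -ItZ; last exact: intgD.
apply: le_It; first exact: (Lp_intg (LpD hf hg)).
  by apply: intgZ; exact: intgD.
by move=> t _; exact: cabs_powRD.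
Qed.

Lemma LpMb f g (M : R) : Lp p f -> cmeas g -> aeT (fun t => cabs (g t) <= M) ->
  Lp p (fun t => g t * f t).
Proof.
move=> hf mg gM; apply: (@Lp_le _ (fun t => M `^ p * cabs (f t) `^ p)).
- exact: cmeasM mg (Lp_cmeas hf).
- by apply: intgZ; exact: Lp_intg.
- apply: (aeT_sub gM) => t _ h; rewrite cabsM powRM ?cabs_ge0//.
  rewrite ler_wpM2r ?powR_ge0//; apply: ge0_ler_powR; rewrite ?nnegrE ?cabs_ge0//.
  exact: le_trans (cabs_ge0 _) h.
Qed.

Lemma IpMb f g (M : R) : Lp p f -> cmeas g -> aeT (fun t => cabs (g t) <= M) ->
  Ip p (fun t => g t * f t) <= M `^ p * Ip p f.
Proof.
move=> hf mg gM; rewrite /Ip -ItZ; last exact: Lp_intg.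
apply: le_ae_It; first exact: Lp_intg (LpMb hf mg gM).
  by apply: intgZ; exact: Lp_intg.
apply: (aeT_sub gM) => t _ h; rewrite cabsM powRM ?cabs_ge0//.
rewrite ler_wpM2r ?powR_ge0//; apply: ge0_ler_powR; rewrite ?nnegrE ?cabs_ge0//.
exact: le_trans (cabs_ge0 _) h.
Qed.

Lemma LpZ (z : R[i]) f : Lp p f -> Lp p (fun t => z * f t).
Proof.
move=> hf; apply: (@LpMb f (fun=> z) (cabs z)) => //.
exact: aeT_all.
Qed.

Lemma IpZ (z : R[i]) f : Lp p f -> Ip p (fun t => z * f t) = cabs z `^ p * Ip p f.
Proof.
move=> hf; rewrite /Ip -ItZ; last exact: Lp_intg.
by apply: eq_It => t _; rewrite cabsM powRM ?cabs_ge0.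
Qed.

Lemma eq_Ip q f g : (forall t, T t -> cabs (f t) = cabs (g t)) -> Ip q f = Ip q g.
Proof. by move=> h; apply: eq_It => t Dt; rewrite h. Qed.

Lemma IpN q f : Ip q (fun t => - f t) = Ip q f.
Proof. by apply: eq_Ip => t _; rewrite cabsN. Qed.

Lemma LpN f : Lp p f -> Lp p (fun t => - f t).
Proof.
move=> hf; apply: (@Lp_le _ (fun t => cabs (f t) `^ p)).
- exact: cmeasN (Lp_cmeas hf).
- exact: Lp_intg.
- by apply: aeT_all => t _; rewrite cabsN.
Qed.

Lemma LpB f g : Lp p f -> Lp p g -> Lp p (fun t => f t - g t).
Proof. by move=> hf hg; exact: LpD hf (LpN hg). Qed.

Lemma IpB f g : Lp p f -> Lp p g ->
  Ip p (fun t => f t - g t) <= 2 `^ p * (Ip p f + Ip p g).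
Proof. by move=> hf hg; rewrite -(IpN p g); exact: IpD hf (LpN hg). Qed.

Lemma Ip_tri f g h : Lp p f -> Lp p g -> Lp p h ->
  Ip p (fun t => f t - h t) <=
  2 `^ p * (Ip p (fun t => f t - g t) + Ip p (fun t => g t - h t)).
Proof.
move=> hf hg hh; apply: le_trans (IpD (LpB hf hg) (LpB hg hh)).
by rewrite le_eqVlt; apply/orP; left; apply/eqP/eq_Ip => t _; rewrite addrA subrK.
Qed.

Lemma Ip_sym f g : Ip p (fun t => f t - g t) = Ip p (fun t => g t - f t).
Proof. by apply: eq_Ip => t _; rewrite -cabsN opprB. Qed.

Lemma Lp_bounded f (M : R) : cmeas f -> aeT (fun t => cabs (f t) <= M) -> Lp p f.
Proof.
move=> mf fM; apply: (@Lp_le _ (fun=> M `^ p)) => //; first exact: intg_cst.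
apply: (aeT_sub fM) => t _ h; apply: ge0_ler_powR; rewrite ?nnegrE ?cabs_ge0//.
exact: le_trans (cabs_ge0 _) h.
Qed.

Lemma Ip_bounded f (M : R) : cmeas f -> aeT (fun t => cabs (f t) <= M) ->
  Ip p f <= M `^ p * (2 * pi).
Proof.
move=> mf fM; rewrite -It_cst; apply: le_ae_It.
- exact: Lp_intg (Lp_bounded mf fM).
- exact: intg_cst.
apply: (aeT_sub fM) => t _ h; apply: ge0_ler_powR; rewrite ?nnegrE ?cabs_ge0//.
exact: le_trans (cabs_ge0 _) h.
Qed.

Lemma Lp_poly (q : {poly R[i]}) : Lp p (fun t : R => q.[expi t]).
Proof.
apply: (@Lp_bounded _ (pnorm 1 q)); first exact: cmeas_poly.
by apply: aeT_all => t _; rewrite cabs_horner_pnorm ?cabs_expi.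
Qed.

Lemma Lp_cintg f : Lp p f -> cintg f.
Proof.
move=> hf; apply: (@cintg_le _ _ (fun t => 1 + 1 `^ (1 - p) * cabs (f t) `^ p)).
- exact: Lp_cmeas.
- by apply: intgD; [exact: intg_cst|apply: intgZ; exact: Lp_intg].
- by apply: aeT_all => t _; apply: ler_linear_powR; rewrite ?cabs_ge0// ltW.
Qed.

(** Substitute for Hoelder's inequality on a space of finite measure: the free threshold [e] makes
    the additive loss as small as desired. *)
Lemma It_cabs_le f (e : R) : Lp p f -> 0 < e ->
  It (fun t => cabs (f t)) <= e * (2 * pi) + e `^ (1 - p) * Ip p f.
Proof.
move=> hf e0; rewrite -It_cst /Ip -ItZ; last exact: Lp_intg.
rewrite -ItD; last 2 first.
  exact: intg_cst.
  by apply: intgZ; exact: Lp_intg.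
apply: le_It.
- by case: (Lp_cintg hf).
- by apply: intgD; [exact: intg_cst|apply: intgZ; exact: Lp_intg].
- by move=> t _; apply: ler_linear_powR; rewrite ?cabs_ge0// ltW.
Qed.

Lemma cabs_fcoef_le f n : cintg f ->
  cabs (fcoef f n) <= pi^-1 * It (fun t => cabs (f t)).
Proof.
move=> hf; rewrite /fcoef cabsM cabs_real ger0_norm ?invr_ge0 ?mulr_ge0 ?pi_ge0//.
have -> : pi^-1 = (2 * pi)^-1 * 2 :> R.
  by rewrite invfM mulrAC mulVf ?mul1r// pnatr_eq0.
rewrite -mulrA ler_wpM2l ?invr_ge0 ?mulr_ge0 ?pi_ge0//.
apply: le_trans (cabs_cint (cintg_mul_expi n hf)) _.
rewrite ler_pM2l//; apply: le_It; first by case: (cintg_mul_expi n hf).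
  by case: hf.
by move=> t _; rewrite cabsM cabs_expi mulr1.
Qed.

Lemma Ip_small (e : R) : 0 < e -> exists2 d : R, 0 < d &
  forall f, Lp p f -> Ip p f < d -> It (fun t => cabs (f t)) < e.
Proof.
(* With threshold e / (4 pi) the linear term of [It_cabs_le] is exactly e / 2; [d] is what keeps the
   other term below e / 2. *)
move=> e0; have pi0 := @pi_gt0 R; set e' := e / (4 * pi).
have e'0 : 0 < e' by rewrite divr_gt0// mulr_gt0.
exists (e / 2 / e' `^ (1 - p)); first by rewrite divr_gt0 ?powR_gt0// divr_gt0.
move=> f hf; rewrite ltr_pdivlMr ?powR_gt0// mulrC => h.
apply: le_lt_trans (It_cabs_le hf e'0) _.
have e'E (x : R) : 0 < x -> e / (4 * x) * (2 * x) = e / 2.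
  by move=> /lt0r_neq0 x0; field.
rewrite e'E//.
by rewrite [X in _ < X](splitr e) ltrD2l.
Qed.

(** Continuity of Fourier coefficients under L^p approximation, in the form that carries identities
    from trigonometric polynomials to all of L^p. *)
Lemma fcoef_approx f n (c : R[i]) : Lp p f ->
  (forall e : R, 0 < e -> exists g,
     [/\ Lp p g, Ip p (fun t => g t - f t) < e & fcoef g n = c]) ->
  fcoef f n = c.
Proof.
move=> hf h; apply/eqP; rewrite -subr_eq0; apply/eqP/cabs_eq0/le_anti.
rewrite cabs_ge0 andbT; apply/ler_addgt0Pr => e e0; rewrite add0r.
have [d d0 hd] := @Ip_small (e * pi) (mulr_gt0 e0 (pi_gt0 _)).
have [g [hg gd <-]] := h d d0.
rewrite -cabsN opprB -fcoefB; try exact: Lp_cintg.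
have hgf := LpB hg hf; apply: le_trans (cabs_fcoef_le _ (Lp_cintg hgf)) _.
by rewrite ler_pdivrMl ?pi_gt0// mulrC; exact/ltW/(hd _ hgf gd).
Qed.

Lemma eq_ae_Ip f g : cmeas f -> cmeas g -> aeT (fun t => f t = g t) -> Ip p f = Ip p g.
Proof.
move=> mf mg fg; apply: eq_ae_It; try exact: measurable_cabs_powR.
by apply: (aeT_sub fg) => t _ ->.
Qed.
End modular.

(** * Fejer means *)

Section fejer.
Variable R : realType.
Local Notation T := (@tdom R).
Local Notation Re := complex.Re.
Local Notation Im := complex.Im.
Local Notation mT f := (measurable_fun T f).

(** This is |\sum_{j <= n} e^{ijx}|^2 / (n + 1). In the form of a double sum of cosines, both
    positivity and the integrals against 1 and cos can be read off without the quotient of sines. *)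
Definition fejer (n : nat) (x : R) : R :=
  n.+1%:R^-1 * \sum_(j < n.+1) \sum_(k < n.+1) cos ((Posz j - Posz k)%:~R * x).

Lemma fejer_ge0 n x : 0 <= fejer n x.
Proof.
apply: mulr_ge0; first by rewrite invr_ge0.
(* The double sum is the squared modulus of \sum_j e^{ijx}. *)
rewrite (_ : \sum_(j < n.+1) _ =
    (\sum_(j < n.+1) cos (j%:R * x)) ^+ 2 + (\sum_(j < n.+1) sin (j%:R * x)) ^+ 2).
  by rewrite addr_ge0 ?sqr_ge0.
rewrite !expr2 !mulr_suml -big_split/=; apply: eq_bigr => j _.
rewrite !mulr_sumr -big_split/=; apply: eq_bigr => k _.
by rewrite -cosB; congr cos; rewrite intrB; ring.
Qed.

Lemma intg_cos (m : int) (t : R) : intg (fun s => cos (m%:~R * (t - s))).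
Proof.
apply: (@intg_bounded _ _ 1); last by move=> s _; exact: cos_max.
apply: measurable_funTS; apply: continuous_measurable_fun => s.
apply: (@continuous_comp _ _ _ (fun s => m%:~R * (t - s)) cos); last exact: continuous_cos.
by apply: cvgM; [exact: cvg_cst|apply: cvgB; [exact: cvg_cst|exact: cvg_id]].
Qed.

Lemma It_cos (m : int) (t : R) :
  It (fun s => cos (m%:~R * (t - s))) = 2 * pi * (m == 0)%:R.
Proof.
have -> : It (fun s => cos (m%:~R * (t - s))) =
    Re (cint (fun s => expi (m%:~R * t) * expi ((- m)%:~R * s))).
  rewrite cintE; apply: eq_It => s _; rewrite -expiD /=; congr cos.
  by rewrite intrN; ring.
rewrite cintZ; last exact: cintg_expi.
rewrite cint_expi oppr_eq0; case: eqP => [->|_]; last by rewrite !mulr0.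
by rewrite mul0r expi0 mul1r mulr1.
Qed.

Lemma intg_fejer n t : intg (fun s => fejer n (t - s)).
Proof.
by apply: intgZ; apply: intg_sum => j; apply: intg_sum => k; exact: intg_cos.
Qed.

Lemma sum_eq_ord n m : (m < n)%N -> \sum_(k < n) ((m : nat) == k)%:R = 1 :> R.
Proof.
move=> mn; rewrite (bigD1 (Ordinal mn))//= eqxx big1 ?addr0// => k km.
rewrite (_ : (_ == _) = false)//; apply/negP => /eqP e.
by move/negP : km; apply; apply/eqP/val_inj.
Qed.

(** Counts the neighbouring pairs: [n] of them against [n + 1] diagonal ones, which is why the first
    Fourier coefficient of the kernel is n / (n + 1). *)
Lemma sum_eq_ordS n : \sum_(j < n.+1) \sum_(k < n.+1) ((j : nat) == k.+1)%:R = n%:R :> R.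
Proof.
rewrite big_ord_recl big1// add0r -[RHS]mulr1n -mulr_natl mulr1.
transitivity (\sum_(j < n) (1 : R)); last by rewrite sumr_const card_ord.
apply: eq_bigr => j _; rewrite -[RHS](@sum_eq_ord n.+1 j); last by rewrite ltnS ltnW.
by apply: eq_bigr => k _; rewrite lift0 eqSS.
Qed.

Lemma It_fejer n t : It (fun s => fejer n (t - s)) = 2 * pi.
Proof.
have h j : intg (fun s => \sum_(k < n.+1) cos ((Posz j - Posz k)%:~R * (t - s))).
  by apply: intg_sum => k; exact: intg_cos.
rewrite ItZ ?It_sum//; last by apply: intg_sum => j; exact: h.
rewrite (eq_bigr (fun=> 2 * pi)); last first.
  move=> j _; rewrite It_sum; last by move=> k; exact: intg_cos.
  under eq_bigr do rewrite It_cos subr_eq0.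
  by rewrite -mulr_sumr sum_eq_ord ?mulr1.
by rewrite sumr_const card_ord -[(2 * pi) *+ _]mulr_natl mulrA mulVf ?mul1r// pnatr_eq0.
Qed.

Lemma fejer_cosE n x : fejer n x * cos x = n.+1%:R^-1 *
  \sum_(j < n.+1) \sum_(k < n.+1) 2^-1 *
   (cos ((Posz j - Posz k.+1)%:~R * x) + cos ((Posz j.+1 - Posz k)%:~R * x)).
Proof.
rewrite /fejer -mulrA; congr (_ * _); rewrite mulr_suml; apply: eq_bigr => j _.
rewrite mulr_suml; apply: eq_bigr => k _.
have -> : (Posz j - Posz k.+1)%:~R * x = (Posz j - Posz k)%:~R * x - x :> R.
  by rewrite !intrB -[k.+1]addn1 PoszD intrD; ring.
have -> : (Posz j.+1 - Posz k)%:~R * x = (Posz j - Posz k)%:~R * x + x :> R.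
  by rewrite !intrB -[j.+1]addn1 PoszD intrD; ring.
by rewrite cosB cosD; field.
Qed.

Lemma intg_fejer_cos n t : intg (fun s => fejer n (t - s) * cos (t - s)).
Proof.
apply: (eq_intg (fun s _ => esym (fejer_cosE n (t - s)))).
apply: intgZ; apply: intg_sum => j; apply: intg_sum => k; apply: intgZ.
by apply: intgD; exact: intg_cos.
Qed.

Lemma It_fejer_cos n t :
  It (fun s => fejer n (t - s) * cos (t - s)) = 2 * pi * (n%:R / n.+1%:R).
Proof.
rewrite (eq_It (fun s _ => fejer_cosE n (t - s))).
have h0 j k : intg (fun s => 2^-1 *
   (cos ((Posz j - Posz k.+1)%:~R * (t - s)) + cos ((Posz j.+1 - Posz k)%:~R * (t - s)))).
  by apply: intgZ; apply: intgD; exact: intg_cos.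
have h j : intg (fun s => \sum_(k < n.+1) 2^-1 *
   (cos ((Posz j - Posz k.+1)%:~R * (t - s)) + cos ((Posz j.+1 - Posz k)%:~R * (t - s)))).
  by apply: intg_sum => k; exact: h0.
rewrite ItZ ?It_sum//; last by apply: intg_sum => j; exact: h.
rewrite (eq_bigr (fun j : 'I_n.+1 => pi * (\sum_(k < n.+1) ((j : nat) == k.+1)%:R
    + \sum_(k < n.+1) (j.+1 == k :> nat)%:R))); last first.
  move=> j _; rewrite It_sum; last by move=> k; exact: h0.
  rewrite -big_split/= mulr_sumr; apply: eq_bigr => k _.
  rewrite ItZ ?ItD; try exact: intg_cos; last by apply: intgD; exact: intg_cos.
  by rewrite !It_cos !subr_eq0; field.
rewrite -mulr_sumr big_split/= sum_eq_ordS [X in _ + X]exchange_big/=.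
rewrite (eq_bigr (fun k : 'I_n.+1 => \sum_(j < n.+1) ((k : nat) == j.+1)%:R)).
  by rewrite sum_eq_ordS; field; rewrite addrC natr1 pnatr_eq0.
by move=> k _; apply: eq_bigr => j _; rewrite eq_sym.
Qed.

(** An analytic polynomial whose real part on the circle is the Fejer mean of [g]: since [g] is
    real, the frequencies j - k and k - j can both be folded into |j - k| without changing the real
    part. *)
Definition fejer_poly n (g : R -> R) : {poly R[i]} :=
  \sum_(j < n.+1) \sum_(k < n.+1)
   (((n.+1%:R^-1 * (2 * pi)^-1)%:C)%C *
     cint (fun s => ((g s)%:C)%C * expi ((- Posz `|Posz j - Posz k|%N)%:~R * s)))%:P
   * 'X^(`|Posz j - Posz k|).

Lemma Re_fejer_poly n g t : mT g -> intg g ->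
  Re (fejer_poly n g).[expi t] = (2 * pi)^-1 * It (fun s => g s * fejer n (t - s)).
Proof.
move=> mg ig.
have hc m : intg (fun s => g s * cos (m%:~R * (t - s))).
  apply: (intg_le0 _ (intg_abs ig)).
    by apply: measurable_funM => //; exact: intg_mf (intg_cos _ _).
  by move=> s _; rewrite normrM ler_piMr// cos_max.
have hj j : intg (fun s => \sum_(k < n.+1) g s * cos ((Posz j - Posz k)%:~R * (t - s))).
  by apply: intg_sum => k; exact: hc.
rewrite (@eq_It _ _ (fun s => n.+1%:R^-1 * \sum_(j < n.+1) \sum_(k < n.+1)
    g s * cos ((Posz j - Posz k)%:~R * (t - s)))); last first.
  move=> s _; rewrite /fejer mulrCA; congr (_ * _); rewrite mulr_sumr.
  by apply: eq_bigr => j _; rewrite mulr_sumr.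
rewrite ItZ ?It_sum//; last by apply: intg_sum.
rewrite mulrA mulr_sumr /fejer_poly horner_sum.
have ReS (I : Type) (r : seq I) (F : I -> R[i]) : Re (\sum_(i <- r) F i) = \sum_(i <- r) Re (F i).
  by elim: r => [|i r IH]; rewrite ?big_nil// !big_cons cReD IH.
rewrite ReS; apply: eq_bigr => j _; rewrite horner_sum ReS It_sum; last by move=> k; exact: hc.
rewrite mulr_sumr; apply: eq_bigr => k _.
rewrite hornerM hornerC hornerXn -expiMn -[X in complex.Re X]mulrA cReMr.
rewrite [X in _ = X * _]mulrC; congr GRing.mul.
set m := `|Posz j - Posz k|%N.
have -> : It (fun s => g s * cos ((Posz j - Posz k)%:~R * (t - s))) =
    It (fun s => g s * cos (m%:R * (t - s))).
  apply: eq_It => s _; congr (_ * _); rewrite /m.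
  case: (Posz j - Posz k) => // l; rewrite NegzE /= intrN mulNr cosN.
  by [].
rewrite [cint _ * _]mulrC -cintZ; last first.
  apply: (@cintg_le _ _ (fun s => `|g s|)).
  - by apply: cmeasM; [exact: cmeas_real|exact: cmeas_expi].
  - exact: intg_abs.
  - by apply: aeT_all => s _; rewrite cabsM cabs_expi mulr1 cabs_real.
rewrite cintE; apply: eq_It => s _.
rewrite mulrCA -expiD cReMr; congr (_ * cos _).
by rewrite intrN -[X in _ + - X * _]/(m%:R); ring.
Qed.

Lemma intg_mul_fejer n (g : R -> R) t : mT g -> intg g -> intg (fun s => g s * fejer n (t - s)).
Proof.
move=> mg ig.
have [M' hM'] : exists M' : R, forall s, `|fejer n (t - s)| <= M'.
  exists (n.+1%:R^-1 * \sum_(j < n.+1) \sum_(k < n.+1) 1) => s.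
  rewrite normrM ger0_norm ?invr_ge0// ler_wpM2l ?invr_ge0//.
  apply: le_trans (ler_norm_sum _ _ _) _; apply: ler_sum => j _.
  apply: le_trans (ler_norm_sum _ _ _) _; apply: ler_sum => k _.
  exact: cos_max.
apply: (intg_le0 _ (intgZ M' (intg_abs ig))).
  by apply: measurable_funM => //; exact: intg_mf (intg_fejer n t).
by move=> s _; rewrite normrM mulrC ler_wpM2r.
Qed.

Lemma fejer_poly_le n (g : R -> R) (M t : R) : mT g -> (forall s, T s -> `|g s| <= M) ->
  `|Re (fejer_poly n g).[expi t]| <= M.
Proof.
move=> mg hM; have ig := intg_bounded mg hM; rewrite Re_fejer_poly//.
have pi2 : 0 < 2 * pi :> R by rewrite mulr_gt0 ?pi_gt0.
rewrite normrM gtr0_norm ?invr_gt0// ler_pdivrMl// mulrC.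
have iK := intg_fejer n t; have igK := intg_mul_fejer n t mg ig.
apply: le_trans (norm_It igK) _; rewrite -(It_fejer n t) -(ItZ _ iK).
apply: le_It; [exact: intg_abs|exact: intgZ|move=> s Ts].
by rewrite normrM (ger0_norm (fejer_ge0 n _)) ler_wpM2r ?fejer_ge0// hM.
Qed.

(* Korovkin-style: the positive kernel has mass one, and its integral against
   [1 - cos] is [1 / (n + 1)]. *)
Lemma fejer_poly_dist n (g : R -> R) (t e M : R) : mT g -> intg g ->
  (forall s, T s -> `|g s - g t| <= e + M * (1 - cos (t - s))) ->
  `|Re (fejer_poly n g).[expi t] - g t| <= e + `|M| / n.+1%:R.
Proof.
move=> mg ig hM; rewrite Re_fejer_poly//.
have pi2 : 0 < 2 * pi :> R by rewrite mulr_gt0 ?pi_gt0.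
have iK := intg_fejer n t.
have iKc := intg_fejer_cos n t.
have igK := intg_mul_fejer n t mg ig.
have -> : (2 * pi)^-1 * It (fun s => g s * fejer n (t - s)) - g t =
    (2 * pi)^-1 * It (fun s => g s * fejer n (t - s) - g t * fejer n (t - s)).
  rewrite (ItB igK (intgZ _ iK)) (ItZ _ iK) It_fejer mulrBr; congr (_ - _).
  by rewrite [RHS]mulrC mulfK// lt0r_neq0.
rewrite normrM gtr0_norm ?invr_gt0// ler_pdivrMl//.
have ib : intg (fun s => g s * fejer n (t - s) - g t * fejer n (t - s)).
  by apply: intgB => //; exact: intgZ.
apply: le_trans (norm_It ib) _.
apply: (@le_trans _ _ (It (fun s => (e + M) * fejer n (t - s) - M * (fejer n (t - s) * cos (t - s))))).
  apply: le_It; first exact: intg_abs.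
    by apply: intgB; exact: intgZ.
  move=> s Ts; rewrite -mulrBl normrM (ger0_norm (fejer_ge0 n _)).
  have -> : (e + M) * fejer n (t - s) - M * (fejer n (t - s) * cos (t - s)) =
      (e + M * (1 - cos (t - s))) * fejer n (t - s) by ring.
  by rewrite ler_wpM2r ?fejer_ge0// hM.
rewrite (ItB (intgZ _ iK) (intgZ _ iKc)) (ItZ _ iK) (ItZ _ iKc) It_fejer It_fejer_cos.
rewrite [X in X <= _](_ : _ = 2 * pi * (e + M / n.+1%:R)); last first.
  by field; rewrite addrC natr1 pnatr_eq0.
by rewrite ler_pM2l// lerD2l ler_wpM2r ?invr_ge0// ler_norm.
Qed.

(** The real constant coefficient is the normalization under which a polynomial is controlled by its
    real part. *)
Lemma Im_fejer_poly0 n g : Im (fejer_poly n g)`_0 = 0.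
Proof.
rewrite /fejer_poly coef_sum.
have ImS (I : Type) (r : seq I) (F : I -> R[i]) : Im (\sum_(i <- r) F i) = \sum_(i <- r) Im (F i).
  by elim: r => [|i r IH]; rewrite ?big_nil// !big_cons cImD IH.
rewrite ImS big1// => j _; rewrite coef_sum ImS big1// => k _.
rewrite coefCM coefXn; case: eqP => [h|_]; last by rewrite mulr0.
rewrite mulr1 cImMr -h oppr0 cintE /=.
rewrite (@eq_It _ _ (fun=> 0)) ?It_cst ?mul0r ?mulr0// => s _.
by rewrite !mul0r sin0 mulr0 addr0.
Qed.

Lemma normr_divn_le (a e : R) : 0 < e -> exists n : nat, `|a| / n.+1%:R <= e.
Proof.
move=> e0; exists (Num.truncn (`|a| / e)).
rewrite ler_pdivrMr// mulrC -ler_pdivrMr//.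
by apply/ltW; exact: truncnS_gt.
Qed.

(** The hypothesis is a modulus of continuity for the squared chord, as 2 (1 - cos (t - s)) =
    |e^{is} - e^{it}|^2; it contains the periodicity of [g], so the approximation is uniform. *)
Lemma fejer_approximation (g : R -> R) : mT g -> intg g ->
  (forall e : R, 0 < e -> exists M : R, forall s t,
     `|g s - g t| <= e + M * (1 - cos (t - s))) ->
  forall e : R, 0 < e -> exists W : {poly R[i]}, Im W`_0 = 0 /\
    forall t, `|Re W.[expi t] - g t| <= e.
Proof.
move=> mg ig hg e e0.
have e2 : 0 < e / 2 by rewrite divr_gt0.
have [M hM] := hg _ e2.
have [n hn] := normr_divn_le M e2.
exists (fejer_poly n g); split; first exact: Im_fejer_poly0.
move=> t; apply: le_trans (fejer_poly_dist n mg ig (fun s _ => hM s t)) _.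
by rewrite [X in _ <= X](splitr e) lerD2l.
Qed.
End fejer.

(** * Powers of analytic functions with positive real part *)

Section real_derivative.
Variable R : realType.
Implicit Types (f g : R -> R) (x a b : R).

Definition has_deriv f x a : Prop := is_derive (x : R) 1 f a.

Lemma has_derivE f x a b : has_deriv f x a -> a = b -> has_deriv f x b.
Proof. by move=> h <-. Qed.

Lemma eq_has_deriv f g x a : f =1 g -> has_deriv f x a -> has_deriv g x a.
Proof. by move=> /funext ->. Qed.

Lemma has_deriv_cst c x : has_deriv (fun=> c) x 0.
Proof. exact: is_derive_cst. Qed.

Lemma has_deriv_id x : has_deriv id x 1.
Proof. exact: is_derive_id. Qed.

Lemma has_derivD f g x a b : has_deriv f x a -> has_deriv g x b ->
  has_deriv (fun y => f y + g y) x (a + b).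
Proof. by move=> hf hg; exact: is_deriveD. Qed.

Lemma has_derivN f x a : has_deriv f x a -> has_deriv (fun y => - f y) x (- a).
Proof. by move=> hf; exact: is_deriveN. Qed.

Lemma has_derivB f g x a b : has_deriv f x a -> has_deriv g x b ->
  has_deriv (fun y => f y - g y) x (a - b).
Proof. by move=> hf hg; apply: has_derivD => //; exact: has_derivN. Qed.

Lemma has_derivM f g x a b : has_deriv f x a -> has_deriv g x b ->
  has_deriv (fun y => f y * g y) x (f x * b + g x * a).
Proof. by move=> hf hg; exact: is_deriveM. Qed.

Lemma has_derivV f x a : f x != 0 -> has_deriv f x a ->
  has_deriv (fun y => (f y)^-1) x (- a / f x ^+ 2).
Proof.
move=> fx hf; apply: (has_derivE (is_deriveV fx hf)).
by rewrite /GRing.scale/=; field.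
Qed.

Lemma has_deriv_comp f g x a b : has_deriv f (g x) a -> has_deriv g x b ->
  has_deriv (fun y => f (g y)) x (a * b).
Proof. by move=> hf hg; exact: is_derive1_comp. Qed.

Lemma has_deriv_continuous f x a : has_deriv f x a -> {for x, continuous f}.
Proof.
move=> h; apply: differentiable_continuous; apply/derivable1_diffP.
by have := h => -[].
Qed.
End real_derivative.

(** * Derivatives of complex curves, and complex powers on the right half-plane *)

Section complex_derivative.
Variable R : realType.
Implicit Types (f g : R -> R[i]) (x : R) (v w : R[i]).
Local Notation Re := complex.Re.
Local Notation Im := complex.Im.

(** The derivative of a curve, component by component. Complex differentiability is replaced by
    chain rules: polynomials, [cexp] and [clog] each turn the derivative [w] of the curve into a
    complex multiple of [w]. *)
Definition has_cderiv f x w : Prop :=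
  has_deriv (fun y => Re (f y)) x (Re w) /\ has_deriv (fun y => Im (f y)) x (Im w).

Lemma has_cderivE f x v w : has_cderiv f x v -> v = w -> has_cderiv f x w.
Proof. by move=> h <-. Qed.

Lemma eq_has_cderiv f g x a : f =1 g -> has_cderiv f x a -> has_cderiv g x a.
Proof. by move=> /funext ->. Qed.

Lemma has_cderiv_cst v x : has_cderiv (fun=> v) x 0.
Proof. by split; exact: has_deriv_cst. Qed.

Lemma has_cderivD f g x v w : has_cderiv f x v -> has_cderiv g x w ->
  has_cderiv (fun y => f y + g y) x (v + w).
Proof.
move=> [f1 f2] [g1 g2]; split.
  rewrite cReD; apply: eq_has_deriv (has_derivD f1 g1) => y; exact: esym (cReD _ _).
rewrite cImD; apply: eq_has_deriv (has_derivD f2 g2) => y; exact: esym (cImD _ _).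
Qed.

Lemma has_cderivM f g x v w : has_cderiv f x v -> has_cderiv g x w ->
  has_cderiv (fun y => f y * g y) x (f x * w + g x * v).
Proof.
move=> [f1 f2] [g1 g2]; split.
  apply: (@eq_has_deriv _ (fun y => Re (f y) * Re (g y) - Im (f y) * Im (g y))).
    by move=> y; rewrite cReM.
  apply: has_derivE (has_derivB (has_derivM f1 g1) (has_derivM f2 g2)) _.
  by rewrite cReD !cReM; ring.
apply: (@eq_has_deriv _ (fun y => Re (f y) * Im (g y) + Im (f y) * Re (g y))).
  by move=> y; rewrite cImM.
apply: has_derivE (has_derivD (has_derivM f1 g2) (has_derivM f2 g1)) _.
by rewrite cImD !cImM; ring.
Qed.

Lemma has_cderivZ f x v w : has_cderiv f x v -> has_cderiv (fun y => w * f y) x (w * v).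
Proof.
move=> h; apply: has_cderivE (has_cderivM (has_cderiv_cst w x) h) _.
by rewrite mulr0 addr0.
Qed.

Lemma has_cderiv_horner f x w (q : {poly R[i]}) : has_cderiv f x w ->
  has_cderiv (fun y => q.[f y]) x (q^`().[f x] * w).
Proof.
move=> hf; elim/poly_ind: q => [|q c IH].
  rewrite deriv0 horner0 mul0r; apply: eq_has_cderiv (has_cderiv_cst 0 x) => y.
  by rewrite horner0.
apply: (@eq_has_cderiv (fun y => q.[f y] * f y + c)).
  by move=> y; rewrite hornerMXaddC.
apply: has_cderivE (has_cderivD (has_cderivM IH hf) (has_cderiv_cst c x)) _.
rewrite derivD derivC !addr0 derivM derivX mulr1 hornerD hornerMX.
ring.
Qed.

Lemma has_cderiv_expi x : has_cderiv (@expi R) x (expi x * 'i%C).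
Proof.
split; rewrite /expi /=; apply: has_derivE; [exact: is_derive_cos|by ring|exact: is_derive_sin|by ring].
Qed.

Lemma has_cderiv_real (c : R[i]) x : has_cderiv (fun y => ((y%:C)%C * c)) x c.
Proof.
split.
  apply: (@eq_has_deriv _ (fun y => y * Re c)) => [y|]; first by rewrite cReMr.
  by apply: has_derivE (has_derivM (has_deriv_id x) (has_deriv_cst (Re c) x)) _; rewrite mulr0 add0r mulr1.
apply: (@eq_has_deriv _ (fun y => y * Im c)) => [y|]; first by rewrite cImMr.
by apply: has_derivE (has_derivM (has_deriv_id x) (has_deriv_cst (Im c) x)) _; rewrite mulr0 add0r mulr1.
Qed.

Lemma has_cderivV f x w : f x != 0 -> has_cderiv f x w ->
  has_cderiv (fun y => (f y)^-1) x (- w / f x ^+ 2).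
Proof.
move=> fx [h1 h2].
pose n y := Re (f y) ^+ 2 + Im (f y) ^+ 2.
have nx : n x != 0.
  by rewrite /n -sqr_cabs sqrf_eq0; apply: contra_neq fx; exact: cabs_eq0.
have hn : has_deriv n x (2 * (Re (f x) * Re w + Im (f x) * Im w)).
  by apply: has_derivE (has_derivD (has_derivM h1 h1) (has_derivM h2 h2)) _; ring.
have hV := has_derivV nx hn.
have sq z : z != 0 -> - w / z ^+ 2 = - w * (z^-1 * z^-1) by move=> _; rewrite expr2 invfM.
have ReV z : Re z^-1 = Re z * (Re z ^+ 2 + Im z ^+ 2)^-1 by case: z.
have ImV z : Im z^-1 = - (Im z * (Re z ^+ 2 + Im z ^+ 2)^-1) by case: z.
move: nx hV; rewrite /n => nx hV; split.
  apply: (@eq_has_deriv _ (fun y => Re (f y) * (n y)^-1)) => [y|]; first by rewrite ReV.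
  apply: has_derivE (has_derivM h1 hV) _.
  by rewrite sq// !cReM !cImM cReN cImN ReV ImV; field.
apply: (@eq_has_deriv _ (fun y => - (Im (f y) * (n y)^-1))) => [y|]; first by rewrite ImV.
apply: has_derivE (has_derivN (has_derivM h2 hV)) _.
by rewrite sq// !cImM !cReM cReN cImN ReV ImV; field.
Qed.

(* The branch of the logarithm on the right half-plane. *)
Definition clog (z : R[i]) : R[i] :=
  (2^-1 * ln (Re z ^+ 2 + Im z ^+ 2) +i* atan (Im z / Re z))%C.

Definition cexp (z : R[i]) : R[i] := ((expR (Re z))%:C)%C * expi (Im z).

Definition cpow (p : R) (z : R[i]) : R[i] := cexp ((p%:C)%C * clog z).

Lemma has_cderiv_cexp f x w : has_cderiv f x w ->
  has_cderiv (fun y => cexp (f y)) x (cexp (f x) * w).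
Proof.
move=> [h1 h2].
have e := has_deriv_comp (is_derive_expR (Re (f x))) h1.
have c := has_deriv_comp (is_derive_cos (Im (f x))) h2.
have s := has_deriv_comp (is_derive_sin (Im (f x))) h2.
split.
  apply: (@eq_has_deriv _ (fun y => expR (Re (f y)) * cos (Im (f y)))) => [y|]; first by rewrite cReMr.
  by apply: has_derivE (has_derivM e c) _; rewrite cReM cReMr cImMr /=; ring.
apply: (@eq_has_deriv _ (fun y => expR (Re (f y)) * sin (Im (f y)))) => [y|]; first by rewrite cImMr.
by apply: has_derivE (has_derivM e s) _; rewrite cImM cReMr cImMr /=; ring.
Qed.

Lemma has_cderiv_clog f x w : 0 < Re (f x) -> has_cderiv f x w ->
  has_cderiv (fun y => clog (f y)) x (w / f x).
Proof.
move=> fx [h1 h2].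
have a0 : Re (f x) != 0 by rewrite gt_eqF.
pose n y := Re (f y) ^+ 2 + Im (f y) ^+ 2.
have n0 : 0 < n x by rewrite ltr_pwDl ?sqr_ge0// exprn_gt0.
have nx : n x != 0 by rewrite gt_eqF.
have hn : has_deriv n x (2 * (Re (f x) * Re w + Im (f x) * Im w)).
  by apply: has_derivE (has_derivD (has_derivM h1 h1) (has_derivM h2 h2)) _; ring.
have hl := has_deriv_comp (is_derive1_ln n0) hn.
have ht := @has_deriv_comp _ _ (fun y => Im (f y) / Re (f y)) x _ _ (is_derive1_atan _)
             (has_derivM h2 (has_derivV a0 h1)).
have ReV z : Re z^-1 = Re z * (Re z ^+ 2 + Im z ^+ 2)^-1 by case: z.
have ImV z : Im z^-1 = - (Im z * (Re z ^+ 2 + Im z ^+ 2)^-1) by case: z.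
have nx' : Re (f x) * Re (f x) + Im (f x) * Im (f x) != 0 by rewrite -!expr2.
split.
  apply: has_derivE (has_derivM (has_deriv_cst 2^-1 x) hl) _.
  by rewrite cReM ReV ImV /n; field.
apply: has_derivE ht _.
rewrite cImM ReV ImV; field.
exact/andP.
Qed.

Lemma has_cderiv_cpow p f x w : 0 < Re (f x) -> has_cderiv f x w ->
  has_cderiv (fun y => cpow p (f y)) x (cpow p (f x) * ((p%:C)%C * (w / f x))).
Proof.
move=> fx h; apply: has_cderiv_cexp; apply: has_cderivZ; exact: has_cderiv_clog.
Qed.

Lemma cabs_expR z : cabs (cexp z) = expR (Re z).
Proof. by rewrite cabsM cabs_expi mulr1 cabs_real ger0_norm ?expR_ge0. Qed.

Lemma cabsE_expR z : 0 < Re z -> cabs z = expR (Re (clog z)).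
Proof.
move=> z0; have n0 : 0 < Re z ^+ 2 + Im z ^+ 2 by rewrite ltr_pwDl ?sqr_ge0// exprn_gt0.
rewrite /= /cabs -powR12_sqrt ?ltW// /powR gt_eqF//.
Qed.

Lemma cabs_cpow p z : 0 < Re z -> cabs (cpow p z) = cabs z `^ p.
Proof.
move=> z0; rewrite cabs_expR cReMr [in RHS]cabsE_expR// /powR expR_eq0 expRK.
by [].
Qed.

Lemma Re_cpow p z : 0 < Re z -> Re (cpow p z) = cabs z `^ p * cos (p * Im (clog z)).
Proof.
by move=> z0; rewrite -cabs_cpow// cabs_expR /cpow {1}/cexp cReMr /expi cImMr.
Qed.

Lemma Re_polar z : 0 < Re z -> Re z = cabs z * cos (Im (clog z)).
Proof.
move=> z0; rewrite /= cos_atan.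
have -> : 1 + (Im z / Re z) ^+ 2 = cabs z ^+ 2 / Re z ^+ 2.
  by rewrite sqr_cabs; field; rewrite gt_eqF.
rewrite sqrtrM ?sqr_ge0// sqrtrV ?sqr_ge0// !sqrtr_sqr (gtr0_norm z0) ger0_norm ?cabs_ge0//.
have : 0 < cabs z by rewrite (lt_le_trans z0)// (le_trans (ler_norm _))// normr_Re_le.
by move: (cabs z) => c c0; field; rewrite !gt_eqF.
Qed.

Lemma cpow_real p (a : R) : 0 < a -> cpow p (a%:C)%C = ((a `^ p)%:C)%C.
Proof.
move=> a0; have h : 0 < Re (a%:C)%C by [].
have e : Im (clog (a%:C)%C) = 0 by rewrite /= mul0r atan0.
apply/eqP; rewrite eq_complex; apply/andP; split.
  by rewrite Re_cpow// e cabs_real gtr0_norm// mulr0 cos0 mulr1.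
by rewrite /cpow /cexp !cImMr e mulr0 /= sin0 mulr0.
Qed.
End complex_derivative.

(** * The maximum modulus principle for polynomials *)

Section maximum_modulus.
Variable R : realType.
Implicit Types (q F : {poly R[i]}) (z : R[i]).
Local Notation T := (@tdom R).
Local Notation Re := complex.Re.

Lemma cabs_coef_le q (K : R) k : (forall t, T t -> cabs q.[expi t] <= K) ->
  cabs q`_k <= 2 * K.
Proof.
move=> hK; have := cabs_fcoef_le (Posz k) (cintg_poly q).
rewrite fcoef_poly => /le_trans; apply.
rewrite ler_pdivrMl ?pi_gt0// [2 * K]mulrC mulrCA -[pi * 2]mulrC -It_cst.
by apply: le_It => //; [case: (cintg_poly q)|exact: intg_cst].
Qed.

Lemma geometric_le (x : R) n : 0 <= x < 1 -> \sum_(i < n) x ^+ i <= (1 - x)^-1.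
Proof.
move=> /andP[x0 x1]; rewrite -[X in _ <= X]div1r ler_pdivlMr ?subr_gt0//.
have := subrX1 x n; have := exprn_ge0 n x0.
set S := \sum_(i < n) _; move=> h1 h2.
have -> : S * (1 - x) = - ((x - 1) * S) by ring.
rewrite -h2; lra.
Qed.

Lemma cabs_horner_lt1 q (K : R) z : (forall t, T t -> cabs q.[expi t] <= K) ->
  cabs z < 1 -> cabs q.[z] <= 2 * K / (1 - cabs z).
Proof.
move=> hK z1; apply: le_trans (cabs_horner_pnorm q (lexx _)) _.
have T0 : T 0 by rewrite /tdom/= in_itv/= lexx mulr_gt0 ?pi_gt0.
have K0 : 0 <= K := le_trans (cabs_ge0 _) (hK 0 T0).
apply: (@le_trans _ _ (2 * K * \sum_(i < size q) cabs z ^+ i)).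
  rewrite mulr_sumr; apply: ler_sum => i _.
  by rewrite ler_wpM2r ?exprn_ge0 ?cabs_ge0// cabs_coef_le.
by rewrite ler_wpM2l ?mulr_ge0// geometric_le// cabs_ge0.
Qed.

Lemma bernoulli_le (x : R) n : 0 <= x -> 1 + n%:R * x <= (1 + x) ^+ n.
Proof.
move=> x0; elim: n => [|n IH]; first by rewrite mul0r addr0 expr0.
rewrite exprS mulrSr; have n0 := ler0n R n.
have : (1 + x) * (1 + n%:R * x) <= (1 + x) * (1 + x) ^+ n by rewrite ler_wpM2l ?addr_ge0.
by apply: le_trans; nra.
Qed.

(* Tensor-power trick: the crude bound above, applied to [q ^+ k], loses a
   constant factor independent of [k]. *)
Lemma maximum_modulus q (K : R) z : (forall t, T t -> cabs q.[expi t] <= K) ->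
  cabs z < 1 -> cabs q.[z] <= K.
Proof.
move=> hK z1.
have T0 : T 0 by rewrite /tdom/= in_itv/= lexx mulr_gt0 ?pi_gt0.
have K0 : 0 <= K := le_trans (cabs_ge0 _) (hK 0 T0).
have h k : cabs q.[z] ^+ k <= 2 * K ^+ k / (1 - cabs z).
  rewrite -cabsX -horner_exp; apply: cabs_horner_lt1 => // t Tt.
  by rewrite horner_exp cabsX lerXn2r ?nnegrE ?cabs_ge0 ?hK.
rewrite leNgt; apply/negP => Kq.
have [K00|K1] := eqVneq K 0.
  by have := h 1%N; rewrite K00 !expr1 mulr0 mul0r leNgt -K00 Kq.
have {K1}K0 : 0 < K by rewrite lt_neqAle eq_sym K1.
set x := cabs q.[z] / K - 1.
have x0 : 0 < x by rewrite subr_gt0 ltr_pdivlMr// mul1r.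
(* By Bernoulli's inequality (|q(z)| / K)^k grows at least linearly in k, yet it never exceeds 2 /
   (1 - |z|). *)
have hx k : 1 + k%:R * x <= 2 / (1 - cabs z).
  apply: (le_trans (bernoulli_le k (ltW x0))).
  rewrite /x addrC subrK expr_div_n ler_pdivrMr ?exprn_gt0//.
  by apply: le_trans (h k) _; rewrite mulrAC.
have := hx (Num.truncn (2 / (1 - cabs z) / x)).+1; apply/negP.
rewrite -ltNge; apply: (@lt_le_trans _ _ ((Num.truncn (2 / (1 - cabs z) / x)).+1%:R * x)).
  by rewrite -ltr_pdivrMr// truncnS_gt.
by rewrite lerDr.
Qed.

(** On the circle Re F >= d and |F| <= C confine F to a disc centred at a large real M and of radius
    K < M. A disc condition, unlike a half-plane condition, extends inside by the maximum modulus
    principle, and the gap M - K leaves room for a slightly larger radius. *)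
Lemma Re_pos_extension F (d : R) : 0 < d ->
  (forall t, T t -> d <= Re F.[expi t]) ->
  exists r e : R, [/\ 1 < r, 0 < e & forall z, cabs z < r -> e <= Re F.[z]].
Proof.
(* With M d = C^2, |F - M|^2 = |F|^2 - 2 M Re F + M^2 <= C^2 - 2 C^2 + M^2 = M^2 - C^2 on the
   circle. *)
move=> d0 hF; pose C := pnorm 1 F + 1; pose M := C ^+ 2 / d.
have C0 : 0 < C by rewrite ltr_wpDl// pnorm_ge0.
have M0 : 0 < M by rewrite divr_gt0// exprn_gt0.
pose K := Num.sqrt (M ^+ 2 - C ^+ 2).
have hC t : cabs F.[expi t] <= C.
  by apply: le_trans (@cabs_horner_pnorm R 1 F _ _) _; [rewrite cabs_expi|rewrite lerDl].
pose G := F - ((M%:C)%C)%:P.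
have Md : M * d = C ^+ 2 by rewrite /M divfK// gt_eqF.
have hsq t : T t -> cabs G.[expi t] ^+ 2 <= M ^+ 2 - C ^+ 2.
  move=> Tt; rewrite /G hornerD hornerN hornerC sqr_cabs cReD cImD cReN cImN /= subr0.
  have : cabs F.[expi t] ^+ 2 <= C ^+ 2 by rewrite lerXn2r ?nnegrE ?cabs_ge0 ?(ltW C0) ?hC.
  rewrite sqr_cabs; have := ler_wpM2l (ltW M0) (hF t Tt); rewrite Md; nra.
have T0 : T 0 by rewrite /tdom/= in_itv/= lexx mulr_gt0 ?pi_gt0.
have MC : 0 <= M ^+ 2 - C ^+ 2 := le_trans (sqr_ge0 _) (hsq 0 T0).
have hG t : T t -> cabs G.[expi t] <= K.
  by move=> Tt; rewrite -ler_sqr ?nnegrE ?cabs_ge0 ?sqrtr_ge0// [K ^+ 2]sqr_sqrtr// hsq.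
have KM : K < M.
  rewrite -ltr_sqr ?nnegrE ?sqrtr_ge0 ?ltW// sqr_sqrtr// gtrBl.
  by rewrite exprn_gt0.
pose e := (M - K) / 2; have e0 : 0 < e by rewrite divr_gt0// subr_gt0.
pose S := pnorm 1 G + 1; have S0 : 0 < S by rewrite ltr_wpDl// pnorm_ge0.
(* The radius satisfies r^n = 1 + e / S with n above every exponent in G, so moving from |z| = 1 to
   |z| = r changes G by at most \sum |G_i| (r^i - 1) <= e. The successor keeps n positive for the
   root. *)
pose n := (size G).+1.
pose r := (1 + e / S) `^ n%:R^-1.
have eS : 0 < e / S by rewrite divr_gt0.
have rn : r ^+ n = 1 + e / S.
  by rewrite -powR_mulrn ?powR_ge0// -powRrM mulVf ?powRr1 ?pnatr_eq0// addr_ge0// ltW.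
have r0 : 0 <= r by exact: powR_ge0.
have r1 : 1 < r.
  by rewrite -(@ltr_pXn2r _ n) ?nnegrE// expr1n rn ltrDl.
exists r, e; split => // z zr.
(* Dilation brings the radius [r] back to the unit circle. *)
pose Gr := G \Po ((r%:C)%C *: 'X).
have GrE w : Gr.[w] = G.[(r%:C)%C * w] by rewrite horner_comp hornerZ hornerX.
have hGr t : T t -> cabs Gr.[expi t] <= K + e.
  move=> Tt; rewrite GrE -[G.[_]](subrK G.[expi t]) addrC.
  apply: le_trans (cabsD _ _) _; apply: lerD; first exact: hG.
  rewrite !horner_coef -sumrB; apply: le_trans (cabs_sum _ _ _) _.
  apply: (@le_trans _ _ (\sum_(i < size G) cabs G`_i * 1 ^+ i * (e / S))).
    apply: ler_sum => i _; rewrite exprMn -mulrBr cabsM expr1n mulr1.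
    rewrite ler_wpM2l ?cabs_ge0// -[X in _ - X]mul1r -mulrBl cabsM cabsX cabs_expi expr1n mulr1.
    have -> : (r%:C)%C ^+ i - 1 = ((r ^+ i - 1)%:C)%C by rewrite rmorphB rmorphXn.
    rewrite cabs_real ger0_norm; last by rewrite subr_ge0 exprn_ege1// ltW.
    rewrite lerBlDl -rn ler_weXn2l ?ltW ?leqW ?(ltnW (ltn_ord i))//.
  rewrite -mulr_suml -/(pnorm 1 G) mulrCA ler_piMr ?(ltW e0)//.
  by rewrite ler_pdivrMr// mul1r lerDl.
have hz : cabs G.[z] <= K + e.
  have := @maximum_modulus Gr _ ((r^-1%:C)%C * z) hGr.
  rewrite GrE mulrA -rmorphM mulfV ?mul1r; last by rewrite gt_eqF// (lt_trans ltr01 r1).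
  apply; rewrite cabsM cabs_real gtr0_norm ?invr_gt0 ?(lt_trans ltr01 r1)//.
  by rewrite ltr_pdivrMl ?mulr1 ?(lt_trans ltr01 r1).
have := le_trans (normr_Re_le _) hz; rewrite /G hornerD hornerN hornerC cReD cReN /=.
have eE : M - (K + e) = e by rewrite /e; field.
by rewrite ler_norml => /andP[+ _]; rewrite lerBrDr addrC eE.
Qed.
End maximum_modulus.

Section cdifferentiable.
Variable R : realType.
Implicit Types f g : R -> R[i].
Local Notation Re := complex.Re.
Local Notation Im := complex.Im.

Definition cdiff f (x : R) : Prop := exists w, has_cderiv f x w.

Lemma cdiff_cst w x : cdiff (fun=> w) x.
Proof. by exists 0; exact: has_cderiv_cst. Qed.

Lemma cdiffM f g x : cdiff f x -> cdiff g x -> cdiff (fun y => f y * g y) x.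
Proof. by move=> [v hv] [w hw]; eexists; exact: has_cderivM hv hw. Qed.

Lemma cdiffV f x : f x != 0 -> cdiff f x -> cdiff (fun y => (f y)^-1) x.
Proof. by move=> fx [v hv]; eexists; exact: has_cderivV fx hv. Qed.

Lemma cdiff_horner f x q : cdiff f x -> cdiff (fun y => q.[f y]) x.
Proof. by move=> [v hv]; eexists; exact: has_cderiv_horner hv. Qed.

Lemma cdiff_expi x : cdiff (@expi R) x.
Proof. by eexists; exact: has_cderiv_expi. Qed.

Lemma cdiff_cpow p f x : 0 < Re (f x) -> cdiff f x -> cdiff (fun y => cpow p (f y)) x.
Proof. by move=> fx [v hv]; eexists; exact: has_cderiv_cpow fx hv. Qed.

Lemma cdiff_Re f : (forall x, cdiff f x) -> continuous (fun y => Re (f y)).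
Proof. by move=> h x; have [w [hw _]] := h x; exact: has_deriv_continuous hw. Qed.

Lemma cdiff_Im f : (forall x, cdiff f x) -> continuous (fun y => Im (f y)).
Proof. by move=> h x; have [w [_ hw]] := h x; exact: has_deriv_continuous hw. Qed.
End cdifferentiable.

(** * The mean value property of F^p, by differentiation in the radius *)

Section mean_value.
Variables (R : realType) (p : R) (F : {poly R[i]}) (r e : R).
Local Notation T := (@tdom R).
Local Notation Re := complex.Re.
Local Notation Im := complex.Im.
Hypothesis p0 : 0 <= p.
Hypothesis r1 : 1 < r.
Hypothesis e0 : 0 < e.
Hypothesis Fpos : forall z, cabs z < r -> e <= Re F.[z].

Let z (s t : R) : R[i] := (s%:C)%C * expi t.
Let G s t := cpow p F.[z s t].
Let D s t := cpow p F.[z s t] * ((p%:C)%C * (F^`().[z s t] / F.[z s t])).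

Let cabs_z s t : cabs (z s t) = `|s|.
Proof. by rewrite /z cabsM cabs_expi mulr1 cabs_real. Qed.

Let Re_gt0 s t : `|s| < r -> 0 < Re F.[z s t].
Proof. by move=> sr; apply: lt_le_trans e0 (Fpos _); rewrite cabs_z. Qed.

Let F_neq0 s t : `|s| < r -> F.[z s t] != 0.
Proof. by move=> sr; have := Re_gt0 t sr; apply: contraTneq => ->; rewrite ltxx. Qed.

Let G_s s t : `|s| < r -> has_cderiv (fun s => G s t) s (D s t * expi t).
Proof.
move=> sr; apply: has_cderivE (has_cderiv_cpow p (Re_gt0 t sr)
  (has_cderiv_horner F (has_cderiv_real (expi t) s))) _.
by rewrite /D -!mulrA; congr (_ * (_ * _)); rewrite [_^-1 * _]mulrC.
Qed.

(** The angular derivative is [i s] times the radial one: the Cauchy-Riemann equations in polar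
    form. *)
Let G_t s t : `|s| < r -> has_cderiv (fun t => G s t) t ((s%:C)%C * 'i%C * (D s t * expi t)).
Proof.
move=> sr; apply: has_cderivE (has_cderiv_cpow p (Re_gt0 t sr)
  (has_cderiv_horner F (has_cderivZ (s%:C)%C (has_cderiv_expi t)))) _.
by rewrite /D -/(z s t); move: (F.[z s t])^-1 => v; ring.
Qed.

Let cdiff_z s x : cdiff (fun t => z s t) x.
Proof. by apply: cdiffM; [exact: cdiff_cst|exact: cdiff_expi]. Qed.

Let cdiff_G s x : `|s| < r -> cdiff (fun t => G s t) x.
Proof. by move=> sr; apply: cdiff_cpow; [exact: Re_gt0|exact/cdiff_horner/cdiff_z]. Qed.

Let cdiff_D s x : `|s| < r -> cdiff (fun t => D s t * expi t) x.
Proof.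
move=> sr; apply: cdiffM; last exact: cdiff_expi.
apply: cdiffM; first exact: cdiff_G.
apply: cdiffM; first exact: cdiff_cst.
apply: cdiffM; first exact/cdiff_horner/cdiff_z.
by apply: cdiffV; [exact: F_neq0|exact/cdiff_horner/cdiff_z].
Qed.

Let B := pnorm r F `^ p * (`|p| * (pnorm r F^`() / e)).

Let cabs_D s t : `|s| < r -> cabs (D s t * expi t) <= B.
Proof.
move=> sr; rewrite cabsM cabs_expi mulr1 /D cabsM cabs_cpow ?Re_gt0// 2!cabsM.
have zr : cabs (z s t) <= r by rewrite cabs_z ltW.
have r0 : 0 <= r by rewrite ltW// (lt_trans ltr01).
have eF : e <= cabs F.[z s t].
  by apply: le_trans (normr_Re_le _); apply: le_trans (ler_norm _); apply: Fpos; rewrite cabs_z.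
apply: ler_pM; rewrite ?powR_ge0 ?mulr_ge0 ?cabs_ge0//.
- by apply: ge0_ler_powR; rewrite ?nnegrE ?cabs_ge0 ?pnorm_ge0 ?cabs_horner_pnorm//.
- rewrite cabs_real ler_wpM2l//; apply: ler_pM; rewrite ?cabs_ge0 ?cabs_horner_pnorm//.
  by rewrite cabsV lef_pV2// posrE (lt_le_trans e0).
Qed.

Let measurable_Re_D s : `|s| < r -> measurable_fun T (fun t => Re (D s t * expi t)).
Proof.
move=> sr; apply: measurable_funTS; apply: continuous_measurable_fun.
by apply: cdiff_Re => y; exact: cdiff_D.
Qed.

Let intg_D s : `|s| < r -> intg (fun t => Re (D s t * expi t)).
Proof.
move=> sr; apply: (@intg_bounded _ _ B); first exact: measurable_Re_D.
by move=> t _; apply: le_trans (normr_Re_le _) (cabs_D _ _).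
Qed.

Let intg_G s : `|s| < r -> intg (fun t => Re (G s t)).
Proof.
move=> sr; apply: (@intg_bounded _ _ (pnorm r F `^ p)).
  apply: measurable_funTS; apply: continuous_measurable_fun.
  by apply: cdiff_Re => y; exact: cdiff_G.
move=> t _; apply: le_trans (normr_Re_le _) _; rewrite cabs_cpow ?Re_gt0//.
apply: ge0_ler_powR; rewrite ?nnegrE ?cabs_ge0 ?pnorm_ge0 ?cabs_horner_pnorm//.
- by rewrite ltW// (lt_trans ltr01).
- by rewrite cabs_z ltW.
Qed.

(** The integrand times [s] is the angular derivative of Im F^p, by [G_t], and Im F^p takes the same
    value at both ends of the period. *)
Let It_D s : `|s| < r -> s != 0 -> It (fun t => Re (D s t * expi t)) = 0.
Proof.
move=> sr s0.
have hc : continuous (fun t => s * Re (D s t * expi t)).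
  move=> x; apply: cvgM; first exact: cvg_cst.
  by apply: cdiff_Re => y; exact: cdiff_D.
have hd t : is_derive (t : R) 1 (fun t => Im (G s t)) (s * Re (D s t * expi t)).
  have [_ h] := G_t t sr; apply: has_derivE h _.
  rewrite -mulrA cImMr; congr (_ * _); case: (D s t * expi t) => a b /=.
  by rewrite mul0r mul1r add0r.
have := It_FTC hc hd.
have -> : G s (2 * pi) = G s 0.
  rewrite /G /z; have := @cos_mulz_2pi R 1; have := @sin_mulz_2pi R 1.
  by rewrite !mul1r /expi => -> ->; rewrite cos0 sin0.
rewrite subrr ItZ; first by move/eqP; rewrite mulf_eq0 (negbTE s0) => /eqP.
exact: intg_D.
Qed.

Let Phi s := It (fun t => Re (G s t)).

Let in_r s : `]- r, r[%classic s -> `|s| < r.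
Proof. by rewrite /= in_itv/= ltr_norml. Qed.

Let partialG s t : `|s| < r -> partial1of2 (fun s t => Re (G s t)) s t = Re (D s t * expi t).
Proof.
by move=> sr; rewrite partial1of2E; have [h _] := G_s t sr; have := h => -[].
Qed.

(** The constant [B] dominates the radial derivative on the whole interval ]-r, r[. Allowing
    negative radii makes 0 an interior point, and r > 1 does the same for 1. *)
Let Phi_deriv s : `|s| < r -> derivable Phi s 1 /\ Phi^`() s = It (fun t => Re (D s t * expi t)).
Proof.
move=> sr; have Is : `]- r, r[%classic s by rewrite /= in_itv/= -ltr_norml.
have h1 x : `]- r, r[%classic x -> lebesgue_measure.-integrable T (EFin \o (fun t => Re (G x t))).
  by move=> /in_r; exact: intg_G.
have h2 x y : `]- r, r[%classic x -> T y -> derivable (fun x => Re (G x y)) x 1.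
  by move=> /in_r xr _; have [h _] := G_s y xr; have := h => -[].
have h3 (y : R) : 0 <= B.
  by apply: le_trans (cabs_ge0 _) (@cabs_D 0 0 _); rewrite normr0 (lt_trans ltr01).
have h4 x y : `]- r, r[%classic x -> T y ->
    `|partial1of2 (fun s t => Re (G s t)) x y| <= B.
  by move=> /in_r xr _; rewrite partialG//; apply: le_trans (normr_Re_le _) (cabs_D _ _).
split; first exact (@derivable_under_integral R _ _ (@lebesgue_measure R) _ T measurable_tdom _ _ _ Is h1 h2 (fun=> B) h3 (intg_cst B) h4).
rewrite [LHS](@differentiation_under_integral R _ _ (@lebesgue_measure R) _ T measurable_tdom _ _ _ Is h1 h2 (fun=> B) h3 (intg_cst B) h4).
by apply: eq_It => t _; rewrite partialG.
Qed.

(** The circular mean has zero derivative on ]0, 1[ and is continuous on [0, 1]; at radius 0 the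
    integrand is constant. *)
Lemma mean_value_cpow :
  It (fun t => Re (cpow p F.[expi t])) = 2 * pi * Re (cpow p F.[0]).
Proof.
have r0 : 0 < r := lt_trans ltr01 r1.
have sub s : 0 <= s <= 1 -> `|s| < r.
  by move=> /andP[s0 s1]; rewrite ger0_norm// (le_lt_trans s1).
have h1 x : x \in `]0, 1[%R -> is_derive (x : R) 1 Phi ((fun=> 0) x).
  rewrite in_itv/= => /andP[x0 x1]; have xr : `|x| < r by apply: sub; rewrite !ltW.
  have [dP dE] := Phi_deriv xr; apply: DeriveDef => //.
  by rewrite -derive1E dE It_D// gt_eqF.
have h2 : {within `[0, 1], continuous Phi}.
  apply: derivable_within_continuous => x; rewrite in_itv/= => /sub xr.
  by have [] := Phi_deriv xr.
have [c _] := MVT ltr01 h1 h2; rewrite mul0r => /eqP; rewrite subr_eq0 => /eqP.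
rewrite /Phi /G /z; under eq_It => t _ do rewrite mul1r; move=> ->.
under eq_It => t _ do rewrite mul0r.
by rewrite It_cst mulrC.
Qed.
End mean_value.

(** * M. Riesz's theorem on trigonometric polynomials *)

Section riesz_positive.
Variables (R : realType) (p : R).
Hypotheses (p1 : 1 < p) (p2 : p <= 2).
Local Notation T := (@tdom R).
Local Notation Re := complex.Re.
Local Notation Im := complex.Im.

Let p0 : 0 < p. Proof. exact: lt_trans ltr01 p1. Qed.

Lemma ler_cos (x y : R) : 0 <= x -> x <= y -> y <= pi -> cos y <= cos x.
Proof.
move=> x0 xy ypi; have y0 := le_trans x0 xy.
rewrite leNgt ltr_cos ?in_itv/= ?x0 ?y0 ?ypi ?(le_trans xy)//.
by rewrite -leNgt.
Qed.

(** Near |u| = pi/2 the power of cos u is useless, but there p |u| lies between pi/2 and pi, where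
    the cosine is negative; this is where 1 < p <= 2 enters. The threshold [v] is the midpoint of
    pi/(2p) and pi/2. Beyond [v], B = -1 / cos (p v) makes the second term at least 1; up to [v], A
    = (1 + B) / (cos v)^p compensates a loss of at most B. *)
Lemma cos_powR_bound : exists A B : R, [/\ 0 < A, 0 < B &
  forall u, `|u| < pi / 2 -> 1 <= A * cos u `^ p - B * cos (p * u)].
Proof.
have pi0 := @pi_gt0 R.
have ph : 0 < pi / 2 :> R by rewrite divr_gt0.
have q0 : 0 < pi / 2 / p :> R by rewrite divr_gt0.
have qh : pi / 2 / p < pi / 2 :> R.
  by rewrite ltr_pdivrMr// ltr_pMr.
have pph : p * (pi / 2) <= pi :> R.
  by rewrite mulrA ler_pdivrMr// mulrC ler_pM2l.
pose v : R := (pi / 2 / p + pi / 2) / 2.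
have qv : pi / 2 / p < v by rewrite /v ltr_pdivlMr// mulr_natr mulr2n ltrD2l.
have vh : v < pi / 2 by rewrite /v ltr_pdivrMr// mulr_natr mulr2n ltrD2r.
have v0 : 0 < v := lt_trans q0 qv.
have pv : pi / 2 < p * v by rewrite [p * v]mulrC -ltr_pdivrMr.
have pvpi : p * v <= pi by apply: le_trans pph; rewrite ler_pM2l// ltW.
have c0 : cos (p * v) < 0.
  rewrite -(@cos_pihalf R) ltr_cos// in_itv/= ?pvpi ?(ltW (lt_trans ph pv))//.
  by rewrite (ltW ph) (le_trans (ltW pv)).
pose B := - (cos (p * v))^-1.
have B0 : 0 < B by rewrite oppr_gt0 invr_lt0.
have cv0 : 0 < cos v.
  by apply: cos_gt0_pihalf; rewrite vh andbT (lt_trans _ v0)// oppr_lt0.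
have cvp : 0 < cos v `^ p by rewrite powR_gt0.
exists ((1 + B) / cos v `^ p), B; split => //; first by rewrite divr_gt0// addr_gt0.
move=> u uh.
have -> : cos (p * u) = cos (p * `|u|) by rewrite -[LHS]cos_norm normrM (gtr0_norm p0).
rewrite -[cos u]cos_norm; move: (normr_ge0 u) uh; move: `|u| => {}u u0 uh.
have cu0 : 0 < cos u.
  by apply: cos_gt0_pihalf; rewrite uh andbT (lt_le_trans _ u0)// oppr_lt0.
have [uv|vu] := leP u v.
  apply: (@le_trans _ _ ((1 + B) - B * 1)); first by rewrite mulr1 addrK.
  apply: lerB; last by rewrite ler_wpM2l ?cos_le1// ltW.
  rewrite -mulrA ler_peMr ?addr_ge0 ?(ltW B0)// ler_pdivlMl// mulr1.
  apply: ge0_ler_powR; rewrite ?nnegrE ?(ltW cv0) ?(ltW cu0) ?(ltW p0)//.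
  by apply: ler_cos => //; rewrite ltW// (lt_trans vh)// ltr_pdivrMr// mulr_natr mulr2n ltrDl.
have cpu : cos (p * u) <= cos (p * v).
  apply: ler_cos; first by rewrite mulr_ge0 ?(ltW p0) ?(ltW v0).
    by rewrite ler_pM2l// ltW.
  by apply: le_trans pph; rewrite ler_pM2l// ltW.
apply: (@le_trans _ _ (0 - B * cos (p * v))).
  by rewrite sub0r /B mulNr opprK mulVf// lt_eqF.
apply: lerB; first by rewrite mulr_ge0 ?powR_ge0// divr_ge0 ?powR_ge0// addr_ge0// ltW.
by rewrite ler_pM2l.
Qed.

(** Both sides are homogeneous of degree [p], so only the argument of [z], which is Im (clog z),
    matters. *)
Lemma cpow_bound : exists A B : R, [/\ 0 < A, 0 < B &
  forall z, 0 < Re z -> cabs z `^ p <= A * Re z `^ p - B * Re (cpow p z)].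
Proof.
have [A [B [A0 B0 h]]] := cos_powR_bound; exists A, B; split => // z z0.
set u := Im (clog z).
have uh : `|u| < pi / 2.
  by rewrite /u /= ltr_norml atan_gtNpi2 atan_ltpi2.
have cu : 0 <= cos u.
  by apply: cos_ge0_pihalf; rewrite -ler_norml ltW.
rewrite (Re_polar z0) Re_cpow// -/u powRM ?cabs_ge0//.
have -> : A * (cabs z `^ p * cos u `^ p) - B * (cabs z `^ p * cos (p * u)) =
  cabs z `^ p * (A * cos u `^ p - B * cos (p * u)) by ring.
by rewrite ler_peMr ?powR_ge0// h.
Qed.

(** Integrating [cpow_bound] makes Re F^p contribute -2 pi B F(0)^p, a negative term since F(0) is a
    positive real. It is moved to the left and kept, as a bound on the mean is wanted later. The
    constant adds the bounds of the two terms taken separately. *)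
Lemma riesz_positive : exists2 C : R, 0 < C & forall (F : {poly R[i]}) (d : R),
  0 < d -> (forall t, T t -> d <= Re F.[expi t]) -> Im F`_0 = 0 ->
  Ip p (fun t => F.[expi t]) + cabs F`_0 `^ p <= C * It (fun t => Re F.[expi t] `^ p).
Proof.
have [A [B [A0 B0 h]]] := cpow_bound.
have pi2 : 0 < 2 * pi :> R by rewrite mulr_gt0 ?pi_gt0.
pose K := B * (2 * pi); have K0 : 0 < K by rewrite mulr_gt0.
exists (A + A / K); first by rewrite addr_gt0// divr_gt0.
move=> F d d0 hF F0.
have [r [e [r1 e0 hr]]] := Re_pos_extension d0 hF.
have mv := mean_value_cpow (ltW p0) r1 e0 hr.
have F00 : F.[0] = ((Re F`_0)%:C)%C.
  by rewrite horner_coef0; move: F0; case: (F`_0) => a b /= ->.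
have ReF0 : 0 < Re F`_0.
  apply: lt_le_trans e0 _; rewrite -[Re _]/(Re ((Re F`_0)%:C)%C) -F00; apply: hr.
  by rewrite cabs0 (lt_trans ltr01).
have cF0 : cabs F`_0 = Re F`_0.
  by rewrite -horner_coef0 F00 cabs_real gtr0_norm.
set I := It (fun t => Re F.[expi t] `^ p).
have mRe : measurable_fun T (fun t => Re F.[expi t]) by case: (cmeas_poly F).
have iRe : intg (fun t => Re F.[expi t] `^ p).
  apply: (intg_le0 _ (Lp_intg (Lp_poly p1 F))).
    apply: (@measurableT_comp _ _ _ _ _ _ (fun x => x `^ p)).
      exact: measurable_powR.
    exact: mRe.
  move=> t Tt; rewrite ger0_norm ?powR_ge0//; apply: ge0_ler_powR.
  - exact: ltW.
  - by rewrite nnegrE (le_trans (ltW d0))// hF.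
  - by rewrite nnegrE cabs_ge0.
  - exact: le_trans (ler_norm _) (normr_Re_le _).
have icp : intg (fun t => Re (cpow p F.[expi t])).
  have hd x : cdiff (fun t => cpow p F.[expi t]) x.
    apply: cdiff_cpow; last exact/cdiff_horner/cdiff_expi.
    by apply: lt_le_trans e0 (hr _ _); rewrite cabs_expi.
  apply: (intg_le0 _ (Lp_intg (Lp_poly p1 F))).
    by apply: measurable_funTS; apply: continuous_measurable_fun; exact: cdiff_Re.
  move=> t Tt; apply: le_trans (normr_Re_le _) _; rewrite cabs_cpow//.
  by apply: lt_le_trans d0 (hF _ _).
have main : Ip p (fun t => F.[expi t]) + K * cabs F`_0 `^ p <= A * I.
  have -> : K * cabs F`_0 `^ p = B * It (fun t => Re (cpow p F.[expi t])).
    by rewrite mv F00 cpow_real// cF0 /K -!mulrA.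
  rewrite -lerBrDr -(ItZ A iRe) -(ItZ B icp) -ItB; try exact: intgZ.
  apply: le_It; first exact: Lp_intg (Lp_poly p1 F).
    by apply: intgB; exact: intgZ.
  by move=> t Tt; apply: h; apply: lt_le_trans d0 (hF _ _).
rewrite mulrDl; apply: lerD.
  by apply: le_trans main; rewrite lerDl mulr_ge0 ?powR_ge0// ltW.
rewrite mulrAC ler_pdivlMr// mulrC; apply: le_trans main.
by rewrite lerDr Ip_ge0.
Qed.
End riesz_positive.

(** * Uniform approximation of the positive part of Re q by real parts of polynomials *)

Section chord.
Variable R : realType.
Local Notation T := (@tdom R).
Local Notation Re := complex.Re.
Local Notation Im := complex.Im.

Lemma cabs_subX (z w : R[i]) n : cabs z <= 1 -> cabs w <= 1 ->
  cabs (z ^+ n - w ^+ n) <= n%:R * cabs (z - w).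
Proof.
move=> z1 w1; elim: n => [|n IH]; first by rewrite !expr0 subrr cabs0 mul0r.
have -> : z ^+ n.+1 - w ^+ n.+1 = z * (z ^+ n - w ^+ n) + (z - w) * w ^+ n.
  by rewrite !exprS; ring.
apply: le_trans (cabsD _ _) _; rewrite !cabsM cabsX mulrSr mulrDl mul1r.
apply: lerD.
  by apply: le_trans IH; rewrite ler_piMl ?cabs_ge0.
by rewrite ler_piMr ?cabs_ge0// exprn_ile1 ?cabs_ge0.
Qed.

Lemma cabs_sub_expi (s t : R) : cabs (expi s - expi t) ^+ 2 = 2 * (1 - cos (t - s)).
Proof.
rewrite sqr_cabs cReD cImD cReN cImN /= cosB.
have := cos2Dsin2 s; have := cos2Dsin2 t; nra.
Qed.

Lemma poly_chord_lipschitz (q : {poly R[i]}) : exists2 L : R, 0 <= L &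
  forall s t, cabs (q.[expi s] - q.[expi t]) <= L * cabs (expi s - expi t).
Proof.
exists (\sum_(i < size q) cabs q`_i * i%:R).
  by apply: sumr_ge0 => i _; rewrite mulr_ge0 ?cabs_ge0.
move=> s t; rewrite !horner_coef -sumrB; apply: le_trans (cabs_sum _ _ _) _.
rewrite mulr_suml; apply: ler_sum => i _.
rewrite -mulrBr cabsM -mulrA ler_wpM2l ?cabs_ge0//.
by rewrite cabs_subX ?cabs_expi.
Qed.

Lemma fejer_approximation_max (q : {poly R[i]}) (e : R) : 0 < e ->
  exists W : {poly R[i]}, Im W`_0 = 0 /\
    forall t, `|Re W.[expi t] - Num.max (Re q.[expi t]) 0| <= e.
Proof.
have mg : measurable_fun T (fun t => Num.max (Re q.[expi t]) 0).
  apply: measurable_maxr; last exact: measurable_cst.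
  by case: (cmeas_poly q).
apply: fejer_approximation => //.
  have [iR _] := cintg_ReIm (cintg_poly q).
  apply: (intg_le0 mg (intg_abs iR)) => t _.
  by rewrite /Num.max; case: ltP => // _; rewrite normr0.
have [L L0 hL] := poly_chord_lipschitz q.
(* From y <= d + y^2 / d with y = L |e^{is} - e^{it}|, where y^2 = 2 L^2 (1 - cos (t - s)). *)
move=> d d0; exists (2 * L ^+ 2 / d) => s t.
set a := Re q.[expi s]; set b := Re q.[expi t].
apply: (@le_trans _ _ `|a - b|).
  have := ler_norm (a - b); have := ler_norm (b - a); rewrite distrC.
  have := normr_ge0 (a - b); move: `|a - b| => n n0 h1 h2.
  by rewrite /Num.max ler_norml; case: (ltP a 0) => ?; case: (ltP b 0) => ?; apply/andP; split; lra.
have : `|a - b| <= L * cabs (expi s - expi t).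
  apply: le_trans (hL s t); apply: le_trans (normr_Re_le _).
  by rewrite cReD cReN.
move/le_trans; apply.
have := cabs_sub_expi s t; have := cabs_ge0 (expi s - expi t).
move: (cabs _) (1 - cos _) => x c x0 xc.
have -> : 2 * L ^+ 2 / d * c = (L * x) ^+ 2 / d by rewrite exprMn xc; field; rewrite gt_eqF.
have [h|h] := leP (L * x) d.
  by apply: (le_trans h); rewrite lerDl divr_ge0 ?sqr_ge0// ltW.
apply: ler_wpDl; first exact: ltW.
rewrite ler_pdivlMr// expr2 ler_wpM2l ?ltW//.
by rewrite (lt_trans d0).
Qed.
End chord.

(** * Control of a polynomial by its real part, of any sign *)

Section riesz_real.
Variables (R : realType) (p : R).
Hypotheses (p1 : 1 < p) (p2 : p <= 2).
Local Notation T := (@tdom R).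
Local Notation Re := complex.Re.
Local Notation Im := complex.Im.

Let p0 : 0 < p. Proof. exact: lt_trans ltr01 p1. Qed.

Lemma intg_normr_Re_powR (F : {poly R[i]}) : intg (fun t => `|Re F.[expi t]| `^ p).
Proof.
have [mRe _] := cmeas_poly F.
apply: (intg_le0 _ (Lp_intg (Lp_poly p1 F))).
  apply: (@measurableT_comp _ _ _ _ _ _ (fun x => x `^ p)).
    exact: measurable_powR.
  exact: measurableT_comp.
move=> t Tt; rewrite ger0_norm ?powR_ge0//; apply: ge0_ler_powR.
- exact: ltW.
- by rewrite nnegrE.
- by rewrite nnegrE cabs_ge0.
- exact: normr_Re_le.
Qed.

(** F = W - V, where Re W and Re V approximate the positive and negative parts of Re F from above
    and are bounded below by a positive constant, so [riesz_positive] applies to each. One factor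
    [c] comes from this splitting, the other from separating |Re F| from the error. *)
Lemma riesz_real : exists2 C : R, 0 < C & forall F : {poly R[i]}, Im F`_0 = 0 ->
  Ip p (fun t => F.[expi t]) + cabs F`_0 `^ p <= C * It (fun t => `|Re F.[expi t]| `^ p).
Proof.
have [C C0 hC] := riesz_positive p1 p2.
have pi2 : 0 < 2 * pi :> R by rewrite mulr_gt0 ?pi_gt0.
pose c : R := 2 `^ p; have c0 : 0 < c by exact: powR_gt0.
exists (c * (C * c + C * c)).
  by rewrite mulr_gt0// addr_gt0// mulr_gt0.
move=> F F0; set I := It _.
apply/ler_addgt0Pr => h h0.
(* [h'] is tuned so that the total error is exactly [h], and [e] so that (3 e)^p = h'. *)
pose h' := h / (c * (C * c + C * c)) / (2 * pi).
have h'0 : 0 < h' by rewrite !divr_gt0// mulr_gt0// addr_gt0// mulr_gt0.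
pose e := h' `^ p^-1 / 3.
have e0 : 0 < e by rewrite divr_gt0// powR_gt0.
have e3 : (3 * e) `^ p = h'.
  by rewrite /e mulrC divfK// -powRrM mulVf ?gt_eqF// powRr1// ltW.
have e30 : 0 <= 3 * e by apply: mulr_ge0 => //; exact: ltW.
have [W0 [W00 hW0]] := fejer_approximation_max F e0.
(* The shift by 2e exceeds the approximation error e: it leaves real parts at least e, and at most
   |Re F| + 3e. *)
pose W := W0 + ((2 * e)%:C)%C%:P.
have WE t : Re W.[expi t] = Re W0.[expi t] + 2 * e by rewrite hornerD hornerC cReD.
have W0E : Im W`_0 = 0 by rewrite coefD coefC eqxx cImD W00 add0r.
pose V := W - F.
have VE t : Re V.[expi t] = Re W.[expi t] - Re F.[expi t].
  by rewrite hornerD hornerN cReD cReN.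
have V0E : Im V`_0 = 0 by rewrite coefD coefN cImD cImN W0E F0 subr0.
have bounds t : T t -> [/\ e <= Re W.[expi t] <= `|Re F.[expi t]| + 3 * e &
    e <= Re V.[expi t] <= `|Re F.[expi t]| + 3 * e].
  move=> Tt; have := hW0 t; rewrite VE WE ler_norml => /andP[]; set x := Re F.[_].
  set m := Num.max x 0; have m1 : x <= m by rewrite /m le_max lexx.
  have m2 : 0 <= m by rewrite /m le_max lexx orbT.
  have m3 : m <= `|x| by rewrite /m ge_max ler_norm normr_ge0.
  have m4 : m - x <= `|x|.
    rewrite /m /Num.max; case: ltP => x0; first by rewrite sub0r -normrN ler_norm.
    by rewrite subrr.
  by move=> h1 h2; split; apply/andP; split; lra.
have bnd U : (forall t, T t -> e <= Re U.[expi t] <= `|Re F.[expi t]| + 3 * e) ->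
    Im U`_0 = 0 -> Ip p (fun t => U.[expi t]) + cabs U`_0 `^ p <= C * c * (I + h' * (2 * pi)).
  move=> hU U0; apply: le_trans (hC U e e0 _ U0) _.
    by move=> t /hU/andP[].
  rewrite -mulrA ler_pM2l//.
  have i1 := intg_normr_Re_powR F.
  rewrite -It_cst /I -ItD//; last exact: intg_cst.
  rewrite -ItZ; last by apply: intgD => //; exact: intg_cst.
  apply: le_It.
  - apply: (eq_intg _ (intg_normr_Re_powR U)) => t /hU/andP[eU _].
    by rewrite ger0_norm// (le_trans _ eU)// ltW.
  - by apply: intgZ; apply: intgD => //; exact: intg_cst.
  - move=> t /hU/andP[eU Ue]; rewrite -e3.
    apply: le_trans (powRDle _ _ (ltW p0)); rewrite ?e30//.
    apply: ge0_ler_powR; rewrite ?nnegrE ?(ltW p0) ?addr_ge0 ?e30//.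
    by rewrite (le_trans _ eU)// ltW.
have kW := bnd W (fun t Tt => (bounds t Tt).1) W0E.
have kV := bnd V (fun t Tt => (bounds t Tt).2) V0E.
have FE t : F.[expi t] = W.[expi t] - V.[expi t].
  by rewrite /V hornerD hornerN opprB addrC subrK.
have F0E : F`_0 = W`_0 - V`_0 by rewrite /V coefD coefN opprB addrC subrK.
have -> : Ip p (fun t => F.[expi t]) = Ip p (fun t => W.[expi t] - V.[expi t]).
  by apply: eq_Ip => t _; rewrite FE.
apply: (@le_trans _ _ (c * (Ip p (fun t => W.[expi t]) + Ip p (fun t => V.[expi t]))
   + c * (cabs W`_0 `^ p + cabs V`_0 `^ p))).
  apply: lerD; first by apply: IpB => //; exact: Lp_poly.
  by rewrite F0E -(cabsN V`_0); exact: cabs_powRD.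
have -> : c * (C * c + C * c) * I + h = c * (C * c * (I + h' * (2 * pi)) + C * c * (I + h' * (2 * pi))).
  have hE : c * (C * c + C * c) * (h' * (2 * pi)) = h.
    rewrite /h' divfK ?gt_eqF// mulrC divfK// gt_eqF//.
    by rewrite mulr_gt0// addr_gt0// mulr_gt0.
  by rewrite -hE; ring.
rewrite -mulrDr ler_pM2l// addrACA; exact: lerD.
Qed.
End riesz_real.

(** * The Riesz projection on trigonometric polynomials, for all exponents *)

Section riesz.
Variables (R : realType).
Implicit Types (p : R) (q : {poly R[i]}).
Local Notation Re := complex.Re.
Local Notation Im := complex.Im.
Local Notation J := ('i%C : R[i]).

(* [q.[expi t]] and [expi (- n t) * q.[expi t]] have the same modulus, and
   [drop_poly n q] is the analytic part of the latter, so this is the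
   boundedness of the Riesz projection on trigonometric polynomials. *)
Definition riesz_bounded p : Prop := exists2 C : R, 0 < C &
  forall n q, Ip p (fun t => (drop_poly n q).[expi t]) <= C * Ip p (fun t => q.[expi t]).

(** Conjugation on the circle followed by multiplication by e^{int}. Only exponents n - k with k < n
    occur, so the constant coefficient vanishes. *)
Definition reflect_poly n q : {poly R[i]} := \sum_(k < n) ((q`_k)^*)%R *: 'X^(n - k).

Lemma reflect_polyE n q (t : R) : (size q <= n)%N ->
  (reflect_poly n q).[expi t] = expi t ^+ n * (q.[expi t]^*)%R.
Proof.
move=> qn; have expiJ : expi t * ((expi t)^*)%R = 1 by rewrite -expiN expiMN.
rewrite (@horner_coef_wide _ n q)//.
rewrite horner_sum rmorph_sum mulr_sumr; apply: eq_bigr => k _.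
rewrite hornerZ hornerXn rmorphM/= rmorphXn mulrCA; congr (_ * _).
have -> : expi t ^+ n = expi t ^+ (n - k) * expi t ^+ k.
  by rewrite -exprD subnK// ltnW.
by rewrite -mulrA -exprMn [X in X ^+ k]expiJ expr1n mulr1.
Qed.

Lemma two_pi_ge1 : 1 <= 2 * pi :> R.
Proof. have := @pi_ge2 R; lra. Qed.

(* With [q = A + 'X^n D], the polynomials [F1 = D + A*] and [F2 = - i D + i A*],
   where [A*] is the reflection of [A], have as real parts on the circle the real
   and imaginary parts of [expi (- n t) * q], and [F1 + i F2 = 2 D]. *)
Lemma riesz_bounded_le2 p : 1 < p -> p <= 2 -> riesz_bounded p.
Proof.
move=> p1 p2; have [C C0 hC] := riesz_real p1 p2.
have p0 : 0 < p := lt_trans ltr01 p1.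
have pi2 := two_pi_ge1.
have pi20 : 0 <= 2 * pi :> R by exact: le_trans ler01 pi2.
pose c : R := 2 `^ p; have c0 : 0 < c by exact: powR_gt0.
exists (c * c * (2 * pi) * (C + C)).
  have pi2p : 0 < 2 * pi :> R := lt_le_trans ltr01 pi2.
  by apply: mulr_gt0; [apply: mulr_gt0 => //; exact: mulr_gt0|exact: addr_gt0].
move=> n q; set D := drop_poly n q; pose A := take_poly n q.
pose A' := reflect_poly n A.
have A'E t : A'.[expi t] = expi t ^+ n * (A.[expi t]^*)%R.
  by apply: reflect_polyE; exact: size_take_poly.
have A'0 : A'`_0 = 0.
  rewrite /A' /reflect_poly coef_sum big1// => k _; rewrite coefZ coefXn eqn_leq leq0n/= leqn0.
  by rewrite subn_eq0 leqNgt ltn_ord/= mulr0.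
pose f t := expi t ^- n * q.[expi t].
have fE t : f t = D.[expi t] + (A'.[expi t]^*)%R.
  rewrite /f -[q in LHS](poly_take_drop n) hornerD hornerM hornerXn mulrDr addrC.
  have en : expi t ^+ n != 0.
    by rewrite -expiMn; apply/eqP => h; have := cabs_expi (n%:R * t); rewrite h cabs0 => /esym/eqP; rewrite oner_eq0.
  rewrite mulrC mulfK//; congr (_ + _).
  rewrite A'E rmorphM/= conjCK rmorphXn/= -expiN; congr (_ * _).
  apply: (mulfI en); rewrite mulfV// -exprMn expiMN expr1n.
  by [].
have absf t : cabs (f t) = cabs q.[expi t].
  by rewrite /f cabsM cabsV cabsX cabs_expi expr1n invr1 mul1r.
(* Purely imaginary constants are added to F1 and F2: the real parts are unaffected and the constant
   coefficients become the reals [a] and [b], as [riesz_real] requires. Recovering 2 D then costs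
   the constant a + i b, paid for by the constant-coefficient term in [riesz_real]. *)
pose a := Re D`_0; pose b := Im D`_0.
pose F1 := D + A' - (J * (b%:C)%C)%:P.
pose F2 := J *: (A' - D) + (J * (a%:C)%C)%:P.
have F1E t : F1.[expi t] = D.[expi t] + A'.[expi t] - J * (b%:C)%C.
  by rewrite !hornerD hornerN hornerC.
have F2E t : F2.[expi t] = J * (A'.[expi t] - D.[expi t]) + J * (a%:C)%C.
  by rewrite hornerD hornerZ hornerD hornerN hornerC.
have ReF1 t : Re F1.[expi t] = Re (f t).
  by rewrite F1E fE; move: D.[_] A'.[_] => [x y] [u v] /=; ring.
have ReF2 t : Re F2.[expi t] = Im (f t).
  by rewrite F2E fE; move: D.[_] A'.[_] => [x y] [u v] /=; ring.
have F10 : F1`_0 = (a%:C)%C.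
  rewrite !coefD coefN coefC eqxx A'0 addr0 /a /b; case: (D`_0) => x y /=.
  by apply/eqP; rewrite eq_complex /=; apply/andP; split; apply/eqP; ring.
have F20 : F2`_0 = (b%:C)%C.
  rewrite coefD coefZ coefD coefN coefC eqxx A'0 add0r /a /b; case: (D`_0) => x y /=.
  by apply/eqP; rewrite eq_complex /=; apply/andP; split; apply/eqP; ring.
have DE t : 2 * D.[expi t] = F1.[expi t] + J * F2.[expi t] + ((a%:C)%C + J * (b%:C)%C).
  rewrite F1E F2E; move: D.[_] A'.[_] => [x y] [u v].
  by apply/eqP; rewrite eq_complex /=; apply/andP; split; apply/eqP; ring.
have I1 := hC F1; have I2 := hC F2; rewrite F10 in I1; rewrite F20 in I2.
have If (g : R[i] -> R) F : (forall z, `|g z| <= cabs z) -> (forall t, Re F.[expi t] = g (f t)) ->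
    It (fun t => `|Re F.[expi t]| `^ p) <= Ip p (fun t => q.[expi t]).
  move=> hg hF; apply: le_It; first exact: intg_normr_Re_powR.
    exact: Lp_intg (Lp_poly p1 q).
  move=> t _; rewrite hF -absf; apply: ge0_ler_powR; rewrite ?nnegrE ?cabs_ge0 ?(ltW p0)//.
have {}I1 := le_trans (I1 erefl) (ler_wpM2l (ltW C0) (If _ _ (@normr_Re_le R) ReF1)).
have {}I2 := le_trans (I2 erefl) (ler_wpM2l (ltW C0) (If _ _ (@normr_Im_le R) ReF2)).
have iF F : intg (fun t => cabs F.[expi t] `^ p) := Lp_intg (Lp_poly p1 F).
set N := Ip p (fun t => q.[expi t]) in I1 I2 *.
set X1 := cabs (a%:C)%C `^ p in I1; set X2 := cabs (b%:C)%C `^ p in I2.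
have X10 : 0 <= X1 by exact: powR_ge0.
have X20 : 0 <= X2 by exact: powR_ge0.
have J1 : 0 <= Ip p (fun t => F1.[expi t]) := Ip_ge0 _ _.
have J2 : 0 <= Ip p (fun t => F2.[expi t]) := Ip_ge0 _ _.
apply: (@le_trans _ _ (It (fun t => c * c *
    ((cabs F1.[expi t] `^ p + cabs F2.[expi t] `^ p) + (X1 + X2))))).
  apply: le_It; first exact: iF.
    by apply: intgZ; apply: intgD; [apply: intgD; exact: iF|exact: intg_cst].
  move=> t _; apply: (@le_trans _ _ (cabs (2 * D.[expi t]) `^ p)).
    apply: ge0_ler_powR; rewrite ?nnegrE ?cabs_ge0 ?(ltW p0)//.
    have -> : (2 : R[i]) = (2%:C)%C by rewrite rmorph_nat.
    by rewrite cabsM cabs_real ger0_norm// ler_peMl ?cabs_ge0// ler1n.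
  rewrite DE; apply: le_trans (cabs_powRD p1 _ _) _.
  rewrite -mulrA ler_pM2l// mulrDr; apply: lerD.
    apply: le_trans (cabs_powRD p1 _ _) _.
    by rewrite cabsM (_ : cabs J = 1) ?mul1r// /cabs /= expr0n add0r expr1n sqrtr1.
  apply: le_trans (cabs_powRD p1 _ _) _.
  by rewrite cabsM (_ : cabs J = 1) ?mul1r// /cabs /= expr0n add0r expr1n sqrtr1.
rewrite ItZ; last by apply: intgD; [apply: intgD; exact: iF|exact: intg_cst].
rewrite ItD; [|by apply: intgD; exact: iF|exact: intg_cst].
rewrite ItD ?It_cst; try exact: iF.
rewrite -/(Ip p (fun t => F1.[expi t])) -/(Ip p (fun t => F2.[expi t])).
have assoc (x w y z : R) : x * w * (y + y) * z = x * (w * (y * z + y * z)) by ring.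
rewrite assoc.
rewrite ler_pM2l; last exact: mulr_gt0.
(* Integrating the constant terms produces 2 pi >= 1, which is therefore allowed in front of the
   whole bound. *)
have arr (w x y u v k : R) : 1 <= w -> 0 <= x -> 0 <= y -> x + u <= k -> y + v <= k ->
    x + y + (u + v) * w <= w * (k + k).
  move=> w1 x0 y0 hx hy; apply: (@le_trans _ _ (w * ((x + u) + (y + v)))).
    have -> : w * ((x + u) + (y + v)) = w * (x + y) + (u + v) * w by ring.
    by rewrite lerD2r ler_peMl// addr_ge0.
  by rewrite ler_wpM2l ?lerD// (le_trans ler01).
exact (arr _ _ _ _ _ _ pi2 J1 J2 I1 I2).
Qed.

(* Cotlar's identity, for the multiplicities encoded by [drop_poly]:
   [D^2 = 2 P(q D) - P(q^2)] with [D = P q]. *)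
Lemma drop_poly_sqr n q : let D := drop_poly n q in
  D ^+ 2 = 2 *: drop_poly n (q * D) - drop_poly (n + n) (q ^+ 2).
Proof.
move=> D; pose A := take_poly n q.
have qE : q = A + D * 'X^n by rewrite poly_take_drop.
have sA : (size A <= n)%N by exact: size_take_poly.
have -> : drop_poly n (q * D) = drop_poly n (A * D) + D ^+ 2.
  rewrite {1}qE mulrDl drop_polyD mulrAC drop_polyMXn_id.
  by [].
have -> : q ^+ 2 = A ^+ 2 + (2 *: (A * D) + D ^+ 2 * 'X^n) * 'X^n.
  rewrite {1}qE scaler_nat; ring.
have sA2 : (size (A ^+ 2) <= n + n)%N.
  apply: leq_trans (size_polyMleq _ _) _; apply: leq_trans (leq_pred _) _.
  exact: leq_add.
rewrite drop_polyD (drop_poly_eq0 sA2) add0r.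
have drop2 s : drop_poly (n + n) (s * 'X^n) = drop_poly n s.
  apply/polyP => i; rewrite !coef_drop_poly coefMXn.
  by rewrite addnA ltnNge leq_addl/= addnK.
rewrite drop2 drop_polyD drop_polyMXn_id drop_polyZ scalerDr.
by rewrite !scaler_nat; ring.
Qed.

Lemma young (k u v : R) : 0 < k -> u * v <= (2 * k)^-1 * v ^+ 2 + k / 2 * u ^+ 2.
Proof.
move=> k0; have : 0 <= (2 * k)^-1 * (v - k * u) ^+ 2.
  by rewrite mulr_ge0 ?sqr_ge0// invr_ge0 mulr_ge0// ltW.
have -> : (2 * k)^-1 * (v - k * u) ^+ 2 = (2 * k)^-1 * v ^+ 2 + k / 2 * u ^+ 2 - u * v.
  by field; rewrite gt_eqF.
by rewrite subr_ge0.
Qed.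

(** The weight c^2 C in Young's inequality is the one for which [X] returns on the right with
    coefficient 1/2; being a finite number, it can be subtracted. *)
Lemma absorb (c C X Y P1 P2 P3 : R) : 0 < c -> 0 < C ->
  X <= c * (c * P1 + P2) -> P1 <= C * P3 -> P2 <= C * Y ->
  P3 <= (2 * (c * c * C))^-1 * X + c * c * C / 2 * Y ->
  X <= 2 * (c * c * C * (c * c * C) / 2 + c * C) * Y.
Proof.
move=> c0 C0 h1 h2 h3 h4.
have : X <= c * (c * (C * ((2 * (c * c * C))^-1 * X + c * c * C / 2 * Y)) + C * Y).
  apply: (le_trans h1); rewrite ler_pM2l//; apply: lerD => //.
  by rewrite ler_pM2l//; apply: (le_trans h2); rewrite ler_pM2l.
have -> : c * (c * (C * ((2 * (c * c * C))^-1 * X + c * c * C / 2 * Y)) + C * Y) =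
    X / 2 + (c * c * C * (c * c * C) / 2 + c * C) * Y.
  by field; rewrite !gt_eqF.
rewrite -[2 * _ * Y]mulrA; move: (_ * Y) => Z; lra.
Qed.

(** The 2p-integral of D is the p-integral of D^2, which Cotlar's identity expresses by projections
    of q D and q^2. The first still involves D; Young's inequality makes its share small enough to
    absorb. *)
Lemma riesz_bounded_double p : 1 < p -> riesz_bounded p -> riesz_bounded (2 * p).
Proof.
move=> p1 [C C0 hC].
have p0 : 0 < p := lt_trans ltr01 p1.
have pp1 : 1 < 2 * p by lra.
pose c : R := 2 `^ p; have c0 : 0 < c by exact: powR_gt0.
pose K := c * c * C; have K0 : 0 < K by rewrite !mulr_gt0.
exists (2 * (K * K / 2 + c * C)); first by rewrite mulr_gt0// addr_gt0 ?mulr_gt0.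
move=> n q; set D := drop_poly n q.
have sq (z : R[i]) : cabs z `^ (2 * p) = cabs (z ^+ 2) `^ p.
  by rewrite powRrM cabsX powR_mulrn ?cabs_ge0.
have iq F r : 1 < r -> intg (fun t => cabs F.[expi t] `^ r) := fun r1 => Lp_intg (Lp_poly r1 F).
set X := Ip (2 * p) (fun t => D.[expi t]).
set Y := Ip (2 * p) (fun t => q.[expi t]).
have h1 : X <= c * (c * Ip p (fun t => (drop_poly n (q * D)).[expi t]) +
                    Ip p (fun t => (drop_poly (n + n) (q ^+ 2)).[expi t])).
  have -> : X = Ip p (fun t => (2 * (drop_poly n (q * D)).[expi t]) - (drop_poly (n + n) (q ^+ 2)).[expi t]).
    apply: eq_It => t _; rewrite sq -horner_exp drop_poly_sqr hornerD hornerN hornerZ.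
    by [].
  apply: le_trans (IpB p1 (LpZ p1 _ (Lp_poly p1 _)) (Lp_poly p1 _)) _.
  rewrite ler_pM2l// IpZ; last exact: Lp_poly.
  have -> : (2 : R[i]) = (2%:C)%C by rewrite rmorph_nat.
  by rewrite cabs_real ger0_norm.
have h2 : Ip p (fun t => (q ^+ 2).[expi t]) = Y.
  by apply: eq_It => t _; rewrite horner_exp -sq.
have h3 : Ip p (fun t => (q * D).[expi t]) <= (2 * K)^-1 * X + (K / 2) * Y.
  rewrite /X /Y /Ip -(ItZ (2 * K)^-1 (iq _ D _ pp1)) -(ItZ (K / 2) (iq _ q _ pp1)).
  rewrite -ItD; try (by apply: intgZ; exact: iq).
  apply: le_It; first exact: iq.
    by apply: intgD; apply: intgZ; exact: iq.
  move=> t _; rewrite !sq !cabsX hornerM cabsM.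
  have sq2 (x : R) : 0 <= x -> (x ^+ 2) `^ p = (x `^ p) ^+ 2.
    by move=> x0; rewrite !expr2 powRM.
  rewrite (sq2 _ (cabs_ge0 D.[_])) (sq2 _ (cabs_ge0 q.[_])) (powRM p (cabs_ge0 q.[_]) (cabs_ge0 D.[_])).
  move: (cabs q.[_] `^ p) (cabs D.[_] `^ p) => u v.
  exact: young.
have h4 := hC (n + n) (q ^+ 2); rewrite h2 in h4.
exact (absorb c0 C0 h1 (hC n (q * D)) h4 h3).
Qed.

(** An exponent above 2 stays above 1 when halved, so repeated halving ends in ]1, 2]. *)
Lemma riesz_bounded_gt1 p : 1 < p -> riesz_bounded p.
Proof.
have h k p' : 1 < p' -> p' <= 2 ^+ k.+1 -> riesz_bounded p'.
  elim: k p' => [|k IH] q q1 q2; first exact: riesz_bounded_le2.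
  have [q2'|q2'] := leP q 2; first exact: riesz_bounded_le2.
  have -> : q = 2 * (q / 2) by field.
  apply: riesz_bounded_double; first by lra.
  apply: IH; first by lra.
  by rewrite ler_pdivrMr// -exprSr.
move=> p1; apply: (h (Num.truncn p)) => //.
apply: le_trans (ltW (truncnS_gt p)) _.
rewrite -natrX ler_nat; exact: ltnW (ltn_expl _ _).
Qed.
End riesz.

(** * Density, uniqueness and completeness *)

Section convergence.
Variable R : realType.
Local Notation mu := (@lebesgue_measure R).
Local Notation T := (@tdom R).
Local Notation mT f := (measurable_fun T f).

Lemma It_dominated (f_ : nat -> R -> R) (g : R -> R) :
  (forall n, mT (f_ n)) -> intg g ->
  (forall n t, T t -> `|f_ n t| <= g t) ->
  aeT (fun t => f_ n t @[n --> \oo] --> (0 : R)) ->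
  It (f_ n) @[n --> \oo] --> (0 : R).
Proof.
move=> mf ig fg f0.
have h1 n : measurable_fun T (EFin \o f_ n) by apply/measurable_EFinP.
have h2 : measurable_fun T (EFin \o (fun=> 0 : R)) by exact: measurable_cst.
have h3 : \forall t \ae mu, T t -> (EFin \o f_ n) t @[n --> \oo] --> (EFin \o (fun=> 0)) t.
  apply: (aeT_sub f0) => t Tt h; apply: cvg_comp h _; exact: cvg_id.
have h4 : \forall t \ae mu, forall n, T t -> (`|(EFin \o f_ n) t| <= (EFin \o g) t)%E.
  by apply: aeW => t n Tt; rewrite /= lee_fin fg.
have [_ _] := @dominated_convergence _ _ _ mu T measurable_tdom _ _ _ h1 h2 h3 ig h4.
rewrite integral0; exact: fine_cvg.
Qed.

(** The endpoint 0 is discarded because the functions approximated below are continuous on the line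
    but not periodic, so Fejer means need not converge there. *)
Lemma aeT_gt0 : aeT (fun t : R => 0 < t).
Proof.
exists [set 0]; split; [exact: measurable_set1|exact: lebesgue_measure_set1|].
move=> t /= h; apply: contrapT => t0; apply: h; rewrite /tdom /= in_itv/= => /andP[t1 _].
by rewrite lt_neqAle t1 andbT; apply/eqP => e; apply: t0.
Qed.

Lemma continuous_approx (f : R -> R) (e : R) : intg f -> 0 < e ->
  exists g : R -> R, [/\ continuous g, intg g & It (fun t => `|f t - g t|) < e].
Proof.
move=> hf e0.
have [g_ [cg ig h]] := @approximation_continuous_integrable R T f measurable_tdom (mu_tdom_fin R) hf.
have h' : It (fun t => `|f t - g_ n t|) @[n --> \oo] --> (0 : R) by exact: fine_cvg h.
have /cvgrPdist_lt/(_ e e0)[n _ hn] := h'.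
exists (g_ n); split; [exact: cg|exact: ig|].
have := hn n (leqnn n); rewrite sub0r normrN /= ger0_norm//.
by apply: It_ge0.
Qed.

Definition clip (M x : R) : R := Num.max (- M) (Num.min x M).

Lemma clip_le (M x : R) : 0 <= M -> `|clip M x| <= M.
Proof.
move=> M0; rewrite ler_norml /clip le_max lexx/= ge_max ge_min lexx orbT andbT.
lra.
Qed.

Lemma clip_lip (M x y : R) : `|clip M x - clip M y| <= `|x - y|.
Proof.
have := ler_norm (x - y); have := ler_norm (y - x); rewrite distrC.
have := normr_ge0 (x - y); move: `|x - y| => n n0 h1 h2.
rewrite /clip /Num.max /Num.min ler_norml.
by case: (ltP x M) => ?; case: (ltP y M) => ?; do 2 ?[case: ltP => ?]; apply/andP; split; lra.
Qed.

Lemma clip_id (M x : R) : `|x| <= M -> clip M x = x.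
Proof.
rewrite ler_norml => /andP[h1 h2]; rewrite /clip.
by rewrite (min_idPl h2) (max_idPr h1).
Qed.

Lemma measurable_clip (M : R) (f : R -> R) : mT f -> mT (fun t => clip M (f t)).
Proof.
move=> mf; apply: measurable_maxr; first exact: measurable_cst.
by apply: measurable_minr => //; exact: measurable_cst.
Qed.

Lemma cos_le_away (d x : R) : 0 < d -> d <= pi -> d <= `|x| <= 2 * pi - d -> cos x <= cos d.
Proof.
move=> d0 dpi /andP[dx xd]; rewrite -(cos_norm x); move: `|x| dx xd => y dy yd.
have [ypi|piy] := leP y pi; first by apply: ler_cos => //; exact: ltW.
have -> : cos y = cos (2 * pi - y).
  by rewrite cosB mulr_natl cos2pi sin2pi mul1r mul0r addr0.
apply: ler_cos; first exact: ltW.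
  by move: yd; move: (2 * pi) => w; lra.
by rewrite mulr_natl mulr2n lerBlDr lerD2l ltW.
Qed.

Lemma fejer_cvg (g : R -> R) (M t : R) : mT g -> (forall s, `|g s| <= M) ->
  {for t, continuous g} -> T t -> 0 < t ->
  complex.Re (fejer_poly n g).[expi t] @[n --> \oo] --> g t.
Proof.
move=> mg gM ct Tt t0.
have ig : intg g := intg_bounded mg (fun s _ => gM s).
apply/cvgrPdist_le => e e0.
have e2 : 0 < e / 2 by rewrite divr_gt0.
have /cvgrPdist_lt/(_ _ e2)[d /= d0 hd] := ct.
have t2 : 0 < 2 * pi - t by move: Tt; rewrite /tdom /= in_itv/= subr_gt0 => /andP[].
(* For [s] in the domain, |t - s| >= d' must also keep t - s at distance d' from both 2 pi and -2
   pi, hence the minimum with t and 2 pi - t. *)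
pose d' := Num.min (Num.min d pi) (Num.min t (2 * pi - t)).
have d'0 : 0 < d' by rewrite !lt_min d0 pi_gt0 t0 t2.
have d'pi : d' <= pi by rewrite !ge_min lexx orbT.
have d'd : d' <= d by rewrite !ge_min lexx.
have d't : d' <= t by rewrite !ge_min lexx !orbT.
have d't2 : d' <= 2 * pi - t by rewrite !ge_min lexx !orbT.
have c0 : 0 < 1 - cos d'.
  rewrite subr_gt0 -[X in _ < X](@cos0 R) ltr_cos ?in_itv/= ?lexx ?pi_ge0//.
  by rewrite (ltW d'0).
have M0 : 0 <= M := le_trans (normr_ge0 _) (gM 0).
(* Chosen so that K (1 - cos d') is the trivial bound 2 M for |g s - g t|. *)
pose K := 2 * M / (1 - cos d').
have K0 : 0 <= K by rewrite divr_ge0 ?mulr_ge0// ltW.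
have key s : T s -> `|g s - g t| <= e / 2 + K * (1 - cos (t - s)).
  move=> Ts; have [h|h] := ltP `|t - s| d'.
    apply: ler_wpDr; first by rewrite mulr_ge0// subr_ge0 cos_le1.
    by rewrite distrC ltW//; apply: hd; rewrite /= (lt_le_trans h).
  apply: ler_wpDl; first exact: ltW.
  apply: (@le_trans _ _ (2 * M)).
    by apply: le_trans (ler_normB _ _) _; rewrite mulr_natl mulr2n lerD.
  rewrite -[X in X <= _](divfK (lt0r_neq0 c0)) -/K ler_wpM2l// lerB//.
  apply: cos_le_away => //; rewrite h/=.
  move: Ts; rewrite /tdom /= in_itv/= => /andP[s0 s2].
  by rewrite ler_norml; apply/andP; split; move: d't d't2 s0 s2; move: (2 * pi) => w; lra.
near=> n; rewrite distrC; apply: le_trans (fejer_poly_dist n mg ig key) _.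
rewrite [X in _ <= X](splitr e) lerD2l ler_pdivrMr// mulrC -ler_pdivrMr//.
apply: (@le_trans _ _ n%:R); last by rewrite ler_nat.
near: n; exact: nbhs_infty_ger.
Unshelve. all: by end_near. Qed.

(** The approximation is only in L^1, but the Fejer kernel is positive of mass one and preserves the
    bound [M]; that bound is what upgrades L^1 to L^p afterwards. *)
Lemma bounded_approx (f : R -> R) (M e : R) : mT f -> (forall t, T t -> `|f t| <= M) ->
  0 < M -> 0 < e -> exists W : {poly R[i]},
  (forall t, `|complex.Re W.[expi t]| <= M) /\
  It (fun t => `|f t - complex.Re W.[expi t]|) < e.
Proof.
move=> mf fM M0 e0; have if' := intg_bounded mf fM.
have e2 : 0 < e / 2 by rewrite divr_gt0.
have [g [cg ig hg]] := continuous_approx if' e2.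
pose g' t := clip M (g t).
have mg' : mT g' by apply: measurable_clip; exact: intg_mf.
have g'M t : `|g' t| <= M by apply: clip_le; exact: ltW.
have cg' : continuous g'.
  move=> t; apply/cvgrPdist_lt => d d0.
  have /cvgrPdist_lt/(_ _ d0) := cg t; apply: filterS => s.
  by apply: le_lt_trans; exact: clip_lip.
have mW n : mT (fun t => complex.Re (fejer_poly n g').[expi t]).
  by case: (cmeas_poly (fejer_poly n g')).
have ig' : intg g' := intg_bounded mg' (fun s _ => g'M s).
have WM n t : `|complex.Re (fejer_poly n g').[expi t]| <= M.
  by apply: fejer_poly_le => // s _.
have h : It (fun t => `|g' t - complex.Re (fejer_poly n g').[expi t]|) @[n --> \oo] --> (0 : R).
  apply: (@It_dominated _ (fun=> 2 * M)).
  - by move=> n; apply: measurableT_comp => //; exact: measurable_funB.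
  - exact: intg_cst.
  - move=> n t _; rewrite normr_id; apply: le_trans (ler_normB _ _) _.
    by rewrite mulr_natl mulr2n lerD.
  - apply: (aeT_sub aeT_gt0) => t Tt t0.
    have := fejer_cvg mg' g'M (cg' t) Tt t0.
    move/cvgrPdist_lt => hc; apply/cvgrPdist_lt => d /hc; apply: filterS => n.
    by rewrite sub0r normrN normr_id.
have /cvgrPdist_lt/(_ _ e2)[n _ hn] := h.
exists (fejer_poly n g'); split; first by move=> t; exact: WM.
have {}hn := hn n (leqnn n); rewrite /= sub0r normrN ger0_norm in hn; last exact: It_ge0.
have iW : intg (fun t => complex.Re (fejer_poly n g').[expi t]).
  by apply: (@intg_bounded _ _ M) => // t _; exact: WM.
apply: (@le_lt_trans _ _ (It (fun t => `|f t - g t|) +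
    It (fun t => `|g' t - complex.Re (fejer_poly n g').[expi t]|))); last first.
  by rewrite [X in _ < X](splitr e) ltrD.
rewrite -ItD; try exact/intg_abs/intgB.
apply: le_It; first exact/intg_abs/intgB.
  by apply: intgD; exact/intg_abs/intgB.
move=> t Tt; apply: le_trans (ler_distD (g' t) _ _) _; rewrite lerD2r.
by rewrite -[f t in X in X <= _](@clip_id M) ?fM// clip_lip.
Qed.
End convergence.

(** * Density of trigonometric polynomials in L^p *)

Section density.
Variable R : realType.
Local Notation T := (@tdom R).
Local Notation mT f := (measurable_fun T f).
Local Notation Re := complex.Re.
Local Notation Im := complex.Im.

(** A trigonometric polynomial with frequencies at least -n, stored as an ordinary polynomial; the
    pair (n, q) is not unique. *)
Definition trig n (q : {poly R[i]}) (t : R) : R[i] := expi t ^- n * q.[expi t].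

Lemma norm_sub_clip (M x : R) : 0 <= M -> `|x - clip M x| <= `|x|.
Proof.
move=> M0; have := ler_norm x; have := ler_norm (- x); rewrite normrN.
have := normr_ge0 x; move: `|x| => n n0 h1 h2.
rewrite /clip /Num.max /Num.min ler_norml.
by case: (ltP x M) => ?; do ?[case: ltP => ?]; apply/andP; split; lra.
Qed.

Lemma measurable_normr_powR (p : R) (f : R -> R) : mT f -> mT (fun t => `|f t| `^ p).
Proof.
move=> mf; apply: (@measurableT_comp _ _ _ _ _ _ (fun x => x `^ p)).
  exact: measurable_powR.
exact: measurableT_comp.
Qed.

Lemma measurable_Re_poly (W : {poly R[i]}) : mT (fun t => Re W.[expi t]).
Proof. by case: (cmeas_poly W). Qed.

Lemma real_density (p : R) (f : R -> R) (e : R) : 1 < p -> mT f ->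
  intg (fun t => `|f t| `^ p) -> 0 < e ->
  exists W : {poly R[i]}, It (fun t => `|f t - Re W.[expi t]| `^ p) < e.
Proof.
move=> p1 mf hf e0.
have p0 : 0 < p := lt_trans ltr01 p1.
pose c : R := 2 `^ p; have c0 : 0 < c by exact: powR_gt0.
pose d := e / c / 2; have d0 : 0 < d by rewrite !divr_gt0.
have mc M : mT (fun t => clip M (f t)) by exact: measurable_clip.
have h : It (fun t => `|f t - clip n.+1%:R (f t)| `^ p) @[n --> \oo] --> (0 : R).
  apply: (@It_dominated _ _ (fun t => `|f t| `^ p)) => //.
  - by move=> n; apply: measurable_normr_powR; exact: measurable_funB.
  - move=> n t _; rewrite ger0_norm ?powR_ge0//; apply: ge0_ler_powR.
    + exact: ltW.
    + by rewrite nnegrE.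
    + by rewrite nnegrE.
    + exact: norm_sub_clip.
  - apply: aeT_all => t _; apply/cvgrPdist_lt => r r0.
    near=> n; rewrite clip_id ?subrr ?normr0 ?powR0 ?subrr ?normr0// ?gt_eqF//.
    apply: (@le_trans _ _ n%:R); last by rewrite ler_nat.
    near: n; exact: nbhs_infty_ger.
have /cvgrPdist_lt/(_ _ d0)[n _ hn] := h.
have {}hn := hn n (leqnn n); rewrite sub0r normrN ger0_norm in hn; last first.
  by apply: It_ge0 => t _; exact: powR_ge0.
pose M : R := n.+1%:R; have M0 : 0 < M by rewrite ltr0n.
(* Both the truncation and its approximant are bounded by M, so the p-th power of their difference
   is at most K times the difference itself. *)
pose K := (2 * M) `^ (p - 1); have K0 : 0 < K by rewrite powR_gt0// mulr_gt0.
have [W [WM hW]] := bounded_approx (mc M) (fun t _ => clip_le (f t) (ltW M0)) M0 (divr_gt0 d0 K0).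
exists W; pose g t := clip M (f t).
have iW : intg (fun t => `|g t - Re W.[expi t]|).
  have mgW : mT (fun t => g t - Re W.[expi t]).
    by apply: measurable_funB; [exact: mc|exact: measurable_Re_poly].
  apply: (@intg_bounded _ _ (M + M)); first exact: measurableT_comp.
  by move=> t _; rewrite normr_id (le_trans (ler_normB _ _))// lerD// clip_le// ltW.
have i1 : intg (fun t => `|f t - g t| `^ p).
  apply: (intg_le0 _ hf); first by apply: measurable_normr_powR; exact: measurable_funB mf (mc M).
  move=> t _; rewrite ger0_norm ?powR_ge0//; apply: ge0_ler_powR.
  + exact: ltW.
  + by rewrite nnegrE.
  + by rewrite nnegrE.
  + exact/norm_sub_clip/ltW.
have pw t : T t -> `|f t - Re W.[expi t]| `^ p <=
    c * (`|f t - g t| `^ p + K * `|g t - Re W.[expi t]|).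
  move=> Tt; apply: (@le_trans _ _ (c * (`|f t - g t| `^ p + `|g t - Re W.[expi t]| `^ p))).
    apply: le_trans (powRDle _ _ (ltW p0)) => //.
    apply: ge0_ler_powR; rewrite ?nnegrE ?addr_ge0 ?(ltW p0)//.
    exact: ler_distD.
  rewrite ler_pM2l// lerD2l -(mulr_powRB1 _ p0)// mulrC ler_wpM2r//.
  apply: ge0_ler_powR; rewrite ?nnegrE ?subr_ge0 ?(ltW p1)//.
    by rewrite mulr_ge0// ltW.
  apply: le_trans (ler_normB _ _) _; rewrite mulr_natl mulr2n lerD//.
  by rewrite clip_le// ltW.
have i2 : intg (fun t => `|f t - g t| `^ p + K * `|g t - Re W.[expi t]|).
  by apply: intgD => //; exact: intgZ.
have i3 : intg (fun t => `|f t - Re W.[expi t]| `^ p).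
  apply: (intg_le0 _ (intgZ c i2)).
    by apply: measurable_normr_powR; apply: measurable_funB => //; exact: measurable_Re_poly.
  by move=> t Tt; rewrite ger0_norm ?powR_ge0// pw.
apply: (@le_lt_trans _ _ (c * (It (fun t => `|f t - g t| `^ p) + K * It (fun t => `|g t - Re W.[expi t]|)))).
  rewrite -(ItZ K iW) -ItD//; last exact: intgZ.
  by rewrite -(ItZ c i2); apply: le_It => //; exact: intgZ.
have -> : e = c * (d + d) by rewrite /d; field; rewrite gt_eqF.
rewrite ltr_pM2l// ltrD// mulrC -ltr_pdivlMr//.
Unshelve. all: by end_near. Qed.

Lemma cabs_expiXV (t : R) n : cabs (expi t ^- n) = 1.
Proof. by rewrite cabsV cabsX cabs_expi expr1n invr1. Qed.

Lemma expiX_neq0 (t : R) n : expi t ^+ n != 0.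
Proof.
apply: expf_neq0; apply/eqP => h; have := cabs_expi t.
by rewrite h cabs0 => /eqP; rewrite eq_sym oner_eq0.
Qed.

Lemma trigDZ n q1 q2 a t : trig n (q1 + a *: q2) t = trig n q1 t + a * trig n q2 t.
Proof. by rewrite /trig hornerD hornerZ mulrDr mulrCA. Qed.

Lemma cabs_trig n q t : cabs (trig n q t) = cabs q.[expi t].
Proof. by rewrite /trig cabsM cabs_expiXV mul1r. Qed.

Lemma expiXV (t : R) n : expi t ^- n = expi ((- Posz n)%:~R * t).
Proof.
apply: (mulfI (expiX_neq0 t n)); rewrite mulfV ?expiX_neq0// -expiMn -expiD.
by rewrite mulrNz mulNr subrr expi0.
Qed.

Lemma cmeas_trig n q : cmeas (trig n q).
Proof.
apply: cmeasM; last exact: cmeas_poly.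
by apply: eq_cmeas (cmeas_expi (- Posz n)%:~R) => t; rewrite expiXV.
Qed.

Lemma Lp_trig (p : R) n q : 1 < p -> Lp p (trig n q).
Proof.
move=> p1; apply: (@Lp_bounded _ _ p1 _ (pnorm 1 q)); first exact: cmeas_trig.
by apply: aeT_all => t _; rewrite cabs_trig cabs_horner_pnorm ?cabs_expi.
Qed.

Lemma fcoef_trig n q (k : int) :
  fcoef (trig n q) k = if k + n is Posz j then q`_j else 0.
Proof.
rewrite (_ : trig n q = (fun t => expi ((- Posz n)%:~R * t) * q.[expi t])).
  by rewrite fcoef_shift opprK fcoef_poly.
by apply/funext => t; rewrite /trig expiXV.
Qed.

(** Re W = (W + \bar W) / 2, where \bar W = e^{-int} times the reflection of W. *)
Lemma Re_poly_trig n (W : {poly R[i]}) t : (size W <= n)%N ->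
  ((Re W.[expi t])%:C)%C = trig n (2^-1 *: (W * 'X^n + reflect_poly n W)) t.
Proof.
move=> Wn; rewrite /trig hornerZ hornerD hornerM hornerXn reflect_polyE//.
rewrite mulrCA mulrDr [W.[_] * _]mulrC !mulKf ?expiX_neq0//.
by rewrite [LHS]ReJ_add mulrC.
Qed.

Lemma density (p : R) (h : R -> R[i]) (e : R) : 1 < p -> Lp p h -> 0 < e ->
  exists n q, Ip p (fun t => trig n q t - h t) < e.
Proof.
move=> p1 hp e0; have [[m1 m2] ih] := (LpP p h).1 hp.
have p0 : 0 < p := lt_trans ltr01 p1.
pose c : R := 2 `^ p; have c0 : 0 < c by exact: powR_gt0.
pose d := e / c / 2; have d0 : 0 < d by rewrite !divr_gt0.
have dom (g : R[i] -> R) : mT (fun t => g (h t)) -> (forall z, `|g z| <= cabs z) ->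
    intg (fun t => `|g (h t)| `^ p).
  move=> mg hg; apply: (intg_le0 _ ih); first exact: measurable_normr_powR.
  move=> t _; rewrite ger0_norm ?powR_ge0//.
  by apply: ge0_ler_powR; rewrite ?nnegrE ?cabs_ge0 ?(ltW p0).
have [W1 hW1] := real_density p1 m1 (dom _ m1 (@normr_Re_le R)) d0.
have [W2 hW2] := real_density p1 m2 (dom _ m2 (@normr_Im_le R)) d0.
pose n := maxn (size W1) (size W2).
pose Q (W : {poly R[i]}) := 2^-1 *: (W * 'X^n + reflect_poly n W).
exists n, (Q W1 + 'i%C *: Q W2).
have E t : trig n (Q W1 + 'i%C *: Q W2) t =
    ((Re W1.[expi t])%:C)%C + 'i%C * ((Re W2.[expi t])%:C)%C.
  rewrite (Re_poly_trig t (leq_maxl (size W1) (size W2))) (Re_poly_trig t (leq_maxr (size W1) (size W2))).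
  exact: trigDZ.
have pw t : cabs (trig n (Q W1 + 'i%C *: Q W2) t - h t) `^ p <=
    c * (`|Re (h t) - Re W1.[expi t]| `^ p + `|Im (h t) - Re W2.[expi t]| `^ p).
  apply: le_trans (powRDle _ _ (ltW p0)) => //.
  apply: ge0_ler_powR; rewrite ?nnegrE ?addr_ge0 ?cabs_ge0 ?(ltW p0)//.
  apply: le_trans (cabs_le _) _; rewrite E; case: (h t) => x y /=.
  rewrite !mul0r !mul1r subr0 ?addr0 ?add0r.
  by rewrite [X in X + _]distrC [X in _ + X]distrC.
have i W (f : R -> R) : mT f -> intg (fun t => `|f t| `^ p) -> intg (fun t => `|f t - Re W.[expi t]| `^ p).
  move=> mf if'; apply: (intg_le0 _ (intgZ c (intgD if' (intg_normr_Re_powR p1 W)))).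
    by apply: measurable_normr_powR; apply: measurable_funB => //; exact: measurable_Re_poly.
  move=> t _; rewrite ger0_norm ?powR_ge0//; apply: le_trans (powRDle _ _ (ltW p0)) => //.
  by apply: ge0_ler_powR; rewrite ?nnegrE ?addr_ge0 ?(ltW p0)// ler_normB.
have i1 := i W1 _ m1 (dom _ m1 (@normr_Re_le R)).
have i2 := i W2 _ m2 (dom _ m2 (@normr_Im_le R)).
apply: (@le_lt_trans _ _ (c * (It (fun t => `|Re (h t) - Re W1.[expi t]| `^ p) +
   It (fun t => `|Im (h t) - Re W2.[expi t]| `^ p)))).
  rewrite -ItD// -(ItZ c (intgD i1 i2)); apply: le_It => //.
    exact: Lp_intg (LpB p1 (Lp_trig _ _ p1) hp).
  exact/intgZ/intgD.
have -> : e = c * (d + d) by rewrite /d; field; rewrite gt_eqF.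
by rewrite (ltr_pM2l c0); apply: ltrD.
Qed.
End density.

(** * Uniqueness of Fourier coefficients *)

Section uniqueness.
Variable R : realType.
Local Notation T := (@tdom R).
Local Notation mT f := (measurable_fun T f).
Local Notation Re := complex.Re.

(* Testing against approximations of the bounded function [f / (1 + `|f|)]. *)
Lemma real_uniqueness (f : R -> R) : intg f ->
  (forall W : {poly R[i]}, It (fun t => f t * Re W.[expi t]) = 0) ->
  aeT (fun t => f t = 0).
Proof.
move=> hf f0; have mf := intg_mf hf.
pose phi t := f t / (1 + `|f t|).
have den t : 0 < 1 + `|f t| by rewrite ltr_pwDl.
have phi1 t : `|phi t| <= 1.
  rewrite /phi normrM normfV (gtr0_norm (den t)) ler_pdivrMr// mul1r.
  by rewrite lerDr.
have mphi : mT phi.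
  apply: measurable_funM => //.
  apply: (@measurableT_comp _ _ _ _ _ _ (fun x : R => (1 + `|x|)^-1)) => //.
  apply: continuous_measurable_fun => x; apply: cvgV; first by rewrite gt_eqF// ltr_pwDl.
  by apply: cvgD; [exact: cvg_cst|exact: norm_continuous].
have prod_ge0 t : 0 <= f t * phi t.
  by rewrite /phi mulrA divr_ge0 ?(ltW (den t))// -expr2 sqr_ge0.
have ifphi : intg (fun t => f t * phi t).
  apply: (intg_le0 _ (intg_abs hf)); first exact: measurable_funM.
  by move=> t _; rewrite normrM ler_piMr.
have I0 : It (fun t => f t * phi t) = 0.
  apply/eqP; rewrite eq_le (It_ge0 (fun t _ => prod_ge0 t)) andbT.
  apply/ler_addgt0Pr => e e0; rewrite add0r.
  have e4 : 0 < e / 4 by rewrite divr_gt0.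
  have h : It (fun t => `|f t| - Num.min `|f t| n.+1%:R) @[n --> \oo] --> (0 : R).
    apply: (@It_dominated _ _ (fun t => `|f t|)).
    - move=> n; apply: measurable_funB; first exact: measurableT_comp.
      by apply: measurable_minr; [exact: measurableT_comp|exact: measurable_cst].
    - exact: intg_abs.
    - move=> n t _; rewrite ger0_norm; last by rewrite subr_ge0 ge_min lexx.
      by rewrite gerBl le_min normr_ge0/=.
    - apply: aeT_all => t _; apply/cvgrPdist_lt => r r0.
      near=> n; rewrite min_l ?subrr ?subrr ?normr0//.
      apply: (@le_trans _ _ n%:R); last by rewrite ler_nat.
      near: n; exact: nbhs_infty_ger.
  have /cvgrPdist_lt/(_ _ e4)[n _ hn] := h.
  have {}hn := hn n (leqnn n); rewrite sub0r normrN ger0_norm in hn; last first.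
    by apply: It_ge0 => t _; rewrite subr_ge0 ge_min lexx.
  pose K : R := n.+1%:R; have K0 : 0 < K by rewrite ltr0n.
  have e2K : 0 < e / 2 / K by rewrite !divr_gt0.
  have [W [WM hW]] := bounded_approx mphi (fun t _ => phi1 t) ltr01 e2K.
  have mW := measurable_Re_poly W.
  have ifW : intg (fun t => f t * Re W.[expi t]).
    apply: (intg_le0 _ (intg_abs hf)); first exact: measurable_funM.
    by move=> t _; rewrite normrM ler_piMr.
  rewrite -[It _]subr0 -(f0 W) -ItB//.
  have idiff : intg (fun t => `|phi t - Re W.[expi t]|).
    apply: (@intg_bounded _ _ (1 + 1)).
      by apply: measurableT_comp => //; exact: measurable_funB.
    by move=> t _; rewrite normr_id (le_trans (ler_normB _ _))// lerD.
  have imin : intg (fun t => `|f t| - Num.min `|f t| K).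
    apply: intgB; first exact: intg_abs.
    apply: (intg_le0 _ (intg_abs hf)).
      by apply: measurable_minr; [exact: measurableT_comp|exact: measurable_cst].
    move=> t _; rewrite ger0_norm ?ge_min ?lexx//.
    by rewrite le_min normr_ge0/= ltW.
  (* [f] is only integrable: the part of |f| below K is paired with the L^1 error of [W], while the
     excess over K meets the uniform bound |phi - Re W| <= 2. *)
  apply: (@le_trans _ _ (K * It (fun t => `|phi t - Re W.[expi t]|) +
     2 * It (fun t => `|f t| - Num.min `|f t| K))).
    rewrite -(ItZ K idiff) -(ItZ 2 imin) -ItD; try exact: intgZ.
    apply: le_It; first exact: intgB.
      by apply: intgD; exact: intgZ.
    move=> t _; rewrite -mulrBr; apply: le_trans (ler_norm _) _; rewrite normrM.
    have : `|phi t - Re W.[expi t]| <= 2.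
      by rewrite (le_trans (ler_normB _ _))// -[2]/(1 + 1) lerD.
    have := normr_ge0 (phi t - Re W.[expi t]).
    move: `|f t| `|phi t - _| (normr_ge0 (f t)) => u v u0 v0 v2.
    by rewrite /Num.min; case: ltP => uK; nra.
  apply: (@le_trans _ _ (e / 2 + 2 * (e / 4))); last by rewrite le_eqVlt; apply/orP; left; apply/eqP; field.
  apply: lerD; last by rewrite ler_pM2l// ltW.
  by rewrite mulrC -ler_pdivlMr// ltW.
have := It_eq0 ifphi (fun t _ => prod_ge0 t) I0.
move/aeT_sub; apply => t _ /eqP; rewrite /phi mulrA mulf_eq0 invr_eq0 (gt_eqF (den t)) orbF.
by rewrite mulf_eq0 orbb => /eqP.
Unshelve. all: by end_near. Qed.

Lemma cintMpoly_eq0 (f : R -> R[i]) (W : {poly R[i]}) : cintg f ->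
  (forall n, fcoef f n = 0) -> cint (fun t => f t * W.[expi t]) = 0.
Proof.
move=> hf f0.
rewrite (_ : (fun t => _) = (fun t => \sum_(k < size W) W`_k * (f t * expi (- ((- Posz k)%:~R * t))))); last first.
  apply/funext => t; rewrite horner_coef mulr_sumr; apply: eq_bigr => k _.
  by rewrite mulrCA -expiMn; congr (_ * (_ * expi _)); rewrite mulrNz mulNr opprK.
rewrite cint_sum; last by move=> k; apply: cintgZ; exact: cintg_mul_expi.
apply: big1 => k _; rewrite cintZ; last exact: cintg_mul_expi.
have /eqP := f0 (- Posz k); rewrite /fcoef mulf_eq0 twopiCV invr_eq0.
by rewrite (negbTE (twopiC_neq0 R)) => /eqP ->; rewrite mulr0.
Qed.

(** The conjugate of [f] has vanishing coefficients too, so 2 Re f integrates to zero against every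
    polynomial. *)
Lemma uniqueness_Re (f : R -> R[i]) : cintg f -> (forall n, fcoef f n = 0) ->
  aeT (fun t => Re (f t) = 0).
Proof.
move=> hf f0; have [iR _] := cintg_ReIm hf.
apply: real_uniqueness => // W.
have hfJ : cintg (cconj f).
  apply: (cintg_le (cmeasJ hf.1) hf.2).
  by apply: aeT_all => t _; rewrite cabs_conj.
have h1 := cintMpoly_eq0 W hf f0.
have h2 : cint (fun t => cconj f t * W.[expi t]) = 0.
  by apply: cintMpoly_eq0 => // n; rewrite fcoefJ// f0 rmorph0.
have iM g : cintg g -> cintg (fun t => g t * W.[expi t]).
  move=> hg; have := cintgMb hg (cmeas_poly W) (aeT_all (fun t _ => @cabs_horner_pnorm R 1 W (expi t) _)).
  rewrite (_ : (fun t => W.[expi t] * g t) = (fun t => g t * W.[expi t])).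
    by apply => t; rewrite cabs_expi.
  by apply/funext => t; rewrite mulrC.
have : cint (fun t => f t * W.[expi t] + cconj f t * W.[expi t]) = 0.
  by rewrite cintD ?h1 ?h2 ?addr0//; exact: iM.
rewrite cintE => -[+ _].
rewrite (@eq_It _ _ (fun t => 2 * (Re (f t) * Re W.[expi t]))); last first.
  move=> t _; rewrite -mulrDl /cconj; case: (f t) => x y; case: (W.[_]) => u v /=.
  by rewrite subrr mul0r subr0; ring.
rewrite ItZ; first by move/eqP; rewrite mulf_eq0 pnatr_eq0/= => /eqP.
apply: (intg_le0 _ (iM _ hf).2).
  by apply: measurable_funM; [exact: intg_mf|exact: measurable_Re_poly].
by move=> t _; rewrite normrM cabsM ler_pM// normr_Re_le.
Qed.

Lemma uniqueness (f : R -> R[i]) : cintg f -> (forall n, fcoef f n = 0) ->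
  aeT (fun t => f t = 0).
Proof.
move=> hf f0; have h1 := uniqueness_Re hf f0.
have h2 : aeT (fun t => Re ((- 'i)%C * f t) = 0).
  apply: uniqueness_Re; first exact: cintgZ.
  by move=> n; rewrite fcoefZ// f0 mulr0.
apply: (aeT_sub (aeT_and h1 h2)) => t _; case: (f t) => x y /= [-> ].
by rewrite oppr0 mul0r sub0r mulN1r opprK => ->.
Qed.
End uniqueness.

(** * Completeness of L^p *)

Section riesz_fischer.
Variable R : realType.
Local Notation mu := (@lebesgue_measure R).
Local Notation T := (@tdom R).
Local Notation mT f := (measurable_fun T f).
Local Notation Re := complex.Re.
Local Notation Im := complex.Im.

Lemma cvg_powR (p : R) (x : nat -> R) (l : R) : 0 < p -> (forall n, 0 <= x n) ->
  x @ \oo --> l -> x n `^ p @[n --> \oo] --> l `^ p.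
Proof.
move=> p0 x0 xl.
have l0 : 0 <= l.
  rewrite -(cvg_lim (@Rhausdorff R) xl); apply: limr_ge; first by apply/cvg_ex; exists l.
  exact: nearW.
(* The power is differentiable only away from 0, so a zero limit is treated by hand. *)
have [l00|l1] := eqVneq l 0; last first.
  have lp : 0 < l by rewrite lt_neqAle eq_sym l1.
  have c : {for l, continuous (@powR R ^~ p)}.
    apply: differentiable_continuous; apply/derivable1_diffP.
    by apply: derivable_powR; rewrite in_itv/= lp.
  exact: (cvg_comp _ _ xl c).
rewrite l00 powR0 ?gt_eqF//; apply/cvgrPdist_lt => e e0.
have e1 : 0 < e `^ p^-1 by exact: powR_gt0.
rewrite l00 in xl; move/cvgrPdist_lt/(_ _ e1) : xl; apply: filterS => n.
rewrite !sub0r !normrN !ger0_norm ?powR_ge0// => h.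
have -> : e = (e `^ p^-1) `^ p by rewrite -powRrM mulVf ?powRr1 ?gt_eqF// ltW.
by apply: gt0_ltr_powR; rewrite ?nnegrE ?powR_ge0.
Qed.

(** The upper limit is measurable and defined everywhere, whether or not the sequence converges. *)
Lemma measurable_limit (u : nat -> R -> R) : (forall n, mT (u n)) ->
  exists2 v : R -> R, mT v & forall t, cvgn (u ^~ t) -> u n t @[n --> \oo] --> v t.
Proof.
move=> mu_; exists (fun t => fine (limn_esup (fun n => (u n t)%:E))).
  apply: (@measurableT_comp _ _ _ _ _ _ fine); first exact: fine_measurable.
  by apply: measurable_fun_limn_esup => n; apply/measurable_EFinP.
move=> t /cvg_ex[l hl].
have h : (u n t)%:E @[n --> \oo] --> l%:E by apply: cvg_comp hl _; exact: cvg_id.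
rewrite is_cvg_limn_esupE; last by apply/cvg_ex; exists l%:E.
by rewrite (cvg_lim _ h).
Qed.

Lemma sum_half_le n : \sum_(k < n) (2^-1 : R) ^+ k <= 2.
Proof.
apply: le_trans (geometric_le _ _) _; first by rewrite invr_ge0 ler0n/= invf_lt1// ltr1n.
by rewrite le_eqVlt; apply/orP; left; apply/eqP; field.
Qed.

(** By monotone convergence the sum of the |d_k| has finite integral, hence is finite almost
    everywhere. *)
Lemma ae_summable (d : nat -> R -> R) (c : R) : (forall k, intg (d k)) ->
  (forall k, It (fun t => `|d k t|) <= c * 2^-1 ^+ k) ->
  aeT (fun t => cvgn (series (d ^~ t))).
Proof.
move=> id hd.
have c0 : 0 <= c.
  by have := hd 0%N; rewrite expr0 mulr1; apply: le_trans; apply: It_ge0.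
pose S t : \bar R := (\sum_(0 <= k <oo) (`|d k t|)%:E)%E.
have mS k : measurable_fun T (fun t => (`|d k t|)%:E).
  by apply/measurable_EFinP; apply: measurableT_comp => //; exact: intg_mf.
have S0 t : (0 <= S t)%E by apply: nneseries_ge0.
have iS : mu.-integrable T S.
  apply/integrableP; split.
    have hS0 k t : T t -> xpredT k -> (0 <= (`|d k t|)%:E :> \bar R)%E by rewrite lee_fin.
    exact: (ge0_emeasurable_sum hS0 (fun k _ => mS k)).
  apply: (@le_lt_trans _ _ (c * 2)%:E); last exact: ltry.
  have -> : (\int[mu]_(t in T) `|S t| = \int[mu]_(t in T) S t)%E.
    by apply: eq_integral => t _; rewrite gee0_abs.
  rewrite (integral_nneseries mu measurable_tdom)//.
  apply: (lime_le (is_cvg_nneseries (fun k _ _ => integral_ge0 _ _))) => //.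
  apply: nearW => n; rewrite big_mkord.
  rewrite (eq_bigr (fun k : 'I_n => (It (fun t => `|d k t|))%:E)); last first.
    by move=> k _; rewrite It_EFin//; exact: intg_abs.
  rewrite sumEFin lee_fin; apply: (@le_trans _ _ (\sum_(k < n) c * 2^-1 ^+ k)).
    by apply: ler_sum => k _; exact: hd.
  by rewrite -mulr_sumr ler_wpM2l// sum_half_le.
have := @integrable_ae _ _ _ mu T measurable_tdom _ iS; move/aeT_sub; apply => t Tt Sfin.
apply: (@normed_cvg _ R^o); apply: nondecreasing_is_cvgn.
  by apply: nondecreasing_series => k _ _ /=.
exists (fine (S t)) => _ [n _ <-]; rewrite -lee_fin fineK// /series /=.
by rewrite -sumEFin; apply: nneseries_lim_ge.
Qed.

Lemma cvgn_increments (u : nat -> R) : cvgn (series (fun k => u k.+1 - u k)) -> cvgn u.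
Proof.
move=> /cvg_ex[l hl]; apply/cvg_ex; exists (l + u 0%N).
apply: cvg_trans (cvgD hl (cvg_cst (u 0%N))); apply: near_eq_cvg; apply: nearW => n.
by rewrite fctE /series /= telescope_sumr// subrK.
Qed.

(** The geometric rate makes the increments summable in L^1, so real and imaginary parts converge
    almost everywhere; Fatou's lemma transfers the rate to the limit. *)
Lemma riesz_fischer (p : R) (g : nat -> R -> R[i]) : 1 < p ->
  (forall k, Lp p (g k)) ->
  (forall k m, (k <= m)%N -> Ip p (fun t => g m t - g k t) <= (2^-1 ^+ k) `^ p) ->
  exists2 h, Lp p h & forall k, Ip p (fun t => h t - g k t) <= (2^-1 ^+ k) `^ p.
Proof.
move=> p1 gp hg; have p0 : 0 < p := lt_trans ltr01 p1.
pose D k t := g k.+1 t - g k t.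
have Dp k : Lp p (D k) by exact: LpB.
have hD k : It (fun t => cabs (D k t)) <= (2 * pi + 1) * 2^-1 ^+ k.
  have x0 : 0 < (2^-1 : R) ^+ k by rewrite exprn_gt0// invr_gt0.
  (* With threshold x = 2^{-k} the second term is at most x^{1-p} x^p = x, so both terms are of
     order 2^{-k}. *)
  apply: le_trans (It_cabs_le p1 (Dp k) x0) _.
  rewrite [X in _ <= X]mulrDl mul1r [X in _ <= X + _]mulrC.
  rewrite lerD2l.
  have e1 : (2^-1 ^+ k) `^ (1 - p) * (2^-1 ^+ k) `^ p = 2^-1 ^+ k :> R.
    by rewrite -powRD ?subrK ?powRr1 ?(ltW x0)// (gt_eqF x0) implybT.
  by rewrite -[X in _ <= X]e1 ler_wpM2l ?powR_ge0// hg.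
have cv (f : R[i] -> R) : (forall z w, f (z - w) = f z - f w) -> (forall z, `|f z| <= cabs z) ->
    (forall h, cmeas h -> mT (fun t => f (h t))) -> aeT (fun t => cvgn (fun n => f (g n t))).
  move=> fB f1 mf.
  have iD k : intg (fun t => f (D k t)).
    apply: (intg_le0 _ (Lp_cintg p1 (Dp k)).2); first exact: mf (Lp_cmeas (Dp k)).
    by move=> t _; exact: f1.
  have := @ae_summable (fun k t => f (D k t)) (2 * pi + 1) iD.
  move=> /(_ _)/aeT_sub; apply.
    move=> k; apply: le_trans (hD k); apply: le_It; first exact/intg_abs/iD.
      exact: (Lp_cintg p1 (Dp k)).2.
    by move=> t _; exact: f1.
  move=> t _ h; apply: cvgn_increments; move: h.
  rewrite (_ : (fun k => f (D k t)) = (fun k => f (g k.+1 t) - f (g k t)))//.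
  by apply/funext => k; rewrite fB.
have cRe : aeT (fun t => cvgn (fun n => Re (g n t))).
  apply: cv; [by move=> z w; rewrite cReD cReN|exact: normr_Re_le|by move=> h []].
have cIm : aeT (fun t => cvgn (fun n => Im (g n t))).
  apply: cv; [by move=> z w; rewrite cImD cImN|exact: normr_Im_le|by move=> h []].
have [a ma ha] := @measurable_limit (fun n t => Re (g n t)) (fun n => (Lp_cmeas (gp n)).1).
have [b mb hb] := @measurable_limit (fun n t => Im (g n t)) (fun n => (Lp_cmeas (gp n)).2).
pose h t := (a t +i* b t)%C.
have mh : cmeas h by [].
have hlim : aeT (fun t => cabs (g n t - h t) @[n --> \oo] --> (0 : R)).
  apply: (aeT_sub (aeT_and cRe cIm)) => t _ [/ha hr /hb hi].
  have := cvgD (cvg_norm (cvgB hr (cvg_cst (a t)))) (cvg_norm (cvgB hi (cvg_cst (b t)))).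
  rewrite !subrr normr0 addr0 => hs.
  apply: (@squeeze_cvgr _ _ _ _ (fun=> 0) (fun n => `|Re (g n t) - a t| + `|Im (g n t) - b t|)).
  - apply: nearW => n; rewrite cabs_ge0/=; apply: le_trans (cabs_le _) _.
    by rewrite cReD cReN cImD cImN.
  - exact: cvg_cst.
  - exact: hs.
have key k : (\int[mu]_(t in T) (cabs (h t - g k t) `^ p)%:E <= ((2^-1 ^+ k) `^ p)%:E)%E.
  pose F m t : \bar R := (cabs (g (m + k)%N t - g k t) `^ p)%:E.
  have mF m : measurable_fun T (F m).
    by apply/measurable_EFinP; apply: measurable_cabs_powR; exact: Lp_cmeas (LpB p1 (gp _) (gp _)).
  have F0 m t : T t -> (0 <= F m t)%E by move=> _; rewrite lee_fin powR_ge0.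
  have limF : aeT (fun t => F m t @[m --> \oo] --> (cabs (h t - g k t) `^ p)%:E).
    apply: (aeT_sub hlim) => t _ ht.
    have h1 : cabs (g (m + k)%N t - g k t) @[m --> \oo] --> cabs (h t - g k t).
      apply/cvgrPdist_le => e e0.
      have ht' : cabs (g (m + k)%N t - h t) @[m --> \oo] --> (0 : R).
        by have := ht; rewrite -(cvg_shiftn k).
      move/cvgrPdist_le/(_ _ e0) : ht'; apply: filterS => m.
      rewrite sub0r normrN ger0_norm ?cabs_ge0// => hm.
      apply: le_trans hm; rewrite ler_norml; apply/andP; split.
        rewrite lerNl opprB lerBlDr.
        by have := cabsD (g (m + k)%N t - h t) (h t - g k t); rewrite addrA subrK.
      rewrite lerBlDr; have := cabsD (h t - g (m + k)%N t) (g (m + k)%N t - g k t).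
      by rewrite addrA subrK -(cabsN (h t - g (m + k)%N t)) opprB.
    have h2 := cvg_powR p0 (fun m => cabs_ge0 _) h1.
    by apply: cvg_comp h2 _; exact: cvg_id.
  have mlim : measurable_fun T (fun t => limn_einf (F ^~ t)).
    rewrite /limn_einf; apply: measurableT_comp => //.
    by apply: measurable_fun_limn_esup => m; exact: measurableT_comp.
  have mhk : measurable_fun T (fun t => (cabs (h t - g k t) `^ p)%:E).
    apply/measurable_EFinP; apply: measurable_cabs_powR; apply: cmeasB => //.
    exact: Lp_cmeas.
  rewrite (@ae_eq_integral _ _ _ mu T (fun t => limn_einf (F ^~ t)) _ measurable_tdom)//; last first.
    apply: (aeT_sub limF) => t _ ht /=.
    by rewrite is_cvg_limn_einfE; [rewrite (cvg_lim _ ht)|apply/cvg_ex; eexists; exact: ht].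
  apply: (le_trans (@fatou _ _ _ mu T measurable_tdom F mF F0)).
  rewrite limn_einf_lim; apply: lime_le; first exact: is_cvg_einfs.
  apply: nearW => m; apply: (@le_trans _ _ (\int[mu]_(t in T) F m t)%E).
    by apply: ereal_inf_lbound; exists m => //=.
  rewrite -It_EFin; last exact: Lp_intg (LpB p1 (gp _) (gp _)).
  by rewrite lee_fin hg// leq_addl.
have hkp k : Lp p (fun t => h t - g k t).
  split; first by apply: cmeasB => //; exact: Lp_cmeas.
  exact: le_lt_trans (key k) (ltry _).
exists h.
  have := LpD p1 (hkp 0%N) (gp 0%N).
  by rewrite (_ : (fun t => _) = h)//; apply/funext => t; rewrite subrK.
move=> k; rewrite -lee_fin It_EFin; last exact: Lp_intg (hkp k).
exact: key.
Qed.
End riesz_fischer.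

(** * The Szego projection *)

Section projection.
Variables (R : realType) (p : R).
Hypothesis p1 : 1 < p.

Let p0 : 0 < p. Proof. exact: lt_trans ltr01 p1. Qed.

Lemma trigB n m (q r : {poly R[i]}) t :
  trig n q t - trig m r t = trig (n + m) (q * 'X^m - r * 'X^n) t.
Proof.
rewrite /trig hornerD hornerN !hornerM !hornerXn exprD invfM.
have := expiX_neq0 t n; have := expiX_neq0 t m.
by move: (expi t ^+ n) (expi t ^+ m) => x y y0 x0; field; rewrite x0 y0.
Qed.

(** Makes the encoded projection additive across different shifts, so differences of projections
    fall under the polynomial inequality. *)
Lemma drop_poly_shift n m (q r : {poly R[i]}) :
  drop_poly (n + m) (q * 'X^m - r * 'X^n) = drop_poly n q - drop_poly m r.
Proof.
apply/polyP => i; rewrite coefB !coef_drop_poly coefB !coefMXn.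
have -> : (i + (n + m) < m)%N = false by rewrite ltnNge addnA leq_addl.
have -> : (i + (n + m) < n)%N = false by rewrite ltnNge addnCA leq_addr.
have -> : (i + (n + m) - m = i + n)%N by rewrite addnA addnK.
by have -> : (i + (n + m) - n = i + m)%N by rewrite addnCA addKn.
Qed.

Lemma half_powR_small (e : R) : 0 < e -> exists k : nat, (2^-1 ^+ k) `^ p < e.
Proof.
move=> e0; pose k := (Num.truncn e^-1).+1; exists k.
have k0 : 0 < k%:R :> R by rewrite ltr0n.
have x0 : 0 < (2^-1 : R) ^+ k by rewrite exprn_gt0// invr_gt0.
apply: (@le_lt_trans _ _ (2^-1 ^+ k)).
  apply: ge1r_powR; last exact: ltW.
  by rewrite x0 exprn_ile1 ?invr_ge0// invf_le1// ler1n.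
rewrite exprVn -[X in _ < X]invrK ltf_pV2 ?posrE ?exprn_gt0 ?invr_gt0//.
apply: (@lt_le_trans _ _ k%:R); first exact: truncnS_gt.
by rewrite -natrX ler_nat ltnW// ltn_expl.
Qed.

Lemma three_step_bound (c C X Y Z H u v d e : R) : 0 < c -> 0 < C ->
  X <= c * (Y + u) -> Y <= C * Z -> Z <= c * (v + H) -> u <= d -> v <= d ->
  d * (c * (1 + C * c)) = e -> X <= c * (C * c) * H + e.
Proof.
move=> c0 C0 hX hY hZ ud vd <-; apply: (le_trans hX).
have -> : c * (C * c) * H + d * (c * (1 + C * c)) = c * (C * (c * (d + H)) + d) by ring.
rewrite ler_pM2l//; apply: lerD => //; apply: (le_trans hY).
rewrite ler_pM2l//; apply: (le_trans hZ).
by rewrite ler_pM2l// lerD2r.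
Qed.

(** Projections of polynomials approximating [h] form a Cauchy sequence by [riesz_bounded_gt1]. The
    last clause records that one polynomial approximates [h] while its analytic part approximates
    [g]; [antianalytic_mul] depends on it. *)
Lemma riesz_extension : exists2 C : R, 0 < C & forall h, Lp p h -> exists g,
  [/\ Lp p g, Ip p g <= C * Ip p h, forall n : int, 0 <= n -> fcoef g n = fcoef h n,
      forall n : int, n < 0 -> fcoef g n = 0 &
      forall e : R, 0 < e -> exists n q, Ip p (fun t => trig n q t - h t) < e /\
        Ip p (fun t => (drop_poly n q).[expi t] - g t) < e].
Proof.
have [C C0 hC] := riesz_bounded_gt1 p1.
pose c : R := 2 `^ p; have c0 : 0 < c by exact: powR_gt0.
exists (c * (C * c)); first by rewrite !mulr_gt0.
move=> h hp.
(* Two approximations of [h] within x/K differ by at most 2 c x/K, and their projections by C times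
   that, which is x, the rate demanded by [riesz_fischer]. *)
pose K := C * (c * 2); have K0 : 0 < K by rewrite !mulr_gt0.
pose x k : R := (2^-1 ^+ k) `^ p.
have x0 k : 0 < x k by rewrite powR_gt0// exprn_gt0// invr_gt0.
have [N hN] : exists N : nat -> nat * {poly R[i]},
    forall k, Ip p (fun t => trig (N k).1 (N k).2 t - h t) < x k / K.
  have /choice[N hN] : forall k, exists nq : nat * {poly R[i]},
      Ip p (fun t => trig nq.1 nq.2 t - h t) < x k / K.
    by move=> k; have [n [q hq]] := density p1 hp (divr_gt0 (x0 k) K0); exists (n, q).
  by exists N.
pose tr k := trig (N k).1 (N k).2.
pose P k t := (drop_poly (N k).1 (N k).2).[expi t].
have trp k : Lp p (tr k) := Lp_trig _ _ p1.
have Pp k : Lp p (P k) := Lp_poly p1 _.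
have hP k : Ip p (P k) <= C * Ip p (tr k).
  rewrite (@eq_Ip _ p (tr k) (fun t => (N k).2.[expi t])); first exact: hC.
  by move=> t _; exact: cabs_trig.
have PB k m : (k <= m)%N -> Ip p (fun t => P m t - P k t) <= x k.
  move=> km.
  have -> : Ip p (fun t => P m t - P k t) = Ip p (fun t =>
      (drop_poly ((N m).1 + (N k).1) ((N m).2 * 'X^((N k).1) - (N k).2 * 'X^((N m).1))).[expi t]).
    by apply: eq_Ip => t _; rewrite drop_poly_shift hornerD hornerN.
  apply: le_trans (hC _ _) _.
  have -> : Ip p (fun t => ((N m).2 * 'X^((N k).1) - (N k).2 * 'X^((N m).1)).[expi t]) =
      Ip p (fun t => tr m t - tr k t).
    by apply: eq_Ip => t _; rewrite trigB cabs_trig.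
  rewrite -ler_pdivlMl//; apply: le_trans (Ip_tri p1 (trp m) hp (trp k)) _.
  rewrite -ler_pdivlMl// [Ip p (fun t => h t - _)]Ip_sym.
  have -> : c^-1 * (C^-1 * x k) = x k / K + x k / K.
    by rewrite /K; field; rewrite !gt_eqF.
  apply: lerD; last by rewrite ltW// hN.
  apply: le_trans (ltW (hN m)) _; rewrite ler_pM2r ?invr_gt0//.
  apply: ge0_ler_powR; rewrite ?nnegrE ?exprn_ge0 ?invr_ge0 ?(ltW p0)//.
  by apply: ler_wiXn2l => //; rewrite ?invr_ge0// invf_le1// ler1n.
have [g gp hg] := riesz_fischer p1 Pp PB.
have small e : 0 < e -> exists k, Ip p (fun t => tr k t - h t) < e /\
    Ip p (fun t => P k t - g t) < e.
  move=> e0; have m0 : 0 < Num.min e (e * K) by rewrite lt_min e0 mulr_gt0.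
  have [k] := half_powR_small m0; rewrite lt_min -/(x k) => /andP[ke keK].
  exists k; split; first by apply: lt_trans (hN k) _; rewrite ltr_pdivrMr.
  by rewrite Ip_sym (le_lt_trans (hg k)).
exists g; split => //.
- apply/ler_addgt0Pr => e e0.
  pose d := e / (c * (1 + C * c)); have d0 : 0 < d by rewrite divr_gt0// mulr_gt0// addr_gt0// mulr_gt0.
  have [k [hk1 hk2]] := small d d0.
  have h1 : Ip p g <= c * (Ip p (P k) + Ip p (fun t => P k t - g t)).
    apply: le_trans (IpB p1 (Pp k) (LpB p1 (Pp k) gp)).
    by rewrite le_eqVlt; apply/orP; left; apply/eqP/eq_Ip => t _; rewrite opprB addrC subrK.
  have h2 : Ip p (tr k) <= c * (Ip p (fun t => tr k t - h t) + Ip p h).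
    apply: le_trans (IpD p1 (LpB p1 (trp k) hp) hp).
    by rewrite le_eqVlt; apply/orP; left; apply/eqP/eq_Ip => t _; rewrite subrK.
  have dE : d * (c * (1 + C * c)) = e.
    by rewrite /d divfK// gt_eqF// mulr_gt0// addr_gt0// mulr_gt0.
  exact (three_step_bound c0 C0 h1 (hP k) h2 (ltW hk2) (ltW hk1) dE).
- move=> n n0; apply/eqP; rewrite -subr_eq0 -(fcoefB _ (Lp_cintg p1 gp) (Lp_cintg p1 hp)).
  apply/eqP; apply: (fcoef_approx p1 (LpB p1 gp hp)).
  move=> e e0; have d0 : 0 < e / c / 2 by rewrite !divr_gt0.
  have [k [hk1 hk2]] := small _ d0.
  exists (fun t => P k t - tr k t); split; first exact (LpB p1 (Pp k) (trp k)).
    apply: (@le_lt_trans _ _ (Ip p (fun t => (P k t - g t) - (tr k t - h t)))).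
      rewrite le_eqVlt; apply/orP; left; apply/eqP; apply: eq_Ip => t _; congr cabs.
      by rewrite !opprB addrACA [RHS]addrACA; congr (_ + _); rewrite addrC.
    apply: (le_lt_trans (IpB p1 (LpB p1 (Pp k) gp) (LpB p1 (trp k) hp))).
    rewrite -ltr_pdivlMl//; apply: (lt_le_trans (ltrD hk2 hk1)).
    by rewrite -splitr mulrC.
  rewrite (fcoefB _ (Lp_cintg p1 (Pp k)) (Lp_cintg p1 (trp k))).
  case: n n0 => // n _; rewrite fcoef_poly fcoef_trig -PoszD coef_drop_poly.
  by rewrite subrr.
- move=> n n0; apply: (fcoef_approx p1 gp) => e e0.
  have [k [_ hk]] := small e e0; exists (P k); split; [exact (Pp k)|exact hk|].
  by rewrite /P fcoef_poly; case: n n0.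
- move=> e e0; have [k hk] := small e e0; by exists (N k).1, (N k).2.
Qed.

Lemma eq_fcoef_ae (f g : R -> R[i]) : Lp p f -> Lp p g ->
  (forall n, fcoef f n = fcoef g n) -> aeT (fun t => f t = g t).
Proof.
move=> hf hg e; have [cf cg] := (Lp_cintg p1 hf, Lp_cintg p1 hg).
have h := uniqueness (cintgB cf cg).
apply: (aeT_sub (h _)); first by move=> n; rewrite (fcoefB _ cf cg) e subrr.
by move=> t _ /eqP; rewrite subr_eq0 => /eqP.
Qed.

Lemma eq_fcoef_Ip (f g : R -> R[i]) : Lp p f -> Lp p g ->
  (forall n, fcoef f n = fcoef g n) -> Ip p f = Ip p g.
Proof.
by move=> hf hg e; apply: eq_ae_Ip (Lp_cmeas hf) (Lp_cmeas hg) _; exact: eq_fcoef_ae.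
Qed.

Lemma Pplus_spec h : Lp p h -> Hp p (Pplus p h) /\
  forall n : int, 0 <= n -> fcoef (Pplus p h) n = fcoef h n.
Proof.
move=> hp; have [C _ hC] := riesz_extension; have [g [gp _ g1 g2 _]] := hC h hp.
apply: (@ClassicalEpsilon.epsilon_spec _ _ (fun g => Hp p g /\ forall n : int, 0 <= n -> fcoef g n = fcoef h n)).
by exists g.
Qed.

Lemma eq_Pplus f g : (forall n : int, 0 <= n -> fcoef f n = fcoef g n) ->
  Pplus p f = Pplus p g.
Proof.
move=> fg; rewrite /Pplus; congr ClassicalEpsilon.epsilon; apply/funext => h.
by apply/propext; split=> -[hh e]; split => // n n0; rewrite e// fg.
Qed.

Lemma Hinf_ball_cmeas (b : R -> R[i]) : Hinf_ball b -> cmeas b.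
Proof. by case. Qed.

Lemma Hinf_ball_le1 (b : R -> R[i]) : Hinf_ball b -> aeT (fun t => cabs (b t) <= 1).
Proof. by case=> _ []. Qed.

Lemma Hinf_ball_cintg (b : R -> R[i]) : Hinf_ball b -> cintg b.
Proof.
by move=> hb; exact: cintg_bounded (Hinf_ball_cmeas hb) (Hinf_ball_le1 hb).
Qed.

Lemma cmeas_cconj (b : R -> R[i]) : cmeas b -> cmeas (cconj b).
Proof. exact: cmeasJ. Qed.

Lemma cconj_le1 (b : R -> R[i]) : aeT (fun t => cabs (b t) <= 1) ->
  aeT (fun t => cabs (cconj b t) <= 1).
Proof. by move=> hb; apply: (aeT_sub hb) => t _; rewrite cabs_conj. Qed.

Lemma Lp_cconjM (b f : R -> R[i]) : Hinf_ball b -> Lp p f -> Lp p (fun t => cconj b t * f t).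
Proof.
move=> hb hf.
exact (LpMb p1 hf (cmeas_cconj (Hinf_ball_cmeas hb)) (cconj_le1 (Hinf_ball_le1 hb))).
Qed.

Lemma Ip_cconjM (b f : R -> R[i]) : Hinf_ball b -> Lp p f ->
  Ip p (fun t => cconj b t * f t) <= Ip p f.
Proof.
move=> hb hf.
have := IpMb p1 hf (cmeas_cconj (Hinf_ball_cmeas hb)) (cconj_le1 (Hinf_ball_le1 hb)).
by rewrite powR1 mul1r.
Qed.

Lemma fcoef_cconjM_trig (b : R -> R[i]) n (q : {poly R[i]}) (m : int) : Hinf_ball b ->
  fcoef (fun t => cconj b t * trig n q t) m =
  \sum_(k < size q) q`_k * ((fcoef b (Posz k - Posz n - m))^*)%R.
Proof.
move=> hb; have cb := Hinf_ball_cintg hb.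
have cJ : cintg (cconj b).
  by apply: cintg_bounded (cmeas_cconj (Hinf_ball_cmeas hb)) (cconj_le1 (Hinf_ball_le1 hb)).
rewrite (_ : (fun t => _) = (fun t => \sum_(k < size q) q`_k * (expi ((Posz k - Posz n)%:~R * t) * cconj b t))); last first.
  apply/funext => t; rewrite /trig horner_coef mulr_sumr mulr_sumr; apply: eq_bigr => k _.
  have -> : expi ((Posz k - Posz n)%:~R * t) = expi ((- Posz n)%:~R * t) * expi t ^+ k.
    by rewrite -expiMn -expiD intrB intrN; congr expi; ring.
  by rewrite expiXV; ring.
have cs (k : nat) : cintg (fun t => expi ((Posz k - Posz n)%:~R * t) * cconj b t).
  apply: (@cintgMb _ (cconj b) _ 1) => //; first exact: cmeas_expi.
  by apply: aeT_all => t _; rewrite cabs_expi.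
rewrite fcoef_sum; last by move=> k; apply: cintgZ.
apply: eq_bigr => k _; rewrite fcoefZ// fcoef_shift fcoefJ//; congr (_ * _^*).
by congr fcoef; rewrite opprB.
Qed.

(** For a trigonometric polynomial with only negative frequencies, the coefficients of the product
    involve coefficients of [b] at negative indices only. For general [k] the projection [g]
    vanishes almost everywhere, so the analytic part of an approximating polynomial is small and can
    be discarded. *)
Lemma antianalytic_mul (b k : R -> R[i]) : Hinf_ball b -> Lp p k ->
  (forall n : int, 0 <= n -> fcoef k n = 0) ->
  forall n : int, 0 <= n -> fcoef (fun t => cconj b t * k t) n = 0.
Proof.
move=> hb hk k0 m m0; have [C _ hC] := riesz_extension.
have [g [gp _ g1 g2 happ]] := hC k hk.
have Z : Lp p (fun=> 0 : R[i]).
  by apply: (@Lp_bounded _ _ p1 _ 0); [exact: cmeas_cst|apply: aeT_all => t _; rewrite cabs0].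
have g0 : aeT (fun t => g t = 0).
  apply: (eq_fcoef_ae gp Z) => n; rewrite (_ : fcoef (fun=> 0) n = 0); last first.
    rewrite /fcoef (_ : (fun t => _) = (fun=> 0 : R[i])) ?cint0 ?mulr0//.
    by apply/funext => t; rewrite mul0r.
  by have [n0|n0] := leP 0 n; [rewrite g1// k0|exact: g2].
apply: (fcoef_approx p1 (Lp_cconjM hb hk)) => e e0.
pose c : R := 2 `^ p; have c0 : 0 < c by exact: powR_gt0.
have d0 : 0 < e / c / 2 by rewrite !divr_gt0.
have [n [q [h1 h2]]] := happ _ d0.
pose A := take_poly n q.
have AE t : trig n A t = trig n q t - (drop_poly n q).[expi t].
  have qE : q.[expi t] = A.[expi t] + (drop_poly n q).[expi t] * expi t ^+ n.
    by rewrite -{1}(poly_take_drop n q) hornerD hornerM hornerXn.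
  by rewrite /trig qE mulrDr mulrCA mulVf ?expiX_neq0// mulr1 addrK.
have Ap := Lp_trig n A p1.
have qp := Lp_trig n q p1.
have Dp := Lp_poly p1 (drop_poly n q).
exists (fun t => cconj b t * trig n A t); split; first exact (Lp_cconjM hb Ap).
  have -> : Ip p (fun t => cconj b t * trig n A t - cconj b t * k t) =
      Ip p (fun t => cconj b t * (trig n A t - k t)).
    by apply: eq_Ip => t _; rewrite mulrBr.
  apply: (le_lt_trans (Ip_cconjM hb (LpB p1 Ap hk))).
  have -> : Ip p (fun t => trig n A t - k t) =
      Ip p (fun t => (trig n q t - k t) - ((drop_poly n q).[expi t] - g t)).
    refine (eq_ae_Ip p (Lp_cmeas (LpB p1 Ap hk)) (Lp_cmeas (LpB p1 (LpB p1 qp hk) (LpB p1 Dp gp))) _).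
    by apply: (aeT_sub g0) => t _ ->; rewrite AE subr0 addrAC.
  apply: (le_lt_trans (IpB p1 (LpB p1 qp hk) (LpB p1 Dp gp))).
  rewrite -ltr_pdivlMl//; apply: (lt_le_trans (ltrD h1 h2)).
  by rewrite -splitr mulrC.
rewrite fcoef_cconjM_trig//; apply: big1 => j _.
have jn : (j < n)%N by rewrite (leq_trans (ltn_ord j))// size_take_poly.
rewrite (proj2 (proj2 hb)) ?rmorph0 ?mulr0//.
by rewrite subr_lt0 (lt_le_trans _ m0)// subr_lt0 ltz_nat.
Qed.

Lemma fcoef_expiN (f : R -> R[i]) (n : int) :
  fcoef (fun t => expi (- t) * f t) n = fcoef f (n + 1).
Proof.
have -> : (fun t => expi (- t) * f t) = (fun t => expi ((-1 : int)%:~R * t) * f t).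
  by apply/funext => t; rewrite mulN1r.
by rewrite fcoef_shift opprK.
Qed.

(* Up to conjugation and a shift, this is [antianalytic_mul] for
   [expi (- t) * cconj b2 t]. *)
Lemma Hinf_ballM (b1 b2 : R -> R[i]) : Hinf_ball b1 -> Hinf_ball b2 ->
  Hinf_ball (fun t => b1 t * b2 t).
Proof.
move=> h1 h2; have m1 := Hinf_ball_cmeas h1; have m2 := Hinf_ball_cmeas h2.
have le1 : aeT (fun t => cabs (b1 t * b2 t) <= 1).
  apply: (aeT_sub (aeT_and (Hinf_ball_le1 h1) (Hinf_ball_le1 h2))) => t _ [l1 l2].
  by rewrite cabsM mulr_ile1 ?cabs_ge0.
split; first exact: cmeasM; split; first exact: le1.
move=> n n0.
have cc := cintg_bounded (cmeasM m1 m2) le1.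
(* The extra factor e^{-it} moves the constant term of \bar b2 to frequency -1, so that only
   negative frequencies are left. *)
have lp2 : Lp p (fun t => expi (- t) * cconj b2 t).
  apply: (@Lp_bounded _ _ p1 _ 1).
    apply: cmeasM (cmeas_cconj m2).
    by apply: eq_cmeas (cmeas_expi (- 1)) => t; rewrite mulN1r.
  by apply: (aeT_sub (cconj_le1 (Hinf_ball_le1 h2))) => t _; rewrite cabsM cabs_expi mul1r.
have z2 m : 0 <= m -> fcoef (fun t => expi (- t) * cconj b2 t) m = 0.
  move=> m0; rewrite fcoef_expiN fcoefJ; last exact: Hinf_ball_cintg.
  by rewrite (proj2 (proj2 h2)) ?rmorph0// oppr_lt0 ltr_wpDl.
have h := antianalytic_mul h1 lp2 z2.
have m0 : 0 <= - n - 1 by lia.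
have := h _ m0.
rewrite (_ : (fun t => _) = (fun t => expi (- t) * cconj (fun s => b1 s * b2 s) t)); last first.
  by apply/funext => t; rewrite mulrCA /cconj rmorphM.
rewrite fcoef_expiN subrK fcoefJ// opprK => /eqP.
by rewrite conjC_eq0 => /eqP.
Qed.
End projection.

(** * Recovering Taylor coefficients from values in the disc *)

Section hval_fcoef.
Variable R : realType.

(* The Taylor coefficients are isolated by the finite geometric expansion
   [1 / (1 - w) = \sum_(i <= j) w ^ i + w ^ j.+1 / (1 - w)]. *)
Lemma hval_taylor (B : R -> R[i]) (j : nat) (r : R) : cmeas B ->
  aeT (fun t => cabs (B t) <= 1) -> 0 < r < 1 ->
  cabs (hval B (r%:C)%C - \sum_(i < j.+1) fcoef B (Posz i) * (r%:C)%C ^+ i) <=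
  2 * (r ^+ j.+1 / (1 - r)).
Proof.
move=> mB hB /andP[r0 r1].
have cB : cintg B := cintg_bounded mB hB.
pose w t : R[i] := (r%:C)%C * expi (- t).
have cw t : cabs (w t) = r by rewrite /w cabsM cabs_expi mulr1 cabs_real gtr0_norm.
have w1 t : 1 - w t != 0.
  by rewrite subr_eq0; apply/eqP => e; move: r1; rewrite -(cw t) -e cabs1 ltxx.
have mw : cmeas w.
  apply: cmeasM; first exact: cmeas_cst.
  by apply: eq_cmeas (cmeas_expi (- 1)) => t; rewrite mulN1r.
have cw1 t : 1 - r <= cabs (1 - w t).
  by rewrite lerBlDr -(cw t) -{1}(cabs1 R) -{1}(subrK (w t) 1) cabsD.
have r1' : 0 < 1 - r by rewrite subr_gt0.
have mV : cmeas (fun t => (1 - w t)^-1).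
  have hd x : cdiff (fun t => (1 - w t)^-1) x.
    apply: cdiffV => //; rewrite (_ : (fun t => 1 - w t) = (fun t => (1 - (r%:C)%C *: 'X).[(expi t)^-1])).
      by apply/cdiff_horner/cdiffV; [exact: (expiX_neq0 x 1)|exact: cdiff_expi].
    apply/funext => t; rewrite hornerD hornerN hornerZ hornerX hornerC /w.
    by rewrite -[expi t in RHS]expr1 expiXV mulN1r.
  split; apply: measurable_funTS; apply: continuous_measurable_fun.
    exact: cdiff_Re.
  exact: cdiff_Im.
have Vle t : cabs (1 - w t)^-1 <= (1 - r)^-1.
  by rewrite cabsV lef_pV2 ?posrE ?(lt_le_trans r1').
have cX i : cintg (fun t => B t * w t ^+ i).
  rewrite (_ : (fun t => _) = (fun t => w t ^+ i * B t)); last by apply/funext => t; rewrite mulrC.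
  apply: (cintgMb cB (cmeasX i mw) (M := 1)); apply: aeT_all => t _.
  by rewrite cabsX cw exprn_ile1// ltW.
have cV : cintg (fun t => B t / (1 - w t)).
  rewrite (_ : (fun t => _) = (fun t => (1 - w t)^-1 * B t)); last by apply/funext => t; rewrite mulrC.
  by apply: (cintgMb cB mV (M := (1 - r)^-1)); apply: aeT_all => t _.
have fE i : fcoef B (Posz i) * (r%:C)%C ^+ i =
    (((2 * pi)^-1)%:C)%C * cint (fun t => B t * w t ^+ i).
  rewrite /fcoef -mulrA; congr (_ * _); rewrite mulrC -cintZ; last exact: cintg_mul_expi.
  congr cint; apply/funext => t; rewrite /w exprMn -expiMn mulrCA.
  by congr (_ * (_ * expi _)); rewrite mulrN.
under eq_bigr do rewrite fE.
rewrite -mulr_sumr /hval -mulrBr -cint_sum; last by [].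
rewrite -cintB//; last exact: cintg_sum.
have E t : B t / (1 - w t) - \sum_(i < j.+1) B t * w t ^+ i = w t ^+ j.+1 * (B t / (1 - w t)).
  apply: (mulIf (w1 t)); rewrite mulrBl -[RHS]mulrA !divfK//.
  have := subrX1 (w t) j.+1; rewrite -mulr_sumr; move: (\sum_(i < _) _) (w t ^+ _) => S x hx.
  have -> : x = (w t - 1) * S + 1 by rewrite -hx subrK.
  by ring.
rewrite (_ : (fun t => _) = (fun t => w t ^+ j.+1 * (B t / (1 - w t)))); last by apply/funext => t; exact: E.
have cE : cintg (fun t => w t ^+ j.+1 * (B t / (1 - w t))).
  apply: (cintgMb cV (cmeasX _ mw) (M := 1)); apply: aeT_all => t _.
  by rewrite cabsX cw exprn_ile1// ltW.
have pi2 : 0 < 2 * pi :> R by rewrite mulr_gt0 ?pi_gt0.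
rewrite cabsM cabs_real gtr0_norm ?invr_gt0// ler_pdivrMl//.
apply: le_trans (cabs_cint cE) _; rewrite mulrCA ler_pM2l// [X in _ <= X]mulrC -It_cst.
apply: le_ae_It; [exact: cE.2|exact: intg_cst|].
apply: (aeT_sub hB) => t _ Bt; rewrite cabsM cabsX cw ler_wpM2l ?exprn_ge0 ?(ltW r0)//.
by rewrite cabsM -[X in _ <= X]mul1r ler_pM ?cabs_ge0.
Qed.

(** The last error term depends on [r] alone, not on [B] or [j], so it can be made small before
    letting [B] vary. *)
Lemma cabs_fcoef_le_hval (B : R -> R[i]) (j : nat) (r : R) : cmeas B ->
  aeT (fun t => cabs (B t) <= 1) -> 0 < r < 1 ->
  cabs (fcoef B (Posz j)) <= r ^- j * (cabs (hval B (r%:C)%C) +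
    \sum_(i < j) cabs (fcoef B (Posz i))) + 2 * (r / (1 - r)).
Proof.
move=> mB hB r01; have := hval_taylor j mB hB r01; have /andP[r0 r1] := r01.
rewrite big_ord_recr/=; set h := hval _ _; set S := \sum_(i < j) _; set a := fcoef _ _ => hT.
have rj : 0 < r ^+ j by rewrite exprn_gt0.
have r1' : 0 < 1 - r by rewrite subr_gt0.
have Sle : cabs S <= \sum_(i < j) cabs (fcoef B (Posz i)).
  apply: le_trans (cabs_sum _ _ _) _; apply: ler_sum => i _.
  rewrite cabsM cabsX cabs_real gtr0_norm// ler_piMr ?cabs_ge0// exprn_ile1 ?ltW//.
rewrite -(ler_pM2l rj) mulrDr mulVKf ?gt_eqF//.
have -> : r ^+ j * (2 * (r / (1 - r))) = 2 * (r ^+ j.+1 / (1 - r)).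
  by rewrite exprSr; ring.
have -> : r ^+ j * cabs a = cabs (a * (r%:C)%C ^+ j).
  by rewrite cabsM cabsX cabs_real gtr0_norm// mulrC.
have -> : a * (r%:C)%C ^+ j = (h - S) - (h - (S + a * (r%:C)%C ^+ j)) by ring.
apply: le_trans (cabsB _ _) _; apply: lerD => //.
by apply: le_trans (cabsB _ _) _; rewrite lerD2l.
Qed.

Lemma cvg0_sum (I : finType) (f : I -> nat -> R) :
  (forall i, f i n @[n --> \oo] --> (0 : R)) ->
  \sum_i f i n @[n --> \oo] --> (0 : R).
Proof.
move=> hf; elim: (index_enum I) => [|i r IH].
  by rewrite (_ : (fun n => _) = (fun=> 0)); [exact: cvg_cst|apply/funext => n; rewrite big_nil].
rewrite (_ : (fun n => _) = (fun n => f i n + \sum_(j <- r) f j n)); last first.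
  by apply/funext => n; rewrite big_cons.
by rewrite -[X in _ --> X]addr0; apply: cvgD.
Qed.

(** Strong induction on [j]: once the lower coefficients tend to 0, the values at one small radius
    control the next one. *)
Lemma fcoef_cvg0 (B : nat -> R -> R[i]) :
  (forall n, cmeas (B n)) -> (forall n, aeT (fun t => cabs (B n t) <= 1)) ->
  (forall z : R[i], cabs z < 1 -> cabs (hval (B n) z) @[n --> \oo] --> (0 : R)) ->
  forall j, cabs (fcoef (B n) (Posz j)) @[n --> \oo] --> (0 : R).
Proof.
move=> mB hB hz j; elim/ltn_ind: j => j IH.
apply/cvgrPdist_lt => e e0.
(* The solution of 2 r / (1 - r) = e / 2. *)
pose r := e / (4 + e); have r0 : 0 < r by rewrite divr_gt0 ?addr_gt0.
have r1 : r < 1 by rewrite ltr_pdivrMr ?addr_gt0// mul1r ltrDr.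
have hr : 2 * (r / (1 - r)) = e / 2.
  have e4 : 4 + e != 0 by rewrite gt_eqF// addr_gt0.
  by rewrite /r; field; rewrite e4 /= addrK.
have cr : cabs (r%:C)%C < 1 by rewrite cabs_real gtr0_norm.
have hS : cabs (hval (B n) (r%:C)%C) + \sum_(i < j) cabs (fcoef (B n) (Posz i)) @[n --> \oo] --> (0 : R).
  rewrite -[X in _ --> X]addr0; apply: cvgD; first exact: hz.
  by apply: cvg0_sum => i; exact: IH.
have d0 : 0 < r ^+ j * (e / 2) by apply: mulr_gt0; [exact: exprn_gt0|rewrite divr_gt0].
move/cvgrPdist_lt/(_ _ d0) : hS; apply: filterS => n.
rewrite !sub0r !normrN !ger0_norm ?cabs_ge0//; last first.
  by rewrite addr_ge0 ?cabs_ge0// sumr_ge0// => i _; exact: cabs_ge0.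
move=> hn; have r01 : 0 < r < 1 by rewrite r0.
apply: (le_lt_trans (cabs_fcoef_le_hval j (mB n) (hB n) r01)).
by rewrite hr [X in _ < X](splitr e) ltrD2r ltr_pdivrMl ?(exprn_gt0 j r0).
Qed.
End hval_fcoef.

(** * The telescoping series *)

Section products.
Variables (R : realType) (p : R) (b : nat -> R -> R[i]).
Hypothesis p1 : 1 < p.
Hypothesis hb : forall n : nat, (0 < n)%N -> Hinf_ball (b n).

Let p0 : 0 < p. Proof. exact: lt_trans ltr01 p1. Qed.

Lemma Bprod0 t : Bprod b 0 t = 1.
Proof. by rewrite /Bprod big_geq. Qed.

Lemma BprodS n t : Bprod b n.+1 t = Bprod b n t * b n.+1 t.
Proof. by rewrite /Bprod big_nat_recr. Qed.

Lemma Hinf_ball1 : Hinf_ball (fun=> 1 : R[i]).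
Proof.
split; first exact: cmeas_cst.
split; first by apply: aeT_all => t _; rewrite cabs1.
move=> n n0; rewrite (_ : (fun=> 1) = (fun t : R => (1 : {poly R[i]}).[expi t])).
  by rewrite fcoef_poly; case: n n0.
by apply/funext => t; rewrite hornerC.
Qed.

Lemma Hinf_ball_Bprod n : Hinf_ball (Bprod b n).
Proof.
elim: n => [|n IH].
  by rewrite (_ : Bprod b 0 = (fun=> 1)); [exact: Hinf_ball1|apply/funext => t; exact: Bprod0].
rewrite (_ : Bprod b n.+1 = (fun t => Bprod b n t * b n.+1 t)).
  by apply: (Hinf_ballM p1) => //; exact: hb.
by apply/funext => t; exact: BprodS.
Qed.

Variable f : R -> R[i].
Hypothesis hf : Hp p f.

Definition TB n : R -> R[i] := Toep p (cconj (Bprod b n)) f.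

Let fp : Lp p f := hf.1.

Lemma TB_spec n : Hp p (TB n) /\
  forall m : int, 0 <= m -> fcoef (TB n) m = fcoef (fun t => cconj (Bprod b n) t * f t) m.
Proof. exact: (Pplus_spec p1 (Lp_cconjM p1 (Hinf_ball_Bprod n) fp)). Qed.

Lemma TB_Lp n : Lp p (TB n).
Proof. by case: (TB_spec n) => -[]. Qed.

(* The defining predicates of the two choices coincide, so they are equal as
   functions and not only almost everywhere. *)
Lemma Toep_TB n : Toep p (cconj (b n.+1)) (TB n) = TB n.+1.
Proof.
have hn := Hinf_ball_Bprod n; have hbn := hb (ltn0Sn n).
have Fp := Lp_cconjM p1 hn fp.
apply: eq_Pplus => m m0.
pose k t := TB n t - cconj (Bprod b n) t * f t.
have kp : Lp p k := LpB p1 (TB_Lp n) Fp.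
have k0 j : 0 <= j -> fcoef k j = 0.
  move=> j0; rewrite (fcoefB _ (Lp_cintg p1 (TB_Lp n)) (Lp_cintg p1 Fp)).
  by rewrite ((TB_spec n).2 j j0) subrr.
have := antianalytic_mul p1 hbn kp k0 m0.
have -> : (fun t => cconj (b n.+1) t * k t) =
    (fun t => cconj (b n.+1) t * TB n t - cconj (Bprod b n.+1) t * f t).
  by apply/funext => t; rewrite mulrBr mulrA /cconj BprodS rmorphM [X in _ - X * _]mulrC.
rewrite (fcoefB _ (Lp_cintg p1 (Lp_cconjM p1 hbn (TB_Lp n)))
  (Lp_cintg p1 (Lp_cconjM p1 (Hinf_ball_Bprod n.+1) fp))).
by move/eqP; rewrite subr_eq0 => /eqP.
Qed.

(** The sum telescopes at every point, but its first term is [TB 0], the chosen projection of [f],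
    which agrees with [f] only almost everywhere; hence the residue f - TB 0. *)
Lemma partial_sum N t : f t - \sum_(1 <= n < N.+1)
    (Bprod b n.-1 t * Qb p (b n) (Toep p (cconj (Bprod b n.-1)) f) t) =
  (f t - TB 0 t) + Bprod b N t * TB N t.
Proof.
rewrite big_add1/= (eq_bigr (fun n => - (Bprod b n.+1 t * TB n.+1 t - Bprod b n t * TB n t))).
  by rewrite sumrN telescope_sumr// Bprod0 mul1r; ring.
move=> n _; rewrite /Qb /Pb -/(TB n) Toep_TB BprodS; ring.
Qed.

Lemma TB0_ae : aeT (fun t => f t = TB 0 t).
Proof.
apply: (eq_fcoef_ae p1 fp (TB_Lp 0)) => n; have [n0|n0] := leP 0 n; last first.
  by rewrite (hf.2)// ((TB_spec 0).1.2).
rewrite ((TB_spec 0).2 n n0); apply: eq_fcoef => t.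
by rewrite /cconj Bprod0 rmorph1 mul1r.
Qed.

Lemma Ip_partial_sum N : Ip p (fun t => f t - \sum_(1 <= n < N.+1)
    (Bprod b n.-1 t * Qb p (b n) (Toep p (cconj (Bprod b n.-1)) f) t)) <= Ip p (TB N).
Proof.
have hB := Hinf_ball_Bprod N; have [mB B1] := (Hinf_ball_cmeas hB, Hinf_ball_le1 hB).
rewrite (@eq_Ip _ p _ (fun t => (f t - TB 0 t) + Bprod b N t * TB N t)); last first.
  by move=> t _; rewrite partial_sum.
have BT := LpMb p1 (TB_Lp N) mB B1.
have -> : Ip p (fun t => (f t - TB 0 t) + Bprod b N t * TB N t) =
    Ip p (fun t => Bprod b N t * TB N t).
  apply: (eq_ae_Ip p (Lp_cmeas (LpD p1 (LpB p1 fp (TB_Lp 0)) BT)) (Lp_cmeas BT)).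
  by apply: (aeT_sub TB0_ae) => t _ ->; rewrite subrr add0r.
by have := IpMb p1 (TB_Lp N) mB B1; rewrite powR1 mul1r.
Qed.

Hypothesis hB0 : forall z : R[i], cabs z < 1 ->
  (fun n : nat => cabs (hval (Bprod b n) z)) @ \oo --> (0 : R).

Lemma fcoef_Bprod_cvg0 (m : int) : cabs (fcoef (Bprod b n) m) @[n --> \oo] --> (0 : R).
Proof.
case: m => j.
  apply: (@fcoef_cvg0 _ (Bprod b)) => // n; have h := Hinf_ball_Bprod n.
    exact: Hinf_ball_cmeas.
  exact: Hinf_ball_le1.
rewrite (_ : (fun n => _) = (fun=> 0)); first exact: cvg_cst.
by apply/funext => n; rewrite (Hinf_ball_Bprod n).2.2 ?cabs0.
Qed.

Lemma TB_cvg0 : Ip p (TB n) @[n --> \oo] --> (0 : R).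
Proof.
have [C C0 hC] := riesz_extension p1.
pose c : R := 2 `^ p; have c0 : 0 < c by exact: powR_gt0.
apply/cvgrPdist_lt => e e0.
have d0 : 0 < e / c / 2 by rewrite !divr_gt0.
have [m [q hq]] := density p1 fp (divr_gt0 d0 C0).
have qp := Lp_trig m q p1.
pose a n j := fcoef (fun t => cconj (Bprod b n) t * trig m q t) (Posz j).
have aE n j : a n j = \sum_(k < size q) q`_k * ((fcoef (Bprod b n) (Posz k - Posz m - Posz j))^*)%R.
  exact: fcoef_cconjM_trig (Hinf_ball_Bprod n).
(* The projection of \bar B_n times the trigonometric polynomial: multiplying by \bar B_n never
   raises frequencies, so [size q] bounds the degree for every n. *)
pose r n : {poly R[i]} := \poly_(j < size q) a n j.
have rE n j : (r n)`_j = a n j.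
  rewrite coef_poly; case: ltnP => // qj; rewrite aE big1// => k _.
  rewrite (Hinf_ball_Bprod n).2.2 ?rmorph0 ?mulr0//.
  by have := ltn_ord k; lia.
pose M n := \sum_(j < size q) \sum_(k < size q) cabs q`_k * cabs (fcoef (Bprod b n) (Posz k - Posz m - Posz j)).
have rM n t : cabs (r n).[expi t] <= M n.
  rewrite (@horner_coef_wide _ (size q)); last exact: size_poly.
  apply: le_trans (cabs_sum _ _ _) _; apply: ler_sum => j _.
  rewrite cabsM cabsX cabs_expi expr1n mulr1 rE aE.
  apply: le_trans (cabs_sum _ _ _) _; apply: ler_sum => k _.
  by rewrite cabsM cabs_conj.
have M0 n : 0 <= M n.
  by apply: sumr_ge0 => j _; apply: sumr_ge0 => k _; rewrite mulr_ge0 ?cabs_ge0.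
have Mcvg : M n @[n --> \oo] --> (0 : R).
  apply: (@cvg0_sum R 'I_(size q)) => j; apply: (@cvg0_sum R 'I_(size q)) => k.
  rewrite -[X in _ --> X](mulr0 (cabs q`_k)).
  by apply: cvgM; [exact: cvg_cst|exact: fcoef_Bprod_cvg0].
have Mp : M n `^ p * (2 * pi) @[n --> \oo] --> (0 : R).
  have := cvg_powR p0 M0 Mcvg; rewrite powR0 ?gt_eqF// => h.
  by rewrite -[X in _ --> X](mul0r (2 * pi)); apply: cvgM; [exact: h|exact: cvg_cst].
have bound n : Ip p (TB n) <= c * (C * Ip p (fun t => trig m q t - f t) + M n `^ p * (2 * pi)).
  have hB := Hinf_ball_Bprod n.
  have dp := LpB p1 fp qp.
  have Bdp := Lp_cconjM p1 hB dp.
  have [g [gp gle g1 g2 _]] := hC _ Bdp.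
  have rp := Lp_poly p1 (r n).
  (* Projections obtained by choice need not add up pointwise; the decomposition is checked on
     Fourier coefficients, which determine the integral. *)
  have -> : Ip p (TB n) = Ip p (fun t => g t + (r n).[expi t]).
    apply: (eq_fcoef_Ip p1 (TB_Lp n) (LpD p1 gp rp)) => j.
    rewrite (fcoefD _ (Lp_cintg p1 gp) (Lp_cintg p1 rp)) fcoef_poly.
    case: j => j; last by rewrite (TB_spec n).1.2// g2// addr0.
    rewrite ((TB_spec n).2 (Posz j) isT) g1// rE /a.
    rewrite -(fcoefD _ (Lp_cintg p1 Bdp) (Lp_cintg p1 (Lp_cconjM p1 hB qp))).
    by apply: eq_fcoef => t; rewrite -mulrDr subrK.
  apply: (le_trans (IpD p1 gp rp)); rewrite (ler_pM2l c0); apply: lerD.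
    apply: (le_trans gle); rewrite (ler_pM2l C0) (Ip_sym p (trig m q) f).
    exact (Ip_cconjM p1 hB dp).
  apply: (Ip_bounded p1 (cmeas_poly (r n))); exact: aeT_all.
move/cvgrPdist_lt/(_ _ d0) : Mp; apply: filterS => n.
rewrite !sub0r !normrN => hn; rewrite ger0_norm ?Ip_ge0//.
apply: (le_lt_trans (bound n)); rewrite -ltr_pdivlMl//.
rewrite ltr_pdivlMr// mulrC in hq.
apply: (lt_le_trans (ltrD hq (le_lt_trans (ler_norm _) hn))).
by rewrite -splitr mulrC.
Qed.

End products.

Theorem theorem3p1 (R : realType) (p : R) (b : nat -> R -> R[i]) :
  1 < p ->
  (forall n : nat, (0 < n)%N -> Hinf_ball (b n)) ->
  (forall z : R[i], cabs z < 1 ->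
     (fun n : nat => cabs (hval (Bprod b n) z)) @ \oo --> (0 : R)) ->
  forall f : R -> R[i], Hp p f ->
  (fun N : nat =>
     Lpnorm p (fun t => f t - \sum_(1 <= n < N.+1)
        (Bprod b n.-1 t * Qb p (b n) (Toep p (cconj (Bprod b n.-1)) f) t)))
    @ \oo --> (0 : R).
Proof.
move=> p1 hb hB f hf.
have p0 : 0 < p := lt_trans ltr01 p1.
pose u N := Ip p (fun t => f t - \sum_(1 <= n < N.+1)
        (Bprod b n.-1 t * Qb p (b n) (Toep p (cconj (Bprod b n.-1)) f) t)).
have u0 N : 0 <= u N by exact: Ip_ge0.
have hu : u @ \oo --> (0 : R).
  apply: (@squeeze_cvgr _ _ _ _ (fun=> 0) (fun N => Ip p (TB p b f N))).
  - by apply: nearW => N; rewrite u0/=; exact: Ip_partial_sum.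
  - exact: cvg_cst.
  - exact: TB_cvg0.
(* [Lpnorm] is [u] raised to the power 1/p, so only continuity of this power at 0 is left. *)
have pV : 0 < p^-1 by rewrite invr_gt0.
have := cvg_powR pV u0 hu.
by rewrite powR0 ?gt_eqF.
Qed.
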